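(* Let $n\ge1$, let $0\le\alpha<1$, and let $f=(f_1,\dots,f_n)'\in Q_B^{\alpha}(D^n)$, i.e. $f:D^n\to\mathbb{C}^n$ is a normalized quasi-convex mapping of type B and order $\alpha$ on the unit polydisk. Suppose that there are complex numbers $a_{kl}$ ($1\le k,l\le n$) with $$\frac{D^2f_k(0)(z^2)}{2!}=z_k\left(\sum_{l=1}^n a_{kl}z_l\right),\qquad k=1,\dots,n,$$ for all $z$. Then $$\frac{\|D^3f(0)(z^3)\|}{3!}\le\frac{(1-\alpha)(3-2\alpha)}{3}\|z\|^3\qquad\text{for all } z\in D^n .$$ This estimate is sharp: for each $n$ and $\alpha$ the constant $\frac{(1-\alpha)(3-2\alpha)}{3}$ cannot be replaced by a smaller one valid for all such $f$ and all $z\in D^n$.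
   Context: $\mathbb{C}^n$ carries the norm $\|z\|=\max_{1\le k\le n}|z_k|$, and $D^n=\{z\in\mathbb{C}^n:\|z\|<1\}$ is its open unit ball. For $x\ne0$, $T(x)=\{T_x\in(\mathbb{C}^n)^*:\|T_x\|=1,\ T_x(x)=\|x\|\}$. For a holomorphic map $f$ on $D^n$, $D^mf(x)$ is the $m$-th Fréchet derivative at $x$ (a symmetric $m$-linear map) and $D^mf(x)(y^m)=D^mf(x)(y,\dots,y)$; $D^mf_k$ denotes the derivative of the $k$-th component. $f:D^n\to\mathbb{C}^n$ is normalized if $f(0)=0$, $Df(0)=I$, and locally biholomorphic if $Df(x)$ is invertible for each $x\in D^n$. $Q_B^\alpha(D^n)$ (quasi-convex mappings of type B and order $\alpha$) is the family of normalized locally biholomorphic mappings $f:D^n\to\mathbb{C}^n$ such that $\mathrm{Re}\{T_x[(Df(x))^{-1}(D^2f(x)(x^2)+Df(x)x)]\}\ge\alpha\|x\|$ for all $x\in D^n\setminus\{0\}$ and all $T_x\in T(x)$. *)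

(* Defs.v *)
From mathcomp Require Import all_boot all_order all_algebra.
From mathcomp Require Import complex.
From mathcomp Require Import all_classical all_reals all_analysis.

Set Implicit Arguments.
Unset Strict Implicit.
Unset Printing Implicit Defensive.

Import Order.TTheory GRing.Theory Num.Theory.
Import numFieldNormedType.Exports.

Local Open Scope classical_set_scope.
Local Open Scope ring_scope.

(* Packing R[i] as a [numClosedFieldType] gives it, and the matrices over it,
   the topology and norm of the analysis library: the modulus on [Cplx R] and
   the sup norm on 'rV[Cplx R]_n. *)
Definition Cplx (R : realType) : numClosedFieldType := R[i].

Definition ReC (R : realType) (z : Cplx R) : R := complex.Re z.

(* The library norm `|x| is the same number, seen as an element of [Cplx R]. *)
Definition rnorm (R : realType) (V : normedModType (Cplx R)) (x : V) : R :=
  ReC `|x|.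

Definition polydisk (R : realType) (n : nat) : set 'rV[Cplx R]_n :=
  [set z | rnorm z < 1].

(* [frechetD f [:: v1; ..; vm] x] is D^m f(x)(v1, .., vm), all derivatives being
   complex ones.  The derivative of an operator-valued map is computed after
   evaluation at fixed vectors: in finite dimension this is the same thing. *)
Fixpoint frechetD (R : realType) (n : nat) (W : normedModType (Cplx R))
    (f : 'rV[Cplx R]_n -> W) (vs : seq 'rV[Cplx R]_n) : 'rV[Cplx R]_n -> W :=
  if vs is v :: vs' then fun x => 'd (frechetD f vs') x v else f.

Definition Dpow (R : realType) (n : nat) (W : normedModType (Cplx R)) (m : nat)
    (f : 'rV[Cplx R]_n -> W) (x y : 'rV[Cplx R]_n) : W :=
  frechetD f (nseq m y) x.

Definition component (R : realType) (n : nat)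
    (f : 'rV[Cplx R]_n -> 'rV[Cplx R]_n) (k : 'I_n) : 'rV[Cplx R]_n -> Cplx R :=
  fun x => f x ord0 k.

Definition holomorphic_on_polydisk (R : realType) (n : nat)
    (f : 'rV[Cplx R]_n -> 'rV[Cplx R]_n) : Prop :=
  forall x, polydisk x -> differentiable f x.

Definition normalized (R : realType) (n : nat)
    (f : 'rV[Cplx R]_n -> 'rV[Cplx R]_n) : Prop :=
  f 0 = 0 /\ forall v, 'd f 0 v = v.

(* Row-vector convention: Df(x) v = v *m 'J f x, hence
   (Df(x))^-1 w = w *m invmx ('J f x). *)
Definition locally_biholomorphic (R : realType) (n : nat)
    (f : 'rV[Cplx R]_n -> 'rV[Cplx R]_n) : Prop :=
  forall x, polydisk x -> 'J f x \in unitmx.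

Definition invD (R : realType) (n : nat) (f : 'rV[Cplx R]_n -> 'rV[Cplx R]_n)
    (x w : 'rV[Cplx R]_n) : 'rV[Cplx R]_n :=
  w *m invmx ('J f x).

Definition dual_norm (R : realType) (n : nat)
    (T : {scalar 'rV[Cplx R]_n}) : R :=
  sup [set rnorm (T y) | y in [set y : 'rV[Cplx R]_n | rnorm y <= 1]].

Definition support_functional (R : realType) (n : nat) (x : 'rV[Cplx R]_n)
    (T : {scalar 'rV[Cplx R]_n}) : Prop :=
  dual_norm T = 1 /\ T x = `|x|.

Definition quasi_convex_B (R : realType) (n : nat) (alpha : R)
    (f : 'rV[Cplx R]_n -> 'rV[Cplx R]_n) : Prop :=
  [/\ holomorphic_on_polydisk f, normalized f, locally_biholomorphic f &
      forall x, polydisk x -> x != 0 ->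
      forall T : {scalar 'rV[Cplx R]_n}, support_functional x T ->
        ReC (T (invD f x (Dpow 2 f x x + 'd f x x))) >= alpha * rnorm x].

Definition second_order_form (R : realType) (n : nat)
    (f : 'rV[Cplx R]_n -> 'rV[Cplx R]_n) (a : 'M[Cplx R]_n) : Prop :=
  forall (z : 'rV[Cplx R]_n) (k : 'I_n),
    Dpow 2 (component f k) 0 z / (2`!)%:R =
      z ord0 k * \sum_(l < n) a k l * z ord0 l.

Definition third_order_bound (R : realType) (n : nat) (c : R)
    (f : 'rV[Cplx R]_n -> 'rV[Cplx R]_n) : Prop :=
  forall z : 'rV[Cplx R]_n, polydisk z ->
    rnorm (Dpow 3 f 0 z) / (3`!)%:R <= c * rnorm z ^+ 3.

(* Main.v *)
(* Upper bound.  Let |z| = |z_k| = 1 and let q(w) be the k-th component of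
   Df(wz)^-1 (D^2f(wz)(wz, z) + Df(wz) z).  Applying the hypothesis at x = wz to the
   support functional y |-> conj(z_k) y_k shows that q(w) / z_k takes the value 1 at 0
   and has real part at least alpha on the disc, so Caratheodory's inequality bounds
   q'(0) and q''(0)/2 by 2(1 - alpha).  Here q'(0) = D^2f_k(0)(z^2), and therefore
   sum_l |a_kl| <= 1 - alpha; moreover
   D^3f_k(0)(z^3) = q''(0)/2 + D^2f_k(0)(z, D^2f(0)(z^2)),
   where the last term is at most 4(1 - alpha)^2 by the special form of D^2f(0).  The
   restriction |z_k| = |z| is removed by the maximum principle in the variable z_k.

   Sharpness.  The map with components F(z_k), F'(z) = (1 - z)^(-b), 0 <= b <= 2(1 - alpha),
   belongs to the family and has F'''(0) = b(b + 1).  Only dyadic exponents b are used: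
   then (1 - z)^(-b) comes from iterated square roots, and b may approach 2(1 - alpha).

   Holomorphy of the iterated derivatives rests on Cauchy's formula on circles, which is
   obtained by Goursat's bisection argument carried out in polar coordinates. *)
From HB Require Import structures.
Require Import Defs.
From mathcomp Require Import all_boot all_order all_algebra.
From mathcomp Require Import ring lra.
From mathcomp Require Import complex.
From mathcomp Require Import all_classical all_reals all_analysis.

Import Order.TTheory GRing.Theory Num.Theory.
Import numFieldNormedType.Exports.

Set Implicit Arguments.
Unset Strict Implicit.
Unset Printing Implicit Defensive.

Local Open Scope classical_set_scope.
Local Open Scope ring_scope.
Local Open Scope complex_scope.

(** * Real-valued norms and differentiability *)

Section RealNorm.
Variable R : realType.
Local Notation C := (Cplx R).

(** A support functional of the sup norm sees only the maximal coordinates, so the hypothesis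
    controls component k directly only where |z_k| = |z|. Yet the term D^2f_k(0)(z, D^2f(0)(z^2))
    involves every component of D^2f(0)(z^2). The special form of D^2f(0) removes this obstacle: row
    k of its coefficients can be tested at a vector all of whose entries are unimodular, and the
    resulting row sum bounds the linear form A_k(z) = sum_l a_kl z_l at every z, for every k. By
    polarization D^2f_k(0)(x, y) = x_k A_k(y) + y_k A_k(x); with x = z and |y| <= 2(1 - alpha) these
    are two terms of size 2(1 - alpha)^2, whence the factor 4. With b = 2(1 - alpha) the total is b
    + b^2 = b(b + 1), which is 3! times the constant and also the third derivative of the extremal
    function with exponent b: the two halves meet because no inequality loses anything there. The
    definition of the class provides first derivatives only, and this is why Cauchy's theory has to
    be built before D^2f and D^3f can be handled. *)

Definition ofR (t : R) : C := t%:C.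
Implicit Types (V W : normedModType C).

(** A nonnegative element of [R[i]] has zero imaginary part, so every norm is an embedded real and
    all estimates can be made in the totally ordered field [R]. *)
Lemma normE V (x : V) : `|x| = ofR (rnorm x).
Proof.
have := normr_ge0 x; rewrite /rnorm /ofR /ReC; case: (`|x|) => a b.
by rewrite lecE /= => /andP[/eqP -> _].
Qed.
Lemma gt0_ofR (e : C) : 0 < e -> exists2 t : R, 0 < t & e = ofR t.
Proof. by case: e => a b; rewrite ltcE /= => /andP[/eqP -> a0]; exists a. Qed.
Lemma rnorm_ge0 V (x : V) : 0 <= rnorm x.
Proof. by have := normr_ge0 x; rewrite normE /ofR lecR. Qed.
Lemma rnormD V (x y : V) : rnorm (x + y) <= rnorm x + rnorm y.
Proof. by have := ler_normD x y; rewrite !normE /ofR -rmorphD lecR. Qed.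
Lemma rnormN V (x : V) : rnorm (- x) = rnorm x.
Proof. by rewrite /rnorm normrN. Qed.
Lemma rnormBC V (x y : V) : rnorm (x - y) = rnorm (y - x).
Proof. by rewrite /rnorm distrC. Qed.
Lemma rnorm0 V : rnorm (0 : V) = 0.
Proof. by rewrite /rnorm normr0. Qed.
Lemma rnorm_eq0 V (x : V) : (rnorm x == 0) = (x == 0).
Proof. by rewrite -[RHS]normr_eq0 normE /ofR -(inj_eq (@complexI R)). Qed.
Lemma rnorm_gt0 V (x : V) : (0 < rnorm x) = (x != 0).
Proof. by rewrite lt_neqAle rnorm_ge0 andbT eq_sym rnorm_eq0. Qed.
Lemma rnormZ V (a : C) (x : V) : rnorm (a *: x) = rnorm a * rnorm x.
Proof. by rewrite {1}/rnorm normrZ !normE /ofR -rmorphM. Qed.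
Lemma rnormM (a b : C) : rnorm (a * b) = rnorm a * rnorm b.
Proof. exact: rnormZ. Qed.
Lemma rnorm1 : rnorm (1 : C) = 1.
Proof. by rewrite /rnorm normr1. Qed.
Lemma rnormV (a : C) : rnorm a^-1 = (rnorm a)^-1.
Proof. by rewrite {1}/rnorm normfV normE /ofR -fmorphV. Qed.
Lemma rnormX (a : C) m : rnorm (a ^+ m) = rnorm a ^+ m.
Proof. by rewrite {1}/rnorm normrX normE /ofR -rmorphXn. Qed.
Lemma rnorm_ofR (t : R) : rnorm (ofR t) = `|t|.
Proof. by rewrite /rnorm normc_def /= expr0n /= addr0 sqrtr_sqr. Qed.
Lemma rnormB V (x y : V) : rnorm (x - y) <= rnorm x + rnorm y.
Proof. by rewrite -(rnormN y) rnormD. Qed.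
Lemma rnorm_sum V (I : Type) (s : seq I) (P : pred I) (F : I -> V) :
  rnorm (\sum_(i <- s | P i) F i) <= \sum_(i <- s | P i) rnorm (F i).
Proof.
elim/big_ind2 : _ => [|x1 x2 y1 y2 h1 h2|//]; first by rewrite rnorm0.
by apply: le_trans (rnormD _ _) _; apply: lerD.
Qed.
Lemma rnorm_def (z : C) : rnorm z = Num.sqrt ((complex.Re z)^+2 + (complex.Im z)^+2).
Proof. by rewrite /rnorm normc_def. Qed.
Lemma abs_Re_le (z : C) : `|complex.Re z| <= rnorm z.
Proof. by rewrite rnorm_def -sqrtr_sqr ler_wsqrtr // lerDl sqr_ge0. Qed.
Lemma abs_Im_le (z : C) : `|complex.Im z| <= rnorm z.
Proof. by rewrite rnorm_def -sqrtr_sqr ler_wsqrtr // lerDr sqr_ge0. Qed.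
Lemma Re_D (x y : C) : complex.Re (x + y) = complex.Re x + complex.Re y.
Proof. by case: x; case: y. Qed.
Lemma Im_D (x y : C) : complex.Im (x + y) = complex.Im x + complex.Im y.
Proof. by case: x; case: y. Qed.
Lemma Re_N (x : C) : complex.Re (- x) = - complex.Re x. Proof. by case: x. Qed.
Lemma Im_N (x : C) : complex.Im (- x) = - complex.Im x. Proof. by case: x. Qed.
Lemma Re_M (x y : C) :
  complex.Re (x * y) = complex.Re x * complex.Re y - complex.Im x * complex.Im y.
Proof. by case: x; case: y. Qed.
Lemma Im_M (x y : C) :
  complex.Im (x * y) = complex.Re x * complex.Im y + complex.Im x * complex.Re y.
Proof. by case: x; case: y. Qed.
Lemma Cplx_eq (x y : C) :
  complex.Re x = complex.Re y -> complex.Im x = complex.Im y -> x = y.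
Proof. by case: x y => [a b] [c d] /= -> ->. Qed.

Lemma nbhs_rnorm V (x : V) (P : V -> Prop) :
  nbhs x P <-> exists2 d : R, 0 < d & forall h, rnorm h < d -> P (x + h).
Proof.
split.
  move=> /nbhs_normP [e /= e0 H].
  have [t t0 eE] := gt0_ofR e0; rewrite eE in H.
  exists t => // h hd; apply: H => /=.
  by rewrite opprD addNKr normrN normE /ofR ltcR.
move=> [d d0 H]; apply/nbhs_normP; exists (ofR d); first by rewrite /= /ofR ltcR.
move=> y /= hy; rewrite -(subrKC x y); apply: H.
by move: hy; rewrite distrC normE /ofR ltcR.
Qed.

Lemma continuous_rnorm V W (f : V -> W) (x : V) : {for x, continuous f} <->
  forall e : R, 0 < e -> exists2 d : R, 0 < d & forall h, rnorm h < d -> rnorm (f (x + h) - f x) < e.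
Proof.
split=> [H e e0|H].
  have e0' : 0 < ofR e by rewrite /ofR ltcR.
  have /cvgr_distC_lt/(_ _ e0') := H.
  by move=> /nbhs_rnorm[d d0 Hd]; exists d => // h /Hd; rewrite normE /ofR ltcR.
apply/cvgrPdist_lt => e e0.
have [t t0 ->] := gt0_ofR e0; have [d d0 Hd] := H _ t0.
by apply/nbhs_rnorm; exists d => // h /Hd hh; rewrite normE /ofR ltcR rnormBC.
Qed.

Lemma littleo_rnorm V W (f : V -> W) :
  (forall e : C, 0 < e -> \forall x \near (0 : V), `|f x| <= e * `|x|) <->
  forall e : R, 0 < e -> exists2 d : R, 0 < d & forall h, rnorm h < d -> rnorm (f h) <= e * rnorm h.
Proof.
split=> H e e0.
  have e0' : 0 < ofR e by rewrite /ofR ltcR.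
  have /nbhs_rnorm[d d0 Hd] := H _ e0'; exists d => // h /Hd.
  by rewrite add0r !normE /ofR -rmorphM lecR.
have [t t0 ->] := gt0_ofR e0; have [d d0 Hd] := H _ t0.
by apply/nbhs_rnorm; exists d => // h /Hd hh; rewrite add0r !normE /ofR -rmorphM lecR.
Qed.

Lemma diff_approx V W (f : V -> W) (x : V) : differentiable f x ->
  forall e : R, 0 < e -> exists2 d : R, 0 < d & forall h, rnorm h < d ->
    rnorm (f (x + h) - f x - 'd f x h) <= e * rnorm h.
Proof.
move=> /diff_locally/eqaddoP/littleo_rnorm H e /H[d d0 Hd]; exists d => // h /Hd.
rewrite (_ : (f \o shift x - (cst (f x) + 'd f x)) h = f (x + h) - f x - 'd f x h) //.
by rewrite -[LHS]/(f (h + x) - (f x + 'd f x h)) opprD addrA [h + x]addrC.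
Qed.

(** The differential is a continuous linear map, and in a general normed module linearity does not
    imply continuity; the bound [B] supplies it, and uniqueness then identifies [L]. *)
Lemma diff_intro V W (f : V -> W) (x : V) (L : {linear V -> W}) (B : R) :
  (forall h, rnorm (L h) <= B * rnorm h) ->
  (forall e : R, 0 < e -> exists2 d : R, 0 < d & forall h, rnorm h < d ->
    rnorm (f (x + h) - f x - L h) <= e * rnorm h) ->
  differentiable f x /\ 'd f x = L :> (V -> W).
Proof.
move=> LB H.
have Lc : continuous L.
  move=> y; apply/continuous_rnorm => e e0.
  exists (e / (`|B| + 1)) => [|h hd]; first by rewrite divr_gt0 // ltr_wpDl.
  rewrite linearD addrAC subrr add0r; apply: le_lt_trans (LB h) _.
  rewrite ltr_pdivlMr ?ltr_wpDl // in hd.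
  apply: le_lt_trans hd; rewrite mulrC ler_wpM2l ?rnorm_ge0 //.
  by have := ler_norm B; lra.
have E : f \o shift x = cst (f x) + L +o_ 0 id.
  apply/eqaddoP/littleo_rnorm => e /H[d d0 Hd]; exists d => // h /Hd.
  rewrite (_ : (f \o shift x - (cst (f x) + L)) h = f (x + h) - f x - L h) //.
  by rewrite -[LHS]/(f (h + x) - (f x + L h)) opprD addrA [h + x]addrC.
have dE := diff_unique Lc E.
by split=> //; apply/diff_locallyP; rewrite dE.
Qed.

Lemma diff_bounded V W (f : V -> W) (x : V) : differentiable f x ->
  exists2 B : R, 0 < B & forall h, rnorm ('d f x h) <= B * rnorm h.
Proof.
move=> /diff_continuous/(_ 0)/continuous_rnorm/(_ 1 ltr01)[d d0 Hd].
exists (2 / d) => [|h]; first by rewrite divr_gt0.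
have [->|h0] := eqVneq h 0; first by rewrite linear0 !rnorm0 mulr0.
have hp : 0 < rnorm h by rewrite rnorm_gt0.
(* Rescales [h] to norm [d / 2], where continuity at 0 bounds the differential by 1; this gives the
   constant [2 / d]. *)
set t := d / 2 / rnorm h.
have tp : 0 < t by rewrite !divr_gt0.
have := Hd (ofR t *: h); rewrite add0r linear0 subr0 linearZ !rnormZ rnorm_ofR gtr0_norm //.
rewrite /t mulfVK ?gt_eqF // => /(_ _)/ltW -/(_ _).
have -> : d / 2 < d by lra.
move=> /(_ isT); rewrite -ler_pdivlMl // => /le_trans; apply.
rewrite mulr1 /t !invfM !invrK; lra.
Qed.

Lemma diff_local V W (f g : V -> W) (x : V) : differentiable g x ->
  nbhs x (fun y => f y = g y) -> differentiable f x /\ 'd f x = 'd g x :> (V -> W).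
Proof.
move=> dg /nbhs_rnorm[r r0 Hr]; have [B _ HB] := diff_bounded dg.
apply: (diff_intro HB) => e e0; have [d d0 Hd] := diff_approx dg e0.
have fx : f x = g x by rewrite -[x]addr0; apply: Hr; rewrite rnorm0.
exists (Num.min d r) => [|h]; first by rewrite lt_min d0.
by rewrite lt_min => /andP[/Hd hd /Hr ->]; rewrite fx.
Qed.
End RealNorm.

(** * Integrals of complex-valued functions *)

Section ComplexIntegral.
Variable R : realType.
Local Notation C := (Cplx R).
Local Notation mu := (@lebesgue_measure R).
Implicit Types (g : R -> C) (a b c : R).

Lemma continuous_Re : continuous (fun z : C => complex.Re z : R).
Proof.
move=> z; apply/(@cvgrPdist_lt R R C (nbhs z) (nbhs_filter z)) => e e0; apply/nbhs_rnorm; exists e => // h he.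
rewrite Re_D opprD addNKr normrN; exact: le_lt_trans (abs_Re_le _) he.
Qed.
Lemma continuous_Im : continuous (fun z : C => complex.Im z : R).
Proof.
move=> z; apply/(@cvgrPdist_lt R R C (nbhs z) (nbhs_filter z)) => e e0; apply/nbhs_rnorm; exists e => // h he.
rewrite Im_D opprD addNKr normrN; exact: le_lt_trans (abs_Im_le _) he.
Qed.
Lemma continuous_modulus : continuous (fun z : C => rnorm z : R).
Proof.
move=> z; apply/(@cvgrPdist_lt R R C (nbhs z) (nbhs_filter z)) => e e0; apply/nbhs_rnorm; exists e => // h he.
apply: le_lt_trans he; rewrite ler_norml; apply/andP; split.
  by have := rnormD z h; lra.
have := rnormD (z + h) (- h); rewrite addrK rnormN; lra.
Qed.
Lemma continuous_ofR : continuous (fun t : R => ofR t).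
Proof.
move=> t; apply/cvgrPdist_lt => e /gt0_ofR[d d0 ->].
apply/nbhs_normP; exists d => // s /= hs.
by rewrite -[ofR t - ofR s](rmorphB (real_complex R)) normE -/(ofR _) rnorm_ofR /ofR ltcR.
Qed.

Lemma integrable_comp_continuous g a b (p : C -> R) : continuous p -> continuous g ->
  mu.-integrable `[a, b] (EFin \o (p \o g)).
Proof.
move=> cp cg; apply: continuous_compact_integrable; first exact: segment_compact.
apply: continuous_subspaceT => x; apply: continuous_comp; [exact: cg|exact: cp].
Qed.

Definition cint a b g : C :=
  Complex (\int[mu]_(t in `[a, b]) complex.Re (g t)) (\int[mu]_(t in `[a, b]) complex.Im (g t)).

Lemma eq_cint a b g1 g2 : {in `[a, b], g1 =1 g2} -> cint a b g1 = cint a b g2.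
Proof.
move=> h; rewrite /cint; congr Complex; apply: eq_Rintegral => x;
 by rewrite inE => /= xab; rewrite h.
Qed.

Lemma integrable_Re a b g : continuous g -> mu.-integrable `[a, b] (EFin \o (fun t => complex.Re (g t))).
Proof. exact: integrable_comp_continuous continuous_Re. Qed.
Lemma integrable_Im a b g : continuous g -> mu.-integrable `[a, b] (EFin \o (fun t => complex.Im (g t))).
Proof. exact: integrable_comp_continuous continuous_Im. Qed.

Lemma cintD a b g1 g2 : continuous g1 -> continuous g2 ->
  cint a b (fun t => g1 t + g2 t) = cint a b g1 + cint a b g2.
Proof.
move=> c1 c2; rewrite /cint; transitivity
 (Complex ((\int[mu]_(t in `[a, b]) complex.Re (g1 t)) + \int[mu]_(t in `[a, b]) complex.Re (g2 t))
  ((\int[mu]_(t in `[a, b]) complex.Im (g1 t)) + \int[mu]_(t in `[a, b]) complex.Im (g2 t))) => //.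
congr Complex.
  rewrite -(RintegralD _ (integrable_Re a b c1) (integrable_Re a b c2)) //.
  by apply: eq_Rintegral => x _; rewrite Re_D.
rewrite -(RintegralD _ (integrable_Im a b c1) (integrable_Im a b c2)) //.
by apply: eq_Rintegral => x _; rewrite Im_D.
Qed.

Lemma cintZ a b (k : C) g : continuous g -> cint a b (fun t => k * g t) = k * cint a b g.
Proof.
move=> cg; case: k => u v; rewrite /cint; transitivity
 (Complex (u * (\int[mu]_(t in `[a, b]) complex.Re (g t)) - v * \int[mu]_(t in `[a, b]) complex.Im (g t))
  (u * (\int[mu]_(t in `[a, b]) complex.Im (g t)) + v * \int[mu]_(t in `[a, b]) complex.Re (g t))) => //.
have iZ (w : R) (p : R -> R) : mu.-integrable `[a, b] (EFin \o p) -> mu.-integrable `[a, b] (EFin \o (fun t => w * p t)).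
  by move=> ip; exact: (@integrableZl _ _ R mu `[a, b]%classic (measurable_itv _) w (EFin \o p) ip).
congr Complex; rewrite -!RintegralZl ?integrable_Re ?integrable_Im //.
  rewrite -(RintegralB _ (iZ _ _ (integrable_Re a b cg)) (iZ _ _ (integrable_Im a b cg))) //.
  by apply: eq_Rintegral => x _ /=; case: (g x).
rewrite -(RintegralD _ (iZ _ _ (integrable_Im a b cg)) (iZ _ _ (integrable_Re a b cg))) //.
by apply: eq_Rintegral => x _ /=; case: (g x).
Qed.

Lemma cint_split a c b g : a <= c -> c <= b -> continuous g ->
  cint a b g = cint a c g + cint c b g.
Proof.
move=> ac cb cg.
have S (p : C -> R) : continuous p -> \int[mu]_(t in `[a, b]) p (g t) =
    \int[mu]_(t in `[a, c]) p (g t) + \int[mu]_(t in `[c, b]) p (g t).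
  move=> cp; have := @Rintegral_itvB R (p \o g) (BLeft a) (BRight b) c
    (integrable_comp_continuous a b cp cg).
  rewrite !bnd_simp => /(_ ac cb) /= E.
  rewrite -[X in _ = _ + X]Rintegral_itv_obnd_cbnd -?E; first by rewrite subrKC.
  apply: integrableS (integrable_comp_continuous a b cp cg) => //.
  by apply: subset_itv; rewrite bnd_simp.
by rewrite /cint (S _ continuous_Re) (S _ continuous_Im).
Qed.

Lemma cint_cst a b (k : C) : a <= b -> cint a b (fun=> k) = k * ofR (b - a).
Proof.
move=> ab; rewrite /cint !Rintegral_cst //= lebesgue_measure_itv /= lte_fin.
have -> : fine (if (a < b)%R then (b%:E - a%:E)%E else 0%E) = b - a.
  by case: ltgtP ab => // -> _; rewrite subrr.
by apply: Cplx_eq; rewrite (Re_M, Im_M) /= mulr0 (subr0, add0r).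
Qed.

Lemma cint_norm a b g : continuous g ->
  rnorm (cint a b g) <= \int[mu]_(t in `[a, b]) rnorm (g t).
Proof.
move=> cg; set I := cint a b g.
have [I0|I0] := eqVneq I 0.
  by rewrite I0 rnorm0; apply: Rintegral_ge0 => x _; exact: rnorm_ge0.
(* The unimodular [k] rotates the integral onto the positive axis, so that its modulus becomes the
   integral of a real part. *)
pose k : C := `|I| / I.
have kI : complex.Re (k * I) = rnorm I by rewrite /k divfK.
have k1 : rnorm k = 1.
  rewrite /k rnormM rnormV normE rnorm_ofR ger0_norm ?rnorm_ge0 // divff //.
  by rewrite rnorm_eq0.
rewrite -kI -cintZ // /cint /=; apply: le_Rintegral => //.
- apply: (@integrable_Re a b (fun t => k * g t)) => x.
  by apply: cvgM; [exact: cvg_cst|exact: cg].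
- exact: integrable_comp_continuous continuous_modulus cg.
- move=> x _; apply: le_trans (ler_norm _) _.
  by apply: le_trans (abs_Re_le _) _; rewrite rnormM k1 mul1r.
Qed.

Lemma cint_bound a b g (K : R) : a <= b -> continuous g ->
  (forall t, a <= t <= b -> rnorm (g t) <= K) -> rnorm (cint a b g) <= K * (b - a).
Proof.
move=> ab cg H; apply: le_trans (cint_norm _ _ cg) _.
have E : \int[mu]_(t in `[a, b]) K = K * (b - a).
  rewrite Rintegral_cst //= lebesgue_measure_itv /= lte_fin.
  by case: ltgtP ab => // -> _; rewrite subrr.
rewrite -E; apply: le_Rintegral => //.
- exact: integrable_comp_continuous continuous_modulus cg.
- apply: (@integrable_comp_continuous (fun=> 0) a b (fun=> K)); exact: cst_continuous.
Qed.

Definition cis (t : R) : C := Complex (cos t) (sin t).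

Lemma cisE t : cis t = ofR (cos t) + 'i * ofR (sin t).
Proof. by rewrite /cis [LHS]complexE. Qed.
Lemma continuous_cis : continuous cis.
Proof.
have -> : cis = fun t => ofR (cos t) + 'i * ofR (sin t) by apply/funext => t; exact: cisE.
move=> t; apply: cvgD.
  by apply: continuous_comp; [exact: continuous_cos|exact: continuous_ofR].
apply: cvgM; first exact: cvg_cst.
by apply: continuous_comp; [exact: continuous_sin|exact: continuous_ofR].
Qed.
Lemma rnorm_cis t : rnorm (cis t) = 1.
Proof. by rewrite rnorm_def /= cos2Dsin2 sqrtr1. Qed.
Lemma cis0 : cis 0 = 1.
Proof. by rewrite /cis cos0 sin0. Qed.
Lemma cis2pi : cis (pi *+ 2) = 1.
Proof. by rewrite /cis cos2pi sin2pi. Qed.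

Lemma cint_cis a b : a <= b -> 'i * cint a b cis = cis b - cis a.
Proof.
rewrite le_eqVlt => /predU1P[->|ab].
  by rewrite subrr /cint set_itv1 !Rintegral_set1 mulr0.
have Ec : \int[mu]_(t in `[a, b]) cos t = sin b - sin a.
  rewrite /Rintegral (@continuous_FTC2 _ cos sin) //.
  - by apply: continuous_subspaceT => x; exact: continuous_cos.
  - split; [by move=> x _; exact: derivable_sin
     | by apply: cvg_at_right_filter; exact: continuous_sin
     | by apply: cvg_at_left_filter; exact: continuous_sin].
  - by move=> x _; rewrite derive1E derive_val.
have Es : \int[mu]_(t in `[a, b]) sin t = cos a - cos b.
  rewrite /Rintegral (@continuous_FTC2 _ sin (fun x => - cos x)) //=.
  - by rewrite opprK addrC.
  - by apply: continuous_subspaceT => x; exact: continuous_sin.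
  - split; [by move=> x _; apply: derivableN; exact: derivable_cos
     | by apply: cvg_at_right_filter; apply: continuousN; exact: continuous_cos
     | by apply: cvg_at_left_filter; apply: continuousN; exact: continuous_cos].
  - by move=> x _; rewrite derive1E derive_val opprK.
by apply: Cplx_eq; rewrite (Re_M, Im_M) (Re_D, Im_D) (Re_N, Im_N) /= ?Ec ?Es; ring.
Qed.

Lemma cis_lip a b : rnorm (cis b - cis a) <= `|b - a|.
Proof.
wlog ab : a b / a <= b => [H|].
  have [/H//|/ltW/H] := leP a b; by rewrite rnormBC distrC.
rewrite -cint_cis // rnormM.
have -> : rnorm ('i : C) = 1 by rewrite rnorm_def /= expr0n expr1n add0r sqrtr1.
rewrite mul1r ger0_norm ?subr_ge0 // -[leRHS]mul1r.
by apply: cint_bound => // [|t _]; [exact: continuous_cis|rewrite rnorm_cis].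
Qed.
End ComplexIntegral.

(** * Goursat's theorem and means over circles *)

Section BoxInduction.
Variable R : realType.
Implicit Types (a b c d x y w h : R) (P : R -> R -> R -> R -> Prop).

Lemma half_pow_lt (t e : R) : 0 < e -> exists n : nat, t / 2 ^+ n < e.
Proof.
move=> e0; exists (Num.bound `|t / e|).
have H : t / e < (Num.bound `|t / e|)%:R.
  by apply: le_lt_trans (ler_norm _) _; exact: archi_boundP.
rewrite ltr_pdivrMr ?exprn_gt0 // mulrC -ltr_pdivrMr //.
by apply: lt_le_trans H _; rewrite -natrX ler_nat ltnW // ltn_expl.
Qed.

(** Quartering principle: were [P] false on the whole box, one quarter would be bad at each stage,
    and the nested bad boxes would shrink to a point, against the local hypothesis there. A box with
    a degenerate side gives induction on segments. *)
Lemma box_induction P a b c d : a <= b -> c <= d ->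
  (forall x1 x2 y1 y2, let xm := (x1 + x2) / 2 in let ym := (y1 + y2) / 2 in
     a <= x1 -> x1 <= x2 -> x2 <= b -> c <= y1 -> y1 <= y2 -> y2 <= d ->
     P x1 xm y1 ym -> P xm x2 y1 ym -> P x1 xm ym y2 -> P xm x2 ym y2 ->
     P x1 x2 y1 y2) ->
  (forall x y, a <= x <= b -> c <= y <= d -> exists2 e : R, 0 < e &
     forall x1 x2 y1 y2, a <= x1 -> x1 <= x <= x2 -> x2 <= b ->
       c <= y1 -> y1 <= y <= y2 -> y2 <= d -> x2 - x1 < e -> y2 - y1 < e ->
       P x1 x2 y1 y2) ->
  P a b c d.
Proof.
move=> ab cd glue loc; apply: contrapT => nP.
pose w (n : nat) := (b - a) / 2 ^+ n; pose h (n : nat) := (d - c) / 2 ^+ n.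
have w0 n : 0 <= w n by rewrite divr_ge0 ?subr_ge0 ?exprn_ge0.
have h0 n : 0 <= h n by rewrite divr_ge0 ?subr_ge0 ?exprn_ge0.
have wS n : w n = w n.+1 + w n.+1 by rewrite /w exprS invfM; field; rewrite expf_neq0.
have hS n : h n = h n.+1 + h n.+1 by rewrite /h exprS invfM; field; rewrite expf_neq0.
pose Bad (s : nat * (R * R)) := let: (n, (x, y)) := s in
  [/\ a <= x, x + w n <= b, c <= y, y + h n <= d & ~ P x (x + w n) y (y + h n)].
(* Being conditional on [Bad s], [Next] is a total relation, so a choice function can be iterated
   from the initial box. *)
pose Next (s t : nat * (R * R)) := Bad s -> [/\ Bad t, t.1 = s.1.+1,
  s.2.1 <= t.2.1 <= s.2.1 + w s.1.+1 & s.2.2 <= t.2.2 <= s.2.2 + h s.1.+1].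
have nextP s : exists t, Next s t.
  case: s => n [x y]; have [B|nB] := pselect (Bad (n, (x, y))); last by exists (n, (x, y)).
  apply: contrapT => nt; case: (B) => ax xb cy yd; apply.
  have Q x' y' : x <= x' <= x + w n.+1 -> y <= y' <= y + h n.+1 ->
      P x' (x' + w n.+1) y' (y' + h n.+1).
    move=> hx hy; apply: contrapT => nP'; apply: nt; exists (n.+1, (x', y')) => _.
    move: (w0 n.+1) (h0 n.+1) (wS n) (hS n) => *.
    by split => //; split => //; lra.
  have xm : (x + (x + w n)) / 2 = x + w n.+1 by rewrite wS; lra.
  have ym : (y + (y + h n)) / 2 = y + h n.+1 by rewrite hS; lra.
  move: (w0 n.+1) (h0 n.+1) (wS n) (hS n) (w0 n) (h0 n) => *.
  apply: glue => //; rewrite ?xm ?ym; try lra.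
  - by apply: Q; lra.
  - by rewrite (_ : x + w n = x + w n.+1 + w n.+1); [apply: Q; lra|lra].
  - by rewrite (_ : y + h n = y + h n.+1 + h n.+1); [apply: Q; lra|lra].
  - rewrite (_ : x + w n = x + w n.+1 + w n.+1); last lra.
    by rewrite (_ : y + h n = y + h n.+1 + h n.+1); [apply: Q; lra|lra].
have [f f0 fS] : exists2 f : nat -> nat * (R * R), f 0 = (0, (a, c)) & forall n, Next (f n) (f n.+1).
  pose g s := projT1 (cid (nextP s)).
  exists (fun n => iter n g (0, (a, c))) => // n; exact: (projT2 (cid (nextP _))).
have Bf n : Bad (f n) /\ (f n).1 = n.
  elim: n => [|n [B E]].
    rewrite f0; split => //; rewrite /Bad /w /h expr0 !divr1 !subrKC; split => //.
  by have [B' E' _ _] := fS n B; rewrite E' E.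
pose x n := (f n).2.1; pose y n := (f n).2.2.
have Bn n : [/\ a <= x n, x n + w n <= b, c <= y n, y n + h n <= d & ~ P (x n) (x n + w n) (y n) (y n + h n)].
  by have [] := Bf n; rewrite /x /y; case: (f n) => m [u v] /= B <-.
have xS n : x n <= x n.+1 /\ x n.+1 + w n.+1 <= x n + w n.
  by have [B E] := Bf n; have [_ _ H _] := fS n B; move: H; rewrite E -/(x n) -/(x n.+1) (wS n); lra.
have yS n : y n <= y n.+1 /\ y n.+1 + h n.+1 <= y n + h n.
  by have [B E] := Bf n; have [_ _ _ H] := fS n B; move: H; rewrite E -/(y n) -/(y n.+1) (hS n); lra.
(* Nested intervals: the supremum of the left endpoints lies in all of them. *)
have lim (u v : nat -> R) : (forall n, 0 <= v n) -> (forall n, u n <= u n.+1 /\ u n.+1 + v n.+1 <= u n + v n) ->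
    exists l, forall n, u n <= l <= u n + v n.
  move=> v0 uS; exists (sup (range u)) => n.
  have inc m k : u m <= u (m + k)%N /\ u (m + k)%N + v (m + k)%N <= u m + v m.
    by elim: k => [|k IH]; rewrite ?addn0 // addnS; have := uS (m + k)%N; lra.
  have ubn : ubound (range u) (u n + v n).
    move=> _ [m _ <-]; have [mn|nm] := leqP m n.
      by have [+ _] := inc m (n - m)%N; rewrite subnKC // => /le_trans; apply; rewrite lerDl.
    have [_ +] := inc n (m - n)%N; rewrite subnKC ?(ltnW nm) //; apply: le_trans.
    by rewrite lerDl.
  apply/andP; split; last by apply: ge_sup => //; exists (u 0%N), 0%N.
  by apply: ub_le_sup; [exists (u n + v n)|exists n].
have [lx Hx] := lim x w w0 xS; have [ly Hy] := lim y h h0 yS.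
have [||e e0 He] := loc lx ly.
- by have [? ? _ _ _] := Bn 0%N; have := Hx 0%N; lra.
- by have [_ _ ? ? _] := Bn 0%N; have := Hy 0%N; lra.
have [n1 Hn1] := half_pow_lt (b - a) e0; have [n2 Hn2] := half_pow_lt (d - c) e0.
pose n := maxn n1 n2.
have mono (t : R) m k : 0 <= t -> (m <= k)%N -> t / 2 ^+ k <= t / 2 ^+ m.
  by move=> t0 mk; rewrite ler_wpM2l // lef_pV2 ?posrE ?exprn_gt0 // ler_weXn2l // ler1n.
have wn : w n < e by apply: le_lt_trans Hn1; apply: mono; rewrite ?subr_ge0 ?leq_maxl.
have hn : h n < e by apply: le_lt_trans Hn2; apply: mono; rewrite ?subr_ge0 ?leq_maxr.
have [? ? ? ? +] := Bn n; apply.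
by apply: He => //; rewrite addrAC subrr add0r.
Qed.
End BoxInduction.

Lemma midpoint (R : realType) (u v : R) : u <= v ->
  [/\ u <= (u + v) / 2, (u + v) / 2 <= v, v - (u + v) / 2 = (v - u) / 2 &
      (u + v) / 2 - u = (v - u) / 2].
Proof. by move=> uv; split; lra. Qed.

(** * Goursat's theorem in polar coordinates *)

Section CircleMean.
Variable R : realType.
Local Notation C := (Cplx R).
Implicit Types (phi : C -> C) (a b r t : R).

Definition polar r t : C := ofR r * cis t.

Lemma rnorm_polar r t : 0 <= r -> rnorm (polar r t) = r.
Proof. by move=> r0; rewrite /polar rnormM rnorm_ofR rnorm_cis mulr1 ger0_norm. Qed.

Lemma polar_lip r1 t1 r2 t2 : rnorm (polar r1 t1 - polar r2 t2) <= `|r1 - r2| + `|r2| * `|t1 - t2|.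
Proof.
have -> : polar r1 t1 - polar r2 t2 = ofR (r1 - r2) * cis t1 + ofR r2 * (cis t1 - cis t2).
  by rewrite /polar /ofR rmorphB /=; ring.
apply: le_trans (rnormD _ _) _; rewrite !rnormM !rnorm_ofR rnorm_cis mulr1 lerD2l.
by rewrite ler_wpM2l // cis_lip.
Qed.

Lemma continuous_polar_angle r : continuous (polar r).
Proof. by move=> t; apply: cvgM; [exact: cvg_cst|exact: continuous_cis]. Qed.

Section Annulus.
Variables (a b : R) (phi : C -> C).
Hypotheses (a0 : 0 < a) (ab : a <= b).
Hypothesis dphi : forall z, a <= rnorm z <= b -> differentiable phi z.

(* Clamping the radius makes the integrands continuous on the whole line. *)
Let clamp r := Num.max a (Num.min r b).
Let clamp_in r : a <= clamp r <= b.
Proof. by rewrite /clamp le_max lexx ge_max ab ge_min lexx orbT. Qed.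
Let clampE r : a <= r <= b -> clamp r = r.
Proof. by move=> /andP[ar rb]; rewrite /clamp min_l // max_r. Qed.
Let continuous_clamp : continuous clamp.
Proof.
move=> r; apply: (@continuous_max _ _ (fun=> a) (fun s => Num.min s b)); first exact: cvg_cst.
by apply: (@continuous_min _ _ id (fun=> b)); [exact: cvg_id|exact: cvg_cst].
Qed.
Let psi r t : C := phi (polar (clamp r) t).

Let polar_in r t : a <= rnorm (polar (clamp r) t) <= b.
Proof. by rewrite rnorm_polar ?clamp_in //; case/andP: (clamp_in r) => + _; apply: le_trans; exact: ltW. Qed.

Let psi_angle r : continuous (psi r).
Proof.
move=> t; apply: (@continuous_comp _ _ _ (polar (clamp r)) phi).
  exact: continuous_polar_angle.
by apply: differentiable_continuous; apply: dphi.
Qed.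

Let psi_radius t : continuous (fun r => psi r t).
Proof.
move=> r; apply: (@continuous_comp _ _ _ (fun r => polar (clamp r) t) phi); last first.
  by apply: differentiable_continuous; apply: dphi.
apply: cvgM; last exact: cvg_cst.
by apply: (@continuous_comp _ _ _ clamp (@ofR R)); [exact: continuous_clamp|exact: continuous_ofR].
Qed.

Let inv_clamp : continuous (fun r => ofR (clamp r)^-1 : C).
Proof.
move=> r; apply: (@continuous_comp _ _ _ (fun r => (clamp r)^-1) (@ofR R)); last exact: continuous_ofR.
apply: (@cvgV R); last exact: continuous_clamp.
by rewrite gt_eqF //; case/andP: (clamp_in r) => + _; apply: lt_le_trans.
Qed.

Let ang r1 r2 t : C := psi r2 t - psi r1 t.
Let rad t1 t2 r : C := (psi r t2 - psi r t1) * ofR (clamp r)^-1.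
Let c_ang r1 r2 : continuous (ang r1 r2).
Proof. by move=> t; apply: cvgB; apply: psi_angle. Qed.
Let c_rad t1 t2 : continuous (rad t1 t2).
Proof. by move=> r; apply: cvgM; [apply: cvgB; apply: psi_radius|exact: inv_clamp]. Qed.

(* The integral of phi(z)/z dz along the boundary of a polar rectangle. *)
Let bd r1 r2 t1 t2 : C := 'i * cint t1 t2 (ang r1 r2) - cint r1 r2 (rad t1 t2).

Let bd_radius r1 r r2 t1 t2 : r1 <= r -> r <= r2 -> bd r1 r2 t1 t2 = bd r1 r t1 t2 + bd r r2 t1 t2.
Proof.
move=> h1 h2; rewrite /bd (cint_split h1 h2 (@c_rad t1 t2)).
have -> : cint t1 t2 (ang r1 r2) = cint t1 t2 (ang r1 r) + cint t1 t2 (ang r r2).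
  rewrite -(cintD t1 t2 (@c_ang r1 r) (@c_ang r r2)); apply: eq_cint => t _.
  by rewrite /ang; ring.
ring.
Qed.

Let bd_angle r1 r2 t1 t t2 : t1 <= t -> t <= t2 -> bd r1 r2 t1 t2 = bd r1 r2 t1 t + bd r1 r2 t t2.
Proof.
move=> h1 h2; rewrite /bd (cint_split h1 h2 (@c_ang r1 r2)).
have -> : cint r1 r2 (rad t1 t2) = cint r1 r2 (rad t1 t) + cint r1 r2 (rad t t2).
  rewrite -(cintD r1 r2 (@c_rad t1 t) (@c_rad t t2)); apply: eq_cint => r _.
  by rewrite /rad; ring.
ring.
Qed.

(** An affine function has zero boundary integral, by [cint_cis], so subtracting the part of slope
    [L] leaves only deviations of size [K]. The radial sides carry the weight [1 / r], at most
    [1 / a]. *)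
Let bd_affine r1 r2 t1 t2 (L : C) (K : R) : a <= r1 -> r1 <= r2 -> r2 <= b -> t1 <= t2 ->
  (forall r t r' t', r1 <= r <= r2 -> t1 <= t <= t2 -> r1 <= r' <= r2 -> t1 <= t' <= t2 ->
    rnorm (phi (polar r' t') - phi (polar r t) - L * (polar r' t' - polar r t)) <= K) ->
  rnorm (bd r1 r2 t1 t2) <= K * (t2 - t1) + K / a * (r2 - r1).
Proof.
move=> ar r12 rb t12 H.
pose ea t := ang r1 r2 t - L * ofR (r2 - r1) * cis t.
pose er r := rad t1 t2 r - L * (cis t2 - cis t1).
have cLc : continuous (fun t => L * ofR (r2 - r1) * cis t).
  by move=> t; apply: cvgM; [exact: cvg_cst|exact: continuous_cis].
have cea : continuous ea by move=> t; apply: cvgB; [exact: c_ang|exact: cLc].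
have cer : continuous er by move=> r; apply: cvgB; [exact: c_rad|exact: cvg_cst].
have E1 : cint t1 t2 (ang r1 r2) = L * ofR (r2 - r1) * cint t1 t2 (@cis R) + cint t1 t2 ea.
  rewrite -cintZ; last exact: continuous_cis.
  rewrite -(cintD t1 t2 cLc cea); apply: eq_cint => t _.
  by rewrite /ea subrKC.
have E2 : cint r1 r2 (rad t1 t2) = L * (cis t2 - cis t1) * ofR (r2 - r1) + cint r1 r2 er.
  rewrite -(cint_cst _ r12) -(cintD r1 r2 _ cer); last exact: cst_continuous.
  by apply: eq_cint => r _; rewrite /er subrKC.
have -> : bd r1 r2 t1 t2 = 'i * cint t1 t2 ea - cint r1 r2 er.
  rewrite /bd E1 E2 -(cint_cis t12); ring.
have in1 : a <= r1 <= b by rewrite ar (le_trans r12).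
have in2 : a <= r2 <= b by rewrite rb (le_trans ar).
have K0 : 0 <= K.
  have := H r1 t1 r1 t1; rewrite !lexx r12 t12 => /(_ isT isT isT isT).
  by apply: le_trans; exact: rnorm_ge0.
apply: le_trans (rnormB _ _) _; apply: lerD.
  rewrite rnormM (_ : rnorm _ = 1) ?mul1r; last by rewrite rnorm_def /= expr0n expr1n add0r sqrtr1.
  apply: (cint_bound t12 cea) => t ht; rewrite /ea /ang /psi !clampE //.
  have := H r1 t r2 t; rewrite !lexx r12 => /(_ isT ht isT ht); apply: le_trans.
  by rewrite le_eqVlt; apply/orP; left; apply/eqP; congr rnorm; rewrite /polar /ofR rmorphB /=; ring.
apply: (cint_bound r12 cer) => r /andP[h1 h2].
have inr : a <= r <= b by rewrite (le_trans ar) // (le_trans h2).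
have r0 : 0 < r by case/andP: inr => + _; apply: lt_le_trans.
rewrite /er /rad /psi !clampE //.
have -> : (phi (polar r t2) - phi (polar r t1)) * ofR r^-1 - L * (cis t2 - cis t1) =
    (phi (polar r t2) - phi (polar r t1) - L * (polar r t2 - polar r t1)) * ofR r^-1.
  have rr : ofR r * ofR r^-1 = 1 :> C.
    by rewrite /ofR -rmorphM divff ?gt_eqF // rmorph1.
  rewrite [RHS]mulrBl; congr (_ - _); rewrite /polar -mulrBr mulrCA -!mulrA mulrA -[LHS]mul1r -rr.
  by ring.
rewrite rnormM rnorm_ofR gtr0_norm ?invr_gt0 //; apply: ler_pM => //.
- exact: rnorm_ge0.
- by rewrite invr_ge0 ltW.
- by apply: H; rewrite ?lexx ?h1 ?h2 ?t12.
- by rewrite lef_pV2 ?posrE //; case/andP: inr.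
Qed.

Lemma goursat_polar t1 t2 : t1 <= t2 -> bd a b t1 t2 = 0.
Proof.
move=> t12; apply/eqP; rewrite -rnorm_eq0 eq_le rnorm_ge0 andbT.
apply/ler_addgt0Pr => e0 e00; rewrite add0r.
pose D := (b - a) + (t2 - t1).
have D0 : 0 <= D by rewrite addr_ge0 ?subr_ge0.
pose e := e0 / (D ^+ 2 + 1).
have D1 : 0 < D ^+ 2 + 1 by rewrite ltr_wpDl ?sqr_ge0.
have ep : 0 < e by rewrite divr_gt0.
apply: le_trans (_ : e * D ^+ 2 <= _); last first.
  by rewrite /e mulrAC ler_pdivrMr // ler_wpM2l ?lerDl // ltW.
(* The square makes the bound reproduce itself under quartering: four boxes with half the side sum
   contribute four quarters of it. *)
pose P r1 r2 s1 s2 := rnorm (bd r1 r2 s1 s2) <= e * ((r2 - r1) + (s2 - s1)) ^+ 2.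
apply: (@box_induction _ P a b t1 t2) => //.
  move=> r1 r2 s1 s2 rm sm ar r12 rb ts s12 st; rewrite /P => P1 P2 P3 P4.
  have [h1 h2 e1 e2] := midpoint r12; have [h3 h4 e3 e4] := midpoint s12.
  rewrite (bd_radius _ _ h1 h2) !(bd_angle _ _ h3 h4).
  apply: le_trans (rnormD _ _) _.
  apply: le_trans (lerD (rnormD _ _) (rnormD _ _)) _.
  apply: le_trans (lerD (lerD P1 P3) (lerD P2 P4)) _.
  rewrite e1 e2 e3 e4.
  by rewrite le_eqVlt; apply/orP; left; apply/eqP; field.
move=> r t hr ht.
have b0 : 0 < b by exact: lt_le_trans ab.
have r0 : 0 <= r by case/andP: hr => + _; apply: le_trans; exact: ltW.
(* [M] collects the losses: points of the box lie within [1 + b] side sums of the base point,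
   comparing two points doubles the error, and the angular and radial sides weigh [1] and [1 / a]. A
   factor 2 is to spare. *)
pose M := 4 * (1 + b) * (1 + a^-1).
have M0 : 0 < M by rewrite /M !mulr_gt0 ?addr_gt0 ?invr_gt0.
pose k := e / M; have k0 : 0 < k by rewrite divr_gt0.
have dz : differentiable phi (polar r t) by apply: dphi; rewrite rnorm_polar.
have [d d0 Hd] := diff_approx dz k0.
exists (d / (2 * (1 + b))) => [|r1 r2 s1 s2 ar hr12 rb ts hs st wd hd].
  by rewrite divr_gt0 // mulr_gt0 // ltr_wpDl // ltW.
have lin z : 'd phi (polar r t) z = 'd phi (polar r t) 1 * z.
  by rewrite -{1}[z]mulr1 -[z * 1]/(z *: (1 : C)) linearZ /= mulrC.
set L := 'd phi (polar r t) 1.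
pose S := (1 + b) * ((r2 - r1) + (s2 - s1)).
have near r' s' : r1 <= r' <= r2 -> s1 <= s' <= s2 ->
    rnorm (polar r' s' - polar r t) <= S.
  move=> hr' hs'; apply: le_trans (polar_lip _ _ _ _) _.
  have A1 : `|r' - r| <= r2 - r1 by rewrite ler_norml; lra.
  have A2 : `|s' - t| <= s2 - s1 by rewrite ler_norml; lra.
  apply: le_trans (lerD A1 (ler_wpM2l _ A2)) _ => //.
  rewrite (ger0_norm r0) /S; have : r * (s2 - s1) <= b * (s2 - s1) by rewrite ler_wpM2r //; lra.
  have : 0 <= b * (r2 - r1) by rewrite mulr_ge0 //; lra.
  lra.
have S_d : S < d.
  rewrite /S; have : (1 + b) * (r2 - r1) < d / 2.
    by rewrite mulrC -ltr_pdivlMr ?ltr_wpDl ?(ltW b0) // -mulrA -invfM.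
  have : (1 + b) * (s2 - s1) < d / 2.
    by rewrite mulrC -ltr_pdivlMr ?ltr_wpDl ?(ltW b0) // -mulrA -invfM.
  lra.
have err r' s' : r1 <= r' <= r2 -> s1 <= s' <= s2 ->
    rnorm (phi (polar r' s') - phi (polar r t) - L * (polar r' s' - polar r t)) <= k * S.
  move=> hr' hs'; have N := near _ _ hr' hs'; have := Hd _ (le_lt_trans N S_d).
  rewrite subrKC lin => /le_trans; apply; by rewrite ler_wpM2l // ltW.
rewrite /P; apply: le_trans (bd_affine (L := L) (K := 2 * (k * S)) ar _ rb _ _) _; [lra|lra| |].
  move=> ra ta rb' tb h1 h2 h3 h4.
  have -> : phi (polar rb' tb) - phi (polar ra ta) - L * (polar rb' tb - polar ra ta) =
    (phi (polar rb' tb) - phi (polar r t) - L * (polar rb' tb - polar r t)) -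
    (phi (polar ra ta) - phi (polar r t) - L * (polar ra ta - polar r t)) by ring.
  by apply: le_trans (rnormB _ _) _; rewrite mulr2n mulrDl mul1r; apply: lerD; exact: err.
set W := (r2 - r1) + (s2 - s1).
have W0 : 0 <= W by rewrite /W; lra.
have kS0 : 0 <= k * S.
  by rewrite (mulr_ge0 (ltW k0)) // /S mulr_ge0 // addr_ge0 // ltW.
have sW : s2 - s1 <= W by rewrite /W; lra.
have rW : r2 - r1 <= W by rewrite /W; lra.
have kS2 : 0 <= 2 * (k * S) by rewrite (mulr_ge0 _ kS0).
have e1 := ler_wpM2l kS2 sW.
have e2 : 2 * (k * S) / a * (r2 - r1) <= 2 * (k * S) / a * W.
  by apply: ler_wpM2l rW; rewrite (mulr_ge0 kS2) // invr_ge0 ltW.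
apply: le_trans (lerD e1 e2) _.
have -> : e = k * M by rewrite /k divfK ?gt_eqF.
have -> : 2 * (k * S) * W + 2 * (k * S) / a * W = (k * M * W ^+ 2) / 2.
  by rewrite /S /M -/W; field; rewrite gt_eqF.
have : 0 <= k * M * W ^+ 2 by rewrite (mulr_ge0 (mulr_ge0 (ltW k0) (ltW M0))) ?sqr_ge0.
lra.
Qed.
End Annulus.

(** This is the contour integral of [phi(z) / z] divided by [2 pi i], so Cauchy's formulas for
    Taylor coefficients become means of [phi(z) z^-m]. *)
Definition cmean r phi : C := ofR (pi *+ 2)^-1 * cint 0 (pi *+ 2) (fun t => phi (polar r t)).

Lemma pi2_gt0 : 0 < pi *+ 2 :> R.
Proof. by rewrite mulrn_wgt0 // pi_gt0. Qed.

(** Over a full turn the two radial sides of the polar rectangle coincide and cancel, which leaves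
    the two circles. *)
Lemma cmean_const a b phi : 0 < a -> a <= b ->
  (forall z, a <= rnorm z <= b -> differentiable phi z) -> cmean a phi = cmean b phi.
Proof.
move=> a0 ab dphi; have := goursat_polar a0 ab dphi (ltW pi2_gt0).
rewrite /polar cis0 cis2pi; rewrite [X in _ - X](_ : _ = 0); last first.
  rewrite (@eq_cint _ _ _ _ (fun=> 0)) ?cint_cst ?mul0r // => r _.
  by rewrite subrr mul0r.
rewrite subr0 => /eqP; rewrite mulf_eq0 => /orP[/eqP/(congr1 (@complex.Im R)) /= /eqP|/eqP].
  by rewrite oner_eq0.
have -> : Num.max a (Num.min b b) = b by rewrite minxx max_r.
have -> : Num.max a (Num.min a b) = a by rewrite min_l // maxxx.
have cc r : a <= r <= b -> continuous (fun t => phi (polar r t)).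
  move=> hr t; apply: (@continuous_comp _ _ _ (polar r) phi); first exact: continuous_polar_angle.
  apply: differentiable_continuous; apply: dphi; rewrite rnorm_polar //.
  by case/andP: hr => + _; apply: le_trans; exact: ltW.
rewrite -[fun t => _]/(fun t => phi (polar b t) - phi (polar a t)).
have -> : (fun t => phi (polar b t) - phi (polar a t)) = (fun t => phi (polar b t) + -1 * phi (polar a t)).
  by apply/funext => t; rewrite mulN1r.
rewrite cintD ?cintZ; first last.
- by move=> t; apply: cvgM; [exact: cvg_cst|apply: cc; rewrite lexx ab].
- by apply: cc; rewrite lexx ab.
- by apply: cc; rewrite lexx ab.
by rewrite mulN1r => /eqP; rewrite subr_eq0 => /eqP E; rewrite /cmean E.
Qed.
End CircleMean.

(** * Cauchy's formulas as means over circles *)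

Section MeanProperties.
Variable R : realType.
Local Notation C := (Cplx R).
Implicit Types (phi : C -> C) (r : R).

Definition circle_continuous r phi := continuous (fun t => phi (polar r t)).

Lemma differentiable_circle r phi : 0 <= r ->
  (forall z, rnorm z = r -> differentiable phi z) -> circle_continuous r phi.
Proof.
move=> r0 H t; apply: (@continuous_comp _ _ _ (polar r) phi); first exact: continuous_polar_angle.
by apply: differentiable_continuous; apply: H; rewrite rnorm_polar.
Qed.

Lemma eq_cmean r phi1 phi2 : 0 <= r -> (forall z, rnorm z = r -> phi1 z = phi2 z) ->
  cmean r phi1 = cmean r phi2.
Proof.
move=> r0 H; rewrite /cmean; congr (_ * _); apply: eq_cint => t _.
by apply: H; rewrite rnorm_polar.
Qed.

Lemma cmeanD r phi1 phi2 : circle_continuous r phi1 -> circle_continuous r phi2 ->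
  cmean r (fun z => phi1 z + phi2 z) = cmean r phi1 + cmean r phi2.
Proof. by move=> c1 c2; rewrite /cmean (cintD _ _ c1 c2) mulrDr. Qed.

Lemma cmeanZ r (k : C) phi : circle_continuous r phi ->
  cmean r (fun z => k * phi z) = k * cmean r phi.
Proof. by move=> c; rewrite /cmean (cintZ _ _ k c) mulrCA. Qed.

Lemma circle_continuousZ r (k : C) phi : circle_continuous r phi ->
  circle_continuous r (fun z => k * phi z).
Proof. by move=> c t; apply: cvgM; [exact: cvg_cst|exact: c]. Qed.

Lemma circle_continuousD r phi1 phi2 : circle_continuous r phi1 -> circle_continuous r phi2 ->
  circle_continuous r (fun z => phi1 z + phi2 z).
Proof. by move=> c1 c2 t; apply: cvgD; [exact: c1|exact: c2]. Qed.

Lemma circle_continuousM r phi1 phi2 : circle_continuous r phi1 -> circle_continuous r phi2 ->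
  circle_continuous r (fun z => phi1 z * phi2 z).
Proof. by move=> c1 c2 t; apply: cvgM; [exact: c1|exact: c2]. Qed.

Lemma circle_continuous_cst r (k : C) : circle_continuous r (fun=> k).
Proof. by move=> t; exact: cvg_cst. Qed.

Lemma cmeanB r phi1 phi2 : circle_continuous r phi1 -> circle_continuous r phi2 ->
  cmean r (fun z => phi1 z - phi2 z) = cmean r phi1 - cmean r phi2.
Proof.
move=> c1 c2; rewrite -[X in _ = _ + X]mulN1r -(cmeanZ _ c2).
rewrite -(cmeanD c1 (circle_continuousZ (k := -1) c2)); congr cmean; apply/funext => z.
by rewrite mulN1r.
Qed.

Lemma cmean_cst r (k : C) : cmean r (fun=> k) = k.
Proof.
rewrite /cmean cint_cst ?(ltW (pi2_gt0 R)) // subr0 mulrCA /ofR -rmorphM mulVf ?rmorph1 ?mulr1 //.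
by rewrite gt_eqF // pi2_gt0.
Qed.

Lemma cmean_bound r phi (K : R) : 0 <= r -> circle_continuous r phi ->
  (forall z, rnorm z = r -> rnorm (phi z) <= K) -> rnorm (cmean r phi) <= K.
Proof.
move=> r0 c H; rewrite /cmean rnormM rnorm_ofR gtr0_norm ?invr_gt0 ?pi2_gt0 //.
rewrite ler_pdivrMl ?pi2_gt0 // mulrC; apply: le_trans (cint_bound (K := K) (ltW (pi2_gt0 R)) c _) _.
  by move=> t _; apply: H; rewrite rnorm_polar.
by rewrite subr0.
Qed.

(** Doubling the radius does not change the mean, yet multiplies it by [k]. This replaces the
    explicit integration of negative powers. *)
Lemma cmean_dilation_eq0 r phi (k : C) : 0 < r -> k != 1 ->
  (forall z, z != 0 -> differentiable phi z) ->
  (forall z, phi (ofR 2 * z) = k * phi z) -> cmean r phi = 0.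
Proof.
move=> r0 k1 dphi H.
have cphi s : 0 < s -> circle_continuous s phi.
  move=> s0; apply: differentiable_circle; first exact: ltW.
  by move=> z zs; apply: dphi; rewrite -rnorm_gt0 zs.
have E : cmean r phi = cmean (2 * r) phi.
  apply: cmean_const => //; first by lra.
  by move=> z /andP[h _]; apply: dphi; rewrite -rnorm_gt0 (lt_le_trans r0).
have : (1 - k) * cmean r phi = 0.
  rewrite mulrBl mul1r {1}E -(cmeanZ _ (cphi _ r0)).
  apply/eqP; rewrite subr_eq0; apply/eqP; rewrite /cmean; congr (_ * _); apply: eq_cint => t _.
  by rewrite -H /polar /ofR rmorphM mulrA.
by move/eqP; rewrite mulf_eq0 subr_eq0 eq_sym (negbTE k1) /= => /eqP.
Qed.

Lemma expC2_neq1 n : (0 < n)%N -> (ofR 2 : C) ^+ n != 1.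
Proof.
move=> n0; apply/eqP => /(congr1 (@rnorm R _)) /eqP.
by rewrite rnormX rnorm_ofR rnorm1 normr_nat gt_eqF // exprn_egt1 ?ltr1n // -lt0n.
Qed.

Lemma differentiable_expr n (z : C) : differentiable (fun z : C => z ^+ n) z.
Proof.
elim: n => [|n IH]; first exact: differentiable_cst.
rewrite (_ : (fun _ => _) = (fun z : C => z * z ^+ n)); first exact: differentiableM.
by apply/funext => w; rewrite exprS.
Qed.

Lemma differentiable_exprV n (z : C) : z != 0 -> differentiable (fun z : C => z ^- n) z.
Proof.
move=> z0; apply: differentiableV; first exact: differentiable_expr.
by rewrite expf_neq0.
Qed.

Lemma cmean_exprV r n : 0 < r -> (0 < n)%N -> cmean r (fun z => z ^- n) = 0.
Proof.
move=> r0 n0; apply: (@cmean_dilation_eq0 _ _ ((ofR 2 : C) ^- n) r0).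
- by rewrite invr_eq1 expC2_neq1.
- by move=> z z0; exact: differentiable_exprV.
- by move=> z; rewrite exprMn invfM.
Qed.

(** The circle is shrunk to the origin. Only the limit at 0 enters, not the value, so the lemma
    applies to difference quotients, which take the default value 0 there. *)
Lemma cmean_limit r (rho : R) phi (l : C) : 0 < r -> r < rho ->
  (forall z, 0 < rnorm z < rho -> differentiable phi z) ->
  (forall e : R, 0 < e -> exists2 d : R, 0 < d & forall z, 0 < rnorm z < d -> rnorm (phi z - l) <= e) ->
  cmean r phi = l.
Proof.
move=> r0 rrho dphi lim; apply/eqP; rewrite -subr_eq0 -rnorm_eq0 eq_le rnorm_ge0 andbT.
apply/ler_addgt0Pr => e e0; rewrite add0r.
have [d d0 Hd] := lim e e0.
pose s := Num.min r (d / 2).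
have s0 : 0 < s by rewrite lt_min r0 divr_gt0.
have sr : s <= r by rewrite ge_min lexx.
have sd : s < d by rewrite gt_min; apply/orP; right; lra.
rewrite -(@cmean_const _ s r phi s0 sr); last first.
  by move=> z /andP[h1 h2]; apply: dphi; rewrite (lt_le_trans s0) //= (le_lt_trans h2).
have cs : circle_continuous s phi.
  apply: differentiable_circle; first exact: ltW.
  by move=> z zs; apply: dphi; rewrite zs s0 (le_lt_trans sr).
rewrite -(cmean_cst s l) -(cmeanB cs (circle_continuous_cst (k := l))).
apply: cmean_bound; [exact: ltW| |by move=> z zs; apply: Hd; rewrite zs s0].
by move=> t; apply: cvgB; [exact: cs|exact: cvg_cst].
Qed.

Lemma cmean_center r (rho : R) phi : 0 < r -> r < rho ->
  (forall z, rnorm z < rho -> differentiable phi z) -> cmean r phi = phi 0.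
Proof.
move=> r0 rrho dphi; apply: (cmean_limit r0 rrho).
  by move=> z /andP[_ h]; exact: dphi.
move=> e e0; have d0 : differentiable phi 0 by apply: dphi; rewrite rnorm0 (lt_trans r0).
have /continuous_rnorm/(_ e e0)[d dp Hd] := differentiable_continuous d0.
by exists d => // z /andP[_ /Hd]; rewrite add0r => /ltW.
Qed.

Lemma diffC_mul phi (z h : C) : 'd phi z h = 'd phi z 1 * h.
Proof. by rewrite -{1}[h]mulr1 -[h * 1]/(h *: (1 : C)) linearZ /= mulrC. Qed.

(** Subtracting [phi 0] turns [phi z / z] into a difference quotient with limit ['d phi 0 1]; the
    subtracted term [phi 0 / z] has mean 0. *)
Lemma cmean_derive r (rho : R) phi : 0 < r -> r < rho ->
  (forall z, rnorm z < rho -> differentiable phi z) ->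
  cmean r (fun z => phi z * z^-1) = 'd phi 0 1.
Proof.
move=> r0 rrho dphi.
have rho0 := lt_trans r0 rrho.
have dq z : 0 < rnorm z < rho -> differentiable (fun z => (phi z - phi 0) * z^-1) z.
  move=> /andP[z0 zr]; apply: differentiableM; first by apply: differentiableB => //; exact: dphi.
  by apply: differentiableV => //; rewrite -rnorm_gt0.
have cq : circle_continuous r (fun z => (phi z - phi 0) * z^-1).
  by apply: differentiable_circle => [|z zr]; [exact: ltW|apply: dq; rewrite zr r0].
have ci : circle_continuous r (fun z => z^-1).
  apply: differentiable_circle => [|z zr]; first exact: ltW.
  by apply: differentiableV => //; rewrite -rnorm_gt0 zr.
transitivity (cmean r (fun z => (phi z - phi 0) * z^-1 + phi 0 * z^-1)).
  by apply: eq_cmean => [|z _]; [exact: ltW|rewrite -mulrDl subrK].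
rewrite (cmeanD cq (circle_continuousZ (k := phi 0) ci)) (cmeanZ _ ci).
rewrite (cmean_exprV (n := 1) r0) // mulr0 addr0; apply: (cmean_limit r0 rrho dq) => e e0.
have d0 : differentiable phi 0 by apply: dphi; rewrite rnorm0.
have [d dp Hd] := diff_approx d0 e0.
exists d => // z /andP[z0 /Hd]; rewrite add0r diffC_mul => H.
have zn : z != 0 by rewrite -rnorm_gt0.
have -> : (phi z - phi 0) * z^-1 - 'd phi 0 1 = (phi z - phi 0 - 'd phi 0 1 * z) * z^-1.
  by rewrite [RHS]mulrBl mulfK.
by rewrite rnormM rnormV ler_pdivrMr.
Qed.
End MeanProperties.

(** * Derivatives of holomorphic functions are holomorphic *)

Section Slices.
Variable R : realType.
Local Notation C := (Cplx R).

Lemma slice_diff (V W : normedModType C) (f : V -> W) (x v : V) (z : C) :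
  differentiable f (x + z *: v) ->
  differentiable (fun z : C => f (x + z *: v)) z /\
  'd (fun z : C => f (x + z *: v)) z 1 = 'd f (x + z *: v) v.
Proof.
move=> df.
have H : is_diff z (fun z : C => x + z *: v) (fun z : C => z *: v).
  have -> : (fun z : C => z *: v) = cst 0 \+ (fun z : C => z *: v).
    by apply/funext => w; rewrite /= add0r.
  exact: is_diffD.
have dl := ex_diff (is_diff_def := H); have El := diff_val (is_diff_def := H).
split; first exact: (differentiable_comp dl df).
have -> : 'd (fun z : C => f (x + z *: v)) z = 'd f (x + z *: v) \o 'd (fun z : C => x + z *: v) z :> (C -> W).
  exact: (diff_comp dl df).
by rewrite /= El scale1r.
Qed.

Lemma diffB_linear (V W : normedModType C) (f : V -> W) (L : {linear V -> W}) (x : V) (B : R) :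
  (forall h, rnorm (L h) <= B * rnorm h) -> differentiable f x ->
  differentiable (f \- L) x /\ forall h, 'd (f \- L) x h = 'd f x h - L h.
Proof.
move=> LB df; have [B' _ HB'] := diff_bounded df.
pose M0 h := 'd f x h - L h.
have M_lin : linear M0.
  by move=> k u w; rewrite /M0 linearP linearP /= scalerBr opprD addrACA.
pose M : {linear V -> W} := HB.pack M0 (GRing.isLinear.Build _ _ _ _ M0 M_lin).
have MB h : rnorm (M h) <= (B' + B) * rnorm h.
  by apply: le_trans (rnormB _ _) _; rewrite mulrDl; exact: lerD.
suff H : forall e : R, 0 < e -> exists2 d : R, 0 < d & forall h, rnorm h < d ->
    rnorm ((f \- L) (x + h) - (f \- L) x - M h) <= e * rnorm h.
  have [dM EM] := diff_intro MB H; split; first exact: dM.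
  by move=> h; exact: (congr1 (fun F => F h) EM).
move=> e e0; have [d d0 Hd] := diff_approx df e0; exists d => // h /Hd.
suff -> : (f \- L) (x + h) - (f \- L) x - M h = f (x + h) - f x - 'd f x h by [].
have alg (p q u w r : W) : p - (u + w) - (q - u) - (r - w) = p - q - r.
  rewrite !opprB opprD !addrA; congr (_ - r).
  by rewrite [p - u - w]addrAC subrK [p - w - q]addrAC subrK.
by rewrite -[M h]/('d f x h - L h) -[(f \- L) (x + h)]/(f (x + h) - L (x + h)) linearD; exact: alg.
Qed.

(* Bisection of [0, 1]: the bound is subadditive, so it suffices to check it on short segments. *)
Lemma mean_value_bound (V W : normedModType C) (f : V -> W) (x h : V) (K : R) :
  (forall t : R, 0 <= t <= 1 -> differentiable f (x + ofR t *: h) /\ rnorm ('d f (x + ofR t *: h) h) <= K) ->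
  rnorm (f (x + h) - f x) <= K.
Proof.
move=> H; apply/ler_addgt0Pr => e e0.
(* The second side of the box is the single point 0. The slack [e] absorbs the first-order remainder
   on short segments. *)
pose P (t1 t2 _ _ : R) := rnorm (f (x + ofR t2 *: h) - f (x + ofR t1 *: h)) <= (K + e) * (t2 - t1).
suff : P 0 1 0 0 by rewrite /P /ofR !rmorph0 !rmorph1 scale1r scale0r addr0 subr0 mulr1.
apply: (@box_induction _ P 0 1 0 0) => //.
  move=> t1 t2 u1 u2 m n _ t12 _ _ _ _; rewrite /P => P1 P2 _ _.
  have -> : f (x + ofR t2 *: h) - f (x + ofR t1 *: h) =
    (f (x + ofR t2 *: h) - f (x + ofR m *: h)) + (f (x + ofR m *: h) - f (x + ofR t1 *: h)).
    by rewrite addrA subrK.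
  apply: le_trans (rnormD _ _) _; apply: le_trans (lerD P2 P1) _.
  by rewrite -mulrDr addrA subrK.
move=> t u ht _; have [df Kt] := H t ht.
have e1 : 0 < e / (rnorm h + 1) by rewrite divr_gt0 // ltr_wpDl ?rnorm_ge0.
have [d d0 Hd] := diff_approx df e1.
have inc s : `|s - t| * (rnorm h + 1) < d ->
    rnorm (f (x + ofR s *: h) - f (x + ofR t *: h)) <= (K + e) * `|s - t|.
  move=> hs; have E : x + ofR s *: h = x + ofR t *: h + ofR (s - t) *: h.
    by rewrite -addrA -scalerDl /ofR -rmorphD /= subrKC.
  have N : rnorm (ofR (s - t) *: h) = `|s - t| * rnorm h by rewrite rnormZ rnorm_ofR.
  have Nd : rnorm (ofR (s - t) *: h) < d.
    by rewrite N; apply: le_lt_trans hs; rewrite ler_wpM2l // lerDl.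
  have := Hd _ Nd; rewrite -E N linearZ => H1.
  have -> : f (x + ofR s *: h) - f (x + ofR t *: h) =
    (f (x + ofR s *: h) - f (x + ofR t *: h) - ofR (s - t) *: 'd f (x + ofR t *: h) h) +
    ofR (s - t) *: 'd f (x + ofR t *: h) h by rewrite subrK.
  apply: le_trans (rnormD _ _) _; apply: le_trans (lerD H1 (lexx _)) _.
  rewrite rnormZ rnorm_ofR mulrDl addrC; apply: lerD.
    by rewrite mulrC ler_wpM2r.
  rewrite [`|s - t| * rnorm h]mulrC mulrA ler_wpM2r ?normr_ge0 //.
  rewrite mulrAC ler_pdivrMr ?ltr_wpDl ?rnorm_ge0 // ler_wpM2l ?(ltW e0) //.
  by rewrite lerDl.
exists (d / (rnorm h + 1)) => [|t1 t2 w1 w2 _ h12 _ _ _ _ ht12 _].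
  by rewrite divr_gt0 // ltr_wpDl ?rnorm_ge0.
have p0 : 0 < rnorm h + 1 by rewrite ltr_wpDl ?rnorm_ge0.
move: h12 => /andP[h1 h2]; rewrite ltr_pdivlMr // in ht12.
have A2 : `|t2 - t| = t2 - t by rewrite ger0_norm ?subr_ge0.
have A1 : `|t1 - t| = t - t1 by rewrite distrC ger0_norm ?subr_ge0.
have B2 := inc t2; have B1 := inc t1; rewrite A2 in B2; rewrite A1 in B1.
rewrite /P.
have -> : f (x + ofR t2 *: h) - f (x + ofR t1 *: h) =
    (f (x + ofR t2 *: h) - f (x + ofR t *: h)) - (f (x + ofR t1 *: h) - f (x + ofR t *: h)).
  by rewrite opprB addrA subrK.
apply: le_trans (rnormB _ _) _.
have -> : (K + e) * (t2 - t1) = (K + e) * (t2 - t) + (K + e) * (t - t1).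
  by rewrite -mulrDr addrA subrK.
by apply: lerD; [apply: B2|apply: B1]; apply: le_lt_trans ht12; rewrite ler_wpM2r ?(ltW p0) //; lra.
Qed.

Lemma cauchy_directional (V : normedModType C) (f : V -> C) (x v : V) (s rho : R) :
  0 < s -> s < rho -> (forall z : C, rnorm z < rho -> differentiable f (x + z *: v)) ->
  'd f x v = cmean s (fun z => f (x + z *: v) * z^-1).
Proof.
move=> s0 srho H.
have H1 z : rnorm z < rho -> differentiable (fun z : C => f (x + z *: v)) z.
  by move=> /H /slice_diff[].
rewrite (cmean_derive s0 srho H1).
have x0 : x + 0 *: v = x by rewrite scale0r addr0.
have d0 : differentiable f (x + 0 *: v) by apply: H; rewrite rnorm0 (lt_trans s0).
by have [_ ->] := slice_diff d0; rewrite x0.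
Qed.
End Slices.

(** * Differentiation of Cauchy's formula under the mean *)

Section DerivativeIsHolomorphic.
Variable R : realType.
Local Notation C := (Cplx R).
Variables (V : normedModType C) (f : V -> C) (x0 : V) (d B : R).
Hypothesis d0 : 0 < d.
Hypothesis df : forall x, rnorm (x - x0) < 4 * d -> differentiable f x.
Hypothesis fB : forall x, rnorm (x - x0) < 4 * d -> rnorm (f x) <= B.

Let ball_add x u (r1 r2 : R) : rnorm (x - x0) <= r1 -> rnorm u <= r2 -> rnorm (x + u - x0) <= r1 + r2.
Proof. by move=> h1 h2; rewrite addrAC; apply: le_trans (rnormD _ _) _; exact: lerD. Qed.

Let cauchy_repr x u s : rnorm (x - x0) <= 2 * d -> 0 < s -> s * rnorm u <= d ->
  'd f x u = cmean s (fun z => f (x + z *: u) * z^-1).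
Proof.
have dp := d0.
(* The disc of radius [2 * s] displaces [x] by less than [2 * d], so it stays in the ball of radius
   [4 * d]. *)
move=> hx s0 su; apply: (@cauchy_directional _ _ _ _ _ s (2 * s)) => // [|z hz]; first by lra.
apply: df; apply: le_lt_trans (ball_add hx (lexx (rnorm (z *: u)))) _.
rewrite rnormZ; have [u0|u0] := eqVneq (rnorm u) 0; first by rewrite u0 mulr0; lra.
have : rnorm z * rnorm u < 2 * s * rnorm u by rewrite ltr_pM2r // lt_neqAle eq_sym u0 rnorm_ge0.
by lra.
Qed.

Let circle_f x u s : rnorm (x - x0) <= 2 * d -> 0 < s -> s * rnorm u <= d ->
  circle_continuous s (fun z => f (x + z *: u) * z^-1).
Proof.
have dp := d0.
move=> hx s0 su; apply: differentiable_circle => [|z zs]; first exact: ltW.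
apply: differentiableM; last by apply: differentiableV => //; rewrite -rnorm_gt0 zs.
apply: (slice_diff _).1; apply: df.
apply: le_lt_trans (ball_add hx (lexx (rnorm (z *: u)))) _.
by rewrite rnormZ zs; lra.
Qed.

Let A := B / d.
Let B0 : 0 <= B.
Proof. by apply: le_trans (fB (x := x0) _); rewrite ?rnorm_ge0 // subrr rnorm0 mulr_gt0. Qed.
Let A0 : 0 <= A. Proof. by rewrite divr_ge0 // ltW. Qed.

(** Cauchy's estimate on the circle of radius [d / rnorm u], along which the displacement has norm
    [d]. *)
Let diff_bound x u : rnorm (x - x0) <= 2 * d -> rnorm ('d f x u) <= A * rnorm u.
Proof.
have dp := d0.
move=> hx; have [->|u0] := eqVneq u 0; first by rewrite linear0 !rnorm0 mulr0.
have up : 0 < rnorm u by rewrite rnorm_gt0.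
have s0 : 0 < d / rnorm u by rewrite divr_gt0.
have su : d / rnorm u * rnorm u <= d by rewrite divfK ?gt_eqF.
rewrite (cauchy_repr hx s0 su); apply: cmean_bound; [exact: ltW|exact: circle_f|].
move=> z zs; rewrite rnormM rnormV zs invfM invrK /A -mulrA [d^-1 * _]mulrC mulrA.
rewrite -mulrA ler_wpM2r ?mulr_ge0 ?invr_ge0 ?(ltW up) ?(ltW d0) //.
apply: fB; apply: le_lt_trans (ball_add hx (lexx (rnorm (z *: u)))) _.
by rewrite rnormZ zs divfK ?gt_eqF //; lra.
Qed.

Let segment_in (r : R) x y (t : R) : 0 <= t <= 1 -> rnorm (x - x0) <= r -> rnorm (y - x0) <= r ->
  rnorm (x + ofR t *: (y - x) - x0) <= r.
Proof.
have dp := d0.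
move=> /andP[t0 t1] hx hy.
have -> : x + ofR t *: (y - x) - x0 = ofR (1 - t) *: (x - x0) + ofR t *: (y - x0).
  have E (u w : V) : ofR (1 - t) *: u + ofR t *: w = u + ofR t *: (w - u).
    by rewrite /ofR rmorphB rmorph1 scalerBl scale1r scalerBr -addrA [- _ + _]addrC.
  by rewrite E opprB addrA subrK addrAC.
apply: le_trans (rnormD _ _) _; rewrite !rnormZ !rnorm_ofR !ger0_norm ?subr_ge0 //.
have := ler_wpM2l t0 hy; have : (1 - t) * rnorm (x - x0) <= (1 - t) * r by rewrite ler_wpM2l ?subr_ge0.
by lra.
Qed.

Let f_lipschitz x y : rnorm (x - x0) <= 2 * d -> rnorm (y - x0) <= 2 * d ->
  rnorm (f y - f x) <= A * rnorm (y - x).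
Proof.
have dp := d0.
move=> hx hy; rewrite -{1}(subrKC x y); apply: mean_value_bound => t ht.
have hs := segment_in ht hx hy.
by split; [apply: df; apply: le_lt_trans hs _; lra|exact: diff_bound].
Qed.

(** Cauchy's estimate for the increment [f (y + .) - f (x + .)], which [f_lipschitz] bounds; hence
    one more factor [1 / d]. *)
Let diff_lipschitz x y u : rnorm (x - x0) <= d -> rnorm (y - x0) <= d ->
  rnorm ('d f y u - 'd f x u) <= A / d * rnorm (y - x) * rnorm u.
Proof.
have dp := d0.
move=> hx hy; have [->|u0] := eqVneq u 0; first by rewrite linear0 linear0 subrr !rnorm0 mulr0.
have up : 0 < rnorm u by rewrite rnorm_gt0.
have s0 : 0 < d / rnorm u by rewrite divr_gt0.
have su : d / rnorm u * rnorm u <= d by rewrite divfK ?gt_eqF.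
have hx2 : rnorm (x - x0) <= 2 * d by lra.
have hy2 : rnorm (y - x0) <= 2 * d by lra.
rewrite (cauchy_repr hx2 s0 su) (cauchy_repr hy2 s0 su).
rewrite -(cmeanB (circle_f hy2 s0 su) (circle_f hx2 s0 su)).
apply: cmean_bound; first exact: ltW.
  by move=> t; apply: cvgB; apply: circle_f.
move=> z zs; rewrite -mulrBl rnormM rnormV zs invfM invrK.
have -> : A / d * rnorm (y - x) * rnorm u = A * rnorm (y - x) * (d^-1 * rnorm u) by ring.
rewrite ler_wpM2r //; first by rewrite mulr_ge0 ?invr_ge0 // ltW.
have zu : rnorm (z *: u) <= d by rewrite rnormZ zs.
apply: le_trans (f_lipschitz _ _) _.
- by apply: le_trans (ball_add hx zu) _; lra.
- by apply: le_trans (ball_add hy zu) _; lra.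
- by rewrite opprD addrACA subrr addr0.
Qed.

(** The mean value inequality for [f - 'd f x], whose differential along the segment is small by
    [diff_lipschitz]. The estimate is uniform in [x], as differentiation under the mean requires. *)
Let second_order x y : rnorm (x - x0) <= d -> rnorm (y - x0) <= d ->
  rnorm (f y - f x - 'd f x (y - x)) <= A / d * rnorm (y - x) ^+ 2.
Proof.
have dp := d0.
move=> hx hy; set h := y - x.
have dx : differentiable f x by apply: df; apply: le_lt_trans hx _; lra.
pose g : V -> C := f \- 'd f x.
have -> : f y - f x - 'd f x h = g (x + h) - g x.
  have alg (p q a b : C) : p - q - b = p - (a + b) - (q - a) by ring.
  have Dl : 'd f x (x + h) = 'd f x x + 'd f x h by exact: linearD.
  have -> : f y = f (x + h) by rewrite /h subrKC.
  rewrite -[g (x + h)]/(f (x + h) - 'd f x (x + h)) -[g x]/(f x - 'd f x x) Dl.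
  exact: alg.
apply: mean_value_bound => t ht; have hs := segment_in ht hx hy; rewrite -/h in hs.
have dt : differentiable f (x + ofR t *: h) by apply: df; apply: le_lt_trans hs _; lra.
have [Bx _ HBx] := diff_bounded dx.
have [dg Eg] := diffB_linear HBx dt; split; first exact: dg.
have -> : 'd g (x + ofR t *: h) h = 'd f (x + ofR t *: h) h - 'd f x h by exact: Eg.
apply: le_trans (diff_lipschitz _ hx hs) _.
rewrite addrAC subrr add0r rnormZ rnorm_ofR.
rewrite expr2 -mulrA ler_wpM2l ?divr_ge0 ?(ltW d0) // ler_wpM2r ?rnorm_ge0 //.
by case/andP: ht => t0 t1; rewrite ger0_norm // ler_piMl ?rnorm_ge0.
Qed.

Lemma differentiable_diff_bounded v : differentiable (fun x => 'd f x v) x0.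
Proof.
have dp := d0.
(* Half of [d] is left for the increment [h]; adding 1 covers [v = 0]. *)
pose s := d / 2 / (rnorm v + 1).
have v1 : 0 < rnorm v + 1 by rewrite ltr_wpDl ?rnorm_ge0.
have s0 : 0 < s by rewrite !divr_gt0.
have sv : s * rnorm v <= d / 2.
  have : s * (rnorm v + 1) = d / 2 by rewrite /s divfK ?gt_eqF.
  by rewrite mulrDr mulr1; lra.
have sv1 : s * rnorm v <= d by lra.
have x00 : rnorm (x0 - x0) <= 0 by rewrite subrr rnorm0.
have inz (z : C) : rnorm z = s -> rnorm (x0 + z *: v - x0) <= d / 2.
  by move=> zs; rewrite addrAC subrr add0r rnormZ zs.
(* The derivative of Cauchy's formula for ['d f x v], taken under the mean. *)
pose L0 (h : V) : C := cmean s (fun z => 'd f (x0 + z *: v) h * z^-1).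
have cL h : circle_continuous s (fun z => 'd f (x0 + z *: v) h * z^-1).
  apply: circle_continuousM; last first.
    apply: differentiable_circle => [|z zs]; first exact: ltW.
    by apply: differentiableV => //; rewrite -rnorm_gt0 zs.
  (* Continuity of ['d f] along the circle comes from [diff_lipschitz], since its differentiability
     is the goal itself. *)
  move=> t; apply/cvgrPdist_lt => e /gt0_ofR[e' e0 ->].
  pose K := A / d * (s * (rnorm v + 1)) * (rnorm h + 1) + 1.
  have h1 : 0 < rnorm h + 1 by rewrite ltr_wpDl ?rnorm_ge0.
  have K0 : 0 < K by rewrite ltr_wpDl // !mulr_ge0 ?invr_ge0 // ltW.
  apply/nbhs_normP; exists (e' / K); first by rewrite /= divr_gt0.
  move=> t' /= ht; rewrite normE /ofR ltcR.
  have in1 t1 : rnorm (x0 + polar s t1 *: v - x0) <= d.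
    by apply: le_trans (inz _ _) _; [exact: rnorm_polar (ltW s0)|lra].
  apply: le_lt_trans (diff_lipschitz _ (in1 _) (in1 _)) _.
  rewrite opprD addrACA subrr add0r -scalerBl rnormZ.
  have P := polar_lip s t s t'; rewrite subrr normr0 add0r (gtr0_norm s0) in P.
  rewrite ltr_pdivlMr // in ht; apply: le_lt_trans ht; rewrite mulrC /K mulrDr mulr1.
  apply: le_trans (_ : `|t - t'| * (A / d * (s * (rnorm v + 1)) * (rnorm h + 1)) <= _); last by rewrite lerDl.
  have -> : `|t - t'| * (A / d * (s * (rnorm v + 1)) * (rnorm h + 1)) =
    (rnorm h + 1) * (A / d * (s * `|t - t'| * (rnorm v + 1))) by ring.
  apply: ler_pM; rewrite ?rnorm_ge0 ?lerDl //.
    by rewrite !mulr_ge0 ?invr_ge0 ?rnorm_ge0 // ltW.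
  rewrite ler_wpM2l ?divr_ge0 ?(ltW d0) //; apply: ler_pM; rewrite ?rnorm_ge0 ?lerDl //.
have lin : linear L0.
  move=> k x y; rewrite /L0 -[k *: cmean _ _]/(k * cmean _ _) -(cmeanZ _ (cL x)).
  rewrite -(cmeanD (circle_continuousZ (k := k) (cL x)) (cL y)); congr cmean; apply/funext => z.
  by rewrite linearD linearZ mulrDl -mulrA.
pose L : {linear V -> C} := HB.pack L0 (GRing.isLinear.Build _ _ _ _ L0 lin).
have LB h : rnorm (L h) <= A / s * rnorm h.
  apply: cmean_bound; [exact: ltW|exact: cL|move=> z zs].
  rewrite rnormM rnormV zs mulrAC ler_wpM2r ?invr_ge0 ?(ltW s0) //.
  by apply: diff_bound; apply: le_trans (inz _ zs) _; lra.
apply: (diff_intro LB _).1 => e e0.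
pose K := A / d / s + 1.
have K0 : 0 < K by rewrite ltr_wpDl // !mulr_ge0 ?invr_ge0 // ltW.
exists (Num.min (d / 2) (e / K)) => [|h]; first by rewrite lt_min !divr_gt0.
rewrite lt_min => /andP[hd he].
have hx : rnorm (x0 + h - x0) <= d / 2 by rewrite addrAC subrr add0r ltW.
have hx2 : rnorm (x0 + h - x0) <= 2 * d by apply: le_trans hx _; lra.
have x02 : rnorm (x0 - x0) <= 2 * d by apply: le_trans x00 _; lra.
rewrite (cauchy_repr hx2 s0 sv1) (cauchy_repr x02 s0 sv1).
rewrite -(cmeanB (circle_f hx2 s0 sv1) (circle_f x02 s0 sv1)) -[L h]/(L0 h).
rewrite -(cmeanB _ (cL h)); last first.
  by move=> t; apply: cvgB; [exact: (circle_f hx2)|exact: (circle_f x02)].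
apply: le_trans (_ : A / d / s * rnorm h ^+ 2 <= _).
  apply: cmean_bound; first exact: ltW.
    move=> t; apply: cvgB; last exact: cL.
    by apply: cvgB; [exact: (circle_f hx2)|exact: (circle_f x02)].
  move=> z zs; rewrite -!mulrBl rnormM rnormV zs.
  rewrite mulrAC ler_wpM2r ?invr_ge0 ?(ltW s0) //.
  have E : x0 + h + z *: v - (x0 + z *: v) = h.
    by rewrite -[x0 + h + _]addrA opprD addrACA subrr add0r addrK.
  have := @second_order (x0 + z *: v) (x0 + h + z *: v); rewrite E; apply.
    by apply: le_trans (inz _ zs) _; lra.
  rewrite (_ : _ - x0 = h + z *: v); last by rewrite -[x0 + h + _]addrA addrAC subrr add0r.
  apply: le_trans (rnormD _ _) _; rewrite rnormZ zs; lra.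
rewrite expr2 mulrA ler_wpM2r ?rnorm_ge0 //.
rewrite ltr_pdivlMr // in he; apply: ltW; apply: le_lt_trans he.
by rewrite mulrC /K mulrDr mulr1 lerDl rnorm_ge0.
Qed.
End DerivativeIsHolomorphic.

(** Continuity of [f] at [x0] supplies the local bound that Cauchy's estimates require. *)
Lemma differentiable_diff (R : realType) (V : normedModType (Cplx R)) (f : V -> Cplx R) (x0 v : V) :
  (\forall x \near x0, differentiable f x) -> differentiable (fun x => 'd f x v) x0.
Proof.
move=> /nbhs_rnorm[r r0 Hr].
have fx0 : differentiable f x0 by rewrite -[x0]addr0; apply: Hr; rewrite rnorm0.
have /continuous_rnorm/(_ _ ltr01)[e e0 He] := differentiable_continuous fx0.
pose d := Num.min r e / 4.
have d0 : 0 < d by rewrite divr_gt0 // lt_min r0.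
have d4 : 4 * d = Num.min r e by rewrite /d; lra.
apply: (@differentiable_diff_bounded _ _ _ _ d (rnorm (f x0) + 1)) => // x.
  by rewrite d4 lt_min => /andP[/Hr + _]; rewrite subrKC.
rewrite d4 lt_min => /andP[_ /He]; rewrite subrKC => H.
have := rnormD (f x - f x0) (f x0); rewrite subrK => /le_trans; apply.
by rewrite addrC lerD2l ltW.
Qed.

(** * Row vectors and iterated Frechet derivatives *)

Section Rows.
Variable R : realType.
Local Notation C := (Cplx R).

Lemma rnorm_entry n (z : 'rV[C]_n) k : rnorm (z ord0 k) <= rnorm z.
Proof.
rewrite leNgt; apply/negP => lt_z.
have e0 : 0 < rnorm (z ord0 k) by apply: le_lt_trans lt_z; exact: rnorm_ge0.
have : ball (0 : 'rV[C]_n) (ofR (rnorm (z ord0 k))) z.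
  by rewrite -ball_normE /= sub0r normrN normE /ofR ltcR.
move=> [_ /(_ ord0 k)]; rewrite -ball_normE /= mxE sub0r normrN normE /ofR ltcR.
by rewrite ltxx.
Qed.

Lemma rnorm_row_attained n (z : 'rV[C]_n) : z != 0 -> exists k, rnorm z = rnorm (z ord0 k).
Proof.
rewrite -normr_eq0 => /mx_norm_neq0[[i k] /= E]; exists k.
by rewrite /rnorm (_ : `|z| = mx_norm z) // E (ord1 i).
Qed.

Lemma rnorm_row_le n (z : 'rV[C]_n) (r : R) : 0 <= r -> (forall k, rnorm (z ord0 k) <= r) -> rnorm z <= r.
Proof.
move=> r0 H; have [->|/rnorm_row_attained[k ->]] := eqVneq z 0; last exact: H.
by rewrite rnorm0.
Qed.

Lemma diff_entry (V : normedModType C) n (F : V -> 'rV[C]_n) (x : V) k :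
  differentiable F x -> differentiable (fun y => F y ord0 k) x /\
  forall h, 'd (fun y => F y ord0 k) x h = 'd F x h ord0 k.
Proof.
move=> dF; have [B _ HB] := diff_bounded dF.
pose L0 (h : V) : C := 'd F x h ord0 k.
have lin : linear L0 by move=> a u w; rewrite /L0 linearP !mxE.
pose L : {linear V -> C} := HB.pack L0 (GRing.isLinear.Build _ _ _ _ L0 lin).
have LB h : rnorm (L h) <= B * rnorm h by apply: le_trans (HB h); exact: rnorm_entry.
suff H : forall e : R, 0 < e -> exists2 d : R, 0 < d & forall h, rnorm h < d ->
    rnorm (F (x + h) ord0 k - F x ord0 k - L h) <= e * rnorm h.
  have [dM EM] := diff_intro (f := fun y => F y ord0 k) LB H; split; first exact: dM.
  by move=> h; exact: (congr1 (fun G => G h) EM).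
move=> e e0; have [d d0 Hd] := diff_approx dF e0; exists d => // h /Hd; apply: le_trans.
by have := rnorm_entry (F (x + h) - F x - 'd F x h) k; rewrite !mxE.
Qed.

Lemma diff_row (V : normedModType C) n (F : V -> 'rV[C]_n) (x : V) :
  (forall k, differentiable (fun y => F y ord0 k) x) -> differentiable F x.
Proof.
move=> H.
have -> : F = \sum_(k < n) (fun y => F y ord0 k *: delta_mx 0 k).
  by apply/funext => y; rewrite fct_sumE [LHS]row_sum_delta.
by apply: differentiable_sum => k; apply: differentiableZl.
Qed.

Lemma nbhs_polydisk n (x : 'rV[C]_n) : polydisk x -> nbhs x (polydisk (R := R) (n := n)).
Proof.
move=> Dx; apply/nbhs_rnorm; exists (1 - rnorm x); first by rewrite subr_gt0.
by move=> h hh; rewrite /polydisk /=; apply: le_lt_trans (rnormD _ _) _; rewrite -ltrBrDl.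
Qed.

Lemma polydisk0 n : polydisk (0 : 'rV[C]_n).
Proof. by rewrite /polydisk /= rnorm0. Qed.

Lemma diff_local_polydisk n (W : normedModType C) (g1 g2 : 'rV[C]_n -> W) (x : 'rV[C]_n) :
  polydisk x -> differentiable g2 x -> (forall y, polydisk y -> g1 y = g2 y) ->
  differentiable g1 x /\ forall h, 'd g1 x h = 'd g2 x h.
Proof.
move=> Dx d2 E; have H : nbhs x (fun y => g1 y = g2 y).
  by apply: filterS (nbhs_polydisk Dx) => y; exact: E.
have [d1 E1] := diff_local d2 H; split; first exact: d1.
by move=> h; exact: (congr1 (fun G => G h) E1).
Qed.

Lemma diff_lincomb (V W : normedModType C) (g1 g2 : V -> W) (a : C) (x : V) :
  differentiable g1 x -> differentiable g2 x ->
  differentiable (fun y => a *: g1 y + g2 y) x /\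
  forall h, 'd (fun y => a *: g1 y + g2 y) x h = a *: 'd g1 x h + 'd g2 x h.
Proof.
move=> d1 d2.
have dg : is_diff x (a *: g1 + g2) (a *: ('d g1 x : V -> W) + 'd g2 x).
  apply: is_diffD; [apply: is_diffZ|]; exact: differentiableP.
split; first exact: (ex_diff (is_diff_def := dg)).
by move=> h; exact: (congr1 (fun G => G h) (diff_val (is_diff_def := dg))).
Qed.

Section Frechet.
Variables (n : nat) (f : 'rV[C]_n -> 'rV[C]_n).
Hypothesis hf : holomorphic_on_polydisk f.
Implicit Types (x u v w z : 'rV[C]_n) (vs : seq 'rV[C]_n).

(** [differentiable_diff] concerns scalar functions, so the induction passes through the
    components. *)
Lemma differentiable_frechetD vs x : polydisk x -> differentiable (frechetD f vs) x.
Proof.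
elim: vs x => [|v vs IH] x Dx /=; first exact: hf.
apply: diff_row => k.
have H : differentiable (fun y => 'd (fun y => frechetD f vs y ord0 k) y v) x.
  apply: differentiable_diff; near=> y; apply: (diff_entry k _).1; apply: IH.
  by near: y; exact: nbhs_polydisk.
apply: (diff_local_polydisk Dx H _).1 => y Dy.
by have [_ ->] := diff_entry k (IH y Dy).
Unshelve. all: by end_near. Qed.

Lemma frechetD_linear vs1 vs2 (a : C) u v x : polydisk x ->
  frechetD f (vs1 ++ (a *: u + v) :: vs2) x =
  a *: frechetD f (vs1 ++ u :: vs2) x + frechetD f (vs1 ++ v :: vs2) x.
Proof.
elim: vs1 x => [|w vs1 IH] x Dx /=; first by rewrite linearP.
have [dg Eg] := diff_lincomb a (differentiable_frechetD (vs1 ++ u :: vs2) Dx)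
  (differentiable_frechetD (vs1 ++ v :: vs2) Dx).
have [_ E] := @diff_local_polydisk n _ (frechetD f (vs1 ++ (a *: u + v) :: vs2)) _ x Dx dg IH.
exact: etrans (E w) (Eg w).
Qed.

Lemma component_frechetD k vs x : polydisk x ->
  frechetD (component f k) vs x = frechetD f vs x ord0 k.
Proof.
elim: vs x => [//|v vs IH] x Dx /=.
have [d1 E1] := diff_entry k (differentiable_frechetD vs Dx).
by have [_ ->] := diff_local_polydisk Dx d1 IH; rewrite E1.
Qed.

(** The second difference is symmetric in [u] and [v], whereas the derivative approximating it is
    taken in a definite order; exchanging [u] and [v] therefore proves that the order is
    irrelevant. *)
Lemma second_difference_approx u v k (e : R) : 0 < e -> exists2 d : R, 0 < d &
  forall t : R, 0 <= t < d ->
  rnorm (f (ofR t *: (u + v)) ord0 k - f (ofR t *: u) ord0 k - f (ofR t *: v) ord0 k + f 0 ord0 k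
    - ofR t * ofR t * frechetD f [:: v; u] 0 ord0 k) <= e * t ^+ 2.
Proof.
have alg (p q r a b : C) : p - q - (a - b) = (p - r - a) - (q - r - b) by ring.
move=> e0; set c := frechetD f [:: v; u] 0 ord0 k.
pose F y := f y ord0 k; pose G y : C := 'd f y u ord0 k.
have D0 := polydisk0 n.
have [dG EG] := diff_entry k (differentiable_frechetD [:: u] D0).
(* Two points of norm at most [t * (rnorm u + rnorm v)] enter, hence the 2; the 1 keeps [N]
   positive. *)
pose N := 2 * (rnorm u + rnorm v) + 1.
have N0 : 0 < N by rewrite /N; have := rnorm_ge0 u; have := rnorm_ge0 v; lra.
have e1 : 0 < e / N by rewrite divr_gt0.
have [d d0 Hd] := diff_approx dG e1.
exists (Num.min d 1 / N) => [|t /andP[t0 td]]; first by rewrite divr_gt0 // lt_min d0 ltr01.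
rewrite ltr_pdivlMr // lt_min in td; case/andP: td => td t1.
(* Mean value inequality for s |-> f(s u + t v) - f(s u) - s t D^2 f(0)(v, u) on [0, t]. *)
pose Psi (s : C) : C := -1 *: F (0 + s *: u) + F (ofR t *: v + s *: u) - s * (ofR t * c).
have EPsi : f (ofR t *: (u + v)) ord0 k - f (ofR t *: u) ord0 k - f (ofR t *: v) ord0 k + f 0 ord0 k
    - ofR t * ofR t * c = Psi (0 + ofR t) - Psi 0.
  rewrite /Psi /F !add0r scale0r !addr0 scalerDr [ofR t *: v + _]addrC mul0r.
  by rewrite -![-1 *: _]/(-1 * _); ring.
rewrite EPsi; apply: mean_value_bound => s /andP[s0 s1]; rewrite add0r.
set w : C := ofR s *: ofR t.
have wE : w = ofR (s * t) by rewrite /w /ofR rmorphM.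
have st : 0 <= s * t <= t by rewrite mulr_ge0 //= ler_piMl.
have nb a b : rnorm (ofR a *: v + ofR b *: u) <= `|a| * rnorm v + `|b| * rnorm u.
  by apply: le_trans (rnormD _ _) _; rewrite !rnormZ !rnorm_ofR.
have pv := rnorm_ge0 v; have pu := rnorm_ge0 u.
have tN : t * (rnorm u + rnorm v) <= t * N by rewrite ler_wpM2l // /N; lra.
have b1 : rnorm (ofR t *: v + w *: u) <= t * (rnorm u + rnorm v).
  rewrite wE; apply: le_trans (nb _ _) _; rewrite !ger0_norm //; last by case/andP: st.
  rewrite mulrDr addrC lerD2r ler_wpM2r //; by case/andP: st.
have b2 : rnorm (0 + w *: u) <= t * (rnorm u + rnorm v).
  rewrite add0r wE rnormZ rnorm_ofR ger0_norm; last by case/andP: st.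
  apply: le_trans (_ : t * rnorm u <= _); first by rewrite ler_wpM2r //; case/andP: st.
  by rewrite mulrDr lerDl mulr_ge0.
have in1 : polydisk (ofR t *: v + w *: u) by rewrite /polydisk /=; lra.
have in2 : polydisk (0 + w *: u) by rewrite /polydisk /=; lra.
have [dF1 EF1] := diff_entry k (hf in1).
have [dF2 EF2] := diff_entry k (hf in2).
have [dS1 ES1] := slice_diff dF1.
have [dS2 ES2] := slice_diff dF2.
have cB h : rnorm (h * (ofR t * c)) <= rnorm (ofR t * c) * rnorm h by rewrite rnormM mulrC.
have lin : linear (fun h : C => h * (ofR t * c)).
  by move=> a x y; rewrite mulrDl -scalerAl.
pose L : {linear C -> C} := HB.pack (fun h : C => h * (ofR t * c)) (GRing.isLinear.Build _ _ _ _ _ lin).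
have [dS ES] := diff_lincomb (-1) dS2 dS1.
have [dP EP] := diffB_linear (L := L) cB dS.
split; first exact: dP.
have -> : 'd Psi w (ofR t) = (G (ofR t *: v + w *: u) - G (0 + w *: u) - ofR t * c) * ofR t.
  rewrite diffC_mul; congr (_ * _); apply: etrans (EP 1) _.
  have L1 : L 1 = ofR t * c by exact: mul1r.
  rewrite L1; congr (_ - _); apply: etrans (ES 1) _.
  apply: etrans (congr2 (fun p q : C => -1 * p + q) (etrans ES2 (EF2 u)) (etrans ES1 (EF1 u))) _.
  by rewrite mulN1r addrC.
have h1 := Hd _ (le_lt_trans b1 (le_lt_trans tN td)).
have h2 := Hd _ (le_lt_trans b2 (le_lt_trans tN td)).
rewrite add0r in h1; rewrite add0r in h2.
have DGE h : 'd (fun y => frechetD f [:: u] y ord0 k) 0 h = frechetD f [:: h; u] 0 ord0 k by rewrite EG.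
have cE : ofR t * c = 'd (fun y => frechetD f [:: u] y ord0 k) 0 (ofR t *: v + w *: u) -
   'd (fun y => frechetD f [:: u] y ord0 k) 0 (0 + w *: u).
  by rewrite -linearB /= add0r addrK linearZ /= EG.
rewrite rnormM rnorm_ofR (ger0_norm t0).
have -> : e * t ^+ 2 = (e * t) * t by rewrite expr2 mulrA.
rewrite ler_wpM2r // cE.
set l1 := 'd _ 0 (ofR t *: v + w *: u) in h1 *; set l2 := 'd _ 0 (0 + w *: u) in h2 *.
rewrite (alg _ _ (G 0)).
apply: le_trans (rnormB _ _) _; apply: le_trans (lerD h1 h2) _.
rewrite -mulrDr mulrAC ler_pdivrMr // -mulrA ler_wpM2l ?(ltW e0) //.
apply: le_trans (lerD b1 b2) _; rewrite /N; lra.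
Qed.

Lemma frechetD_symmetric u v k :
  frechetD f [:: u; v] 0 ord0 k = frechetD f [:: v; u] 0 ord0 k.
Proof.
apply/eqP; rewrite -subr_eq0 -rnorm_eq0 eq_le rnorm_ge0 andbT.
apply/ler_addgt0Pr => e e0; rewrite add0r.
have e2 : 0 < e / 2 by rewrite divr_gt0.
have [d1 d10 H1] := second_difference_approx u v k e2.
have [d2 d20 H2] := second_difference_approx v u k e2.
pose t := Num.min d1 d2 / 2.
have m0 : 0 < Num.min d1 d2 by rewrite lt_min d10.
have t0 : 0 < t by rewrite divr_gt0.
have tm : t < Num.min d1 d2 by rewrite /t; lra.
rewrite lt_min in tm; case/andP: tm => t1 t2.
have := H1 t; have := H2 t; rewrite (ltW t0) t1 t2 => /(_ isT) h2 /(_ isT) h1.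
have E : (ofR t * ofR t) * (frechetD f [:: u; v] 0 ord0 k - frechetD f [:: v; u] 0 ord0 k) =
  (f (ofR t *: (u + v)) ord0 k - f (ofR t *: u) ord0 k - f (ofR t *: v) ord0 k + f 0 ord0 k
    - ofR t * ofR t * frechetD f [:: v; u] 0 ord0 k) -
  (f (ofR t *: (v + u)) ord0 k - f (ofR t *: v) ord0 k - f (ofR t *: u) ord0 k + f 0 ord0 k
    - ofR t * ofR t * frechetD f [:: u; v] 0 ord0 k).
  by rewrite [v + u]addrC; ring.
have := congr1 (@rnorm R _) E; rewrite rnormM rnormM rnorm_ofR (gtr0_norm t0) => E'.
have : t * t * rnorm (frechetD f [:: u; v] 0 ord0 k - frechetD f [:: v; u] 0 ord0 k) <= t * t * e.
  rewrite E'; apply: le_trans (rnormB _ _) _; apply: le_trans (lerD h1 h2) _.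
  by rewrite expr2; lra.
by rewrite ler_pM2l // mulr_gt0.
Qed.
End Frechet.
End Rows.

(** * Holomorphic functions on the unit disc *)

Section DiscFunctions.
Variable R : realType.
Local Notation C := (Cplx R).
Implicit Types (phi psi h : C -> C) (z : C).

Definition cderive phi z : C := 'd phi z 1.
Definition disc_holomorphic phi := forall z, rnorm z < 1 -> differentiable phi z.

Lemma nbhs_disc z : rnorm z < 1 -> nbhs z (fun w : C => rnorm w < 1).
Proof.
move=> z1; apply/nbhs_rnorm; exists (1 - rnorm z); first by rewrite subr_gt0.
by move=> h hh; apply: le_lt_trans (rnormD _ _) _; rewrite -ltrBrDl.
Qed.

Lemma disc_holomorphic_cderive phi : disc_holomorphic phi -> disc_holomorphic (cderive phi).
Proof.
by move=> H z z1; apply: differentiable_diff; apply: filterS (nbhs_disc z1) => w; exact: H.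
Qed.

Lemma eq_cderive phi psi z : rnorm z < 1 -> disc_holomorphic psi ->
  (forall w, rnorm w < 1 -> phi w = psi w) -> differentiable phi z /\ cderive phi z = cderive psi z.
Proof.
move=> z1 H E; have N : nbhs z (fun w => phi w = psi w).
  by apply: filterS (nbhs_disc z1) => w; exact: E.
have [d1 E1] := diff_local (H z z1) N; split; first exact: d1.
exact: (congr1 (fun G => G 1) E1).
Qed.

Lemma cderiveM phi psi z : differentiable phi z -> differentiable psi z ->
  differentiable (fun w => phi w * psi w) z /\
  cderive (fun w => phi w * psi w) z = cderive phi z * psi z + phi z * cderive psi z.
Proof.
move=> d1 d2; split; first exact: differentiableM.
have := diffM d1 d2 => /(congr1 (fun G => G 1)) E.
by apply: etrans E _; rewrite addrC [_ * psi z]mulrC.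
Qed.

Lemma cderiveD phi psi z : differentiable phi z -> differentiable psi z ->
  differentiable (fun w => phi w + psi w) z /\
  cderive (fun w => phi w + psi w) z = cderive phi z + cderive psi z.
Proof.
move=> d1 d2; split; first exact: differentiableD.
by have := diffD d1 d2 => /(congr1 (fun G => G 1)).
Qed.

Lemma cderive_cst (k : C) z : differentiable (fun=> k) z /\ cderive (fun=> k) z = 0.
Proof.
split; first exact: differentiable_cst.
by have := diff_cst k z => /(congr1 (fun G => G 1)).
Qed.

Lemma cderive_id z : differentiable (fun w => w) z /\ cderive (fun w => w) z = 1.
Proof.
have H := is_diff_id z; split; first exact: (ex_diff (is_diff_def := H)).
exact: (congr1 (fun G => G 1) (diff_val (is_diff_def := H))).
Qed.

Lemma cderive_sum (I : Type) (s : seq I) (F : I -> C -> C) z :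
  (forall i, differentiable (F i) z) ->
  differentiable (fun w => \sum_(i <- s) F i w) z /\
  cderive (fun w => \sum_(i <- s) F i w) z = \sum_(i <- s) cderive (F i) z.
Proof.
move=> H; elim: s => [|i s [d1 E1]].
  rewrite big_nil; have -> : (fun w => \sum_(i <- [::]) F i w) = fun=> 0.
    by apply/funext => w; rewrite big_nil.
  exact: cderive_cst.
rewrite big_cons -E1.
have -> : (fun w => \sum_(j <- i :: s) F j w) = fun w => F i w + \sum_(j <- s) F j w.
  by apply/funext => w; rewrite big_cons.
exact: cderiveD.
Qed.

Lemma differentiable_bigprod (I : Type) (s : seq I) (F : I -> C -> C) z :
  (forall i, differentiable (F i) z) -> differentiable (fun w => \prod_(i <- s) F i w) z.
Proof.
move=> H; elim: s => [|i s IH].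
  have -> : (fun w => \prod_(i <- [::]) F i w) = fun=> 1.
    by apply/funext => w; rewrite big_nil.
  exact: differentiable_cst.
have -> : (fun w => \prod_(j <- i :: s) F j w) = fun w => F i w * \prod_(j <- s) F j w.
  by apply/funext => w; rewrite big_cons.
exact: differentiableM.
Qed.

Lemma differentiable_det m (M : C -> 'M[C]_m) z :
  (forall i j, differentiable (fun w => M w i j) z) -> differentiable (fun w => \det (M w)) z.
Proof.
move=> H; rewrite /determinant.
apply: (cderive_sum _ _).1 => s; apply: differentiableM; first exact: differentiable_cst.
by apply: differentiable_bigprod.
Qed.

(** The cofactor formula writes the entries of the inverse as quotients of determinants. [invmx]
    follows it only on invertible matrices, so invertibility is required on a neighbourhood. *)
Lemma differentiable_invmx m (M : C -> 'M[C]_m) z i j :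
  (forall i j, differentiable (fun w => M w i j) z) ->
  (\forall w \near z, M w \in unitmx) ->
  differentiable (fun w => invmx (M w) i j) z.
Proof.
move=> H U.
pose G w := (\det (M w))^-1 * ((-1) ^+ (j + i) * \det (row' j (col' i (M w)))).
have Uz : M z \in unitmx by exact: nbhs_singleton U.
have dG : differentiable G z.
  apply: differentiableM.
    apply: differentiableV; first exact: differentiable_det.
    by rewrite -unitfE -unitmxE.
  apply: differentiableM; first exact: differentiable_cst.
  apply: differentiable_det => k l.
  rewrite (_ : (fun _ => _) = fun w => M w (lift j k) (lift i l)); first exact: H.
  by apply/funext => w; rewrite !mxE.
apply: (diff_local dG _).1; apply: filterS U => w Uw.
by rewrite /G /invmx Uw !mxE.
Qed.

Lemma cderive_quadratic (a b : C) z :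
  differentiable (fun w => a * w + b * (w * w)) z /\
  cderive (fun w => a * w + b * (w * w)) z = a + b * (z + z).
Proof.
have [di Ei] := cderive_id z; have [ds Es] := cderiveM di di.
have [da Ea] := cderive_cst a z; have [db Eb] := cderive_cst b z.
have [d1 E1] := cderiveM da di; have [d2 E2] := cderiveM db ds.
have [d3 E3] := cderiveD d1 d2; split; first exact: d3.
apply: (etrans E3); apply: congr2.
  apply: (etrans E1); apply: etrans (congr2 (fun p q : C => p * z + a * q) Ea Ei) _.
  by rewrite mul0r add0r mulr1.
apply: (etrans E2); apply: etrans (congr2 (fun p q : C => p * (z * z) + b * q) Eb Es) _.
apply: etrans (congr1 (fun p : C => 0 * (z * z) + b * (p * z + z * p)) Ei) _.
by rewrite mul0r add0r mulr1 mul1r.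
Qed.

(** Mean value inequality for [phi] minus its Taylor polynomial of degree 2: the derivative of this
    difference is [o(z)] because [cderive phi] is differentiable at 0. *)
Lemma cderive_taylor2 phi (e : R) : disc_holomorphic phi -> 0 < e ->
  exists2 d : R, 0 < d & forall z, rnorm z < d ->
    rnorm (phi z - phi 0 - cderive phi 0 * z - cderive (cderive phi) 0 / 2 * z ^+ 2) <= e * rnorm z ^+ 2.
Proof.
move=> H e0; set a := cderive phi 0; set c := cderive (cderive phi) 0.
have n0 : rnorm (0 : C) < 1 by rewrite rnorm0.
have [d d0 Hd] := diff_approx (disc_holomorphic_cderive H n0) e0.
exists (Num.min d 1) => [|z]; first by rewrite lt_min d0 ltr01.
rewrite lt_min => /andP[zd z1].
pose P w := a * w + c / 2 * (w * w).
have dP w : differentiable P w /\ cderive P w = a + c * w.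
  have [d1 E1] := cderive_quadratic a (c / 2) w; split; first exact: d1.
  by apply: etrans E1 _; congr (_ + _); field.
pose g w := -1 *: P w + phi w.
have gE w : g w = phi w - P w by rewrite /g scaleN1r addrC.
have -> : phi z - phi 0 - a * z - c / 2 * z ^+ 2 = g (0 + z) - g 0.
  have alg (p q u v x : C) : p - q - u * x - v * x ^+ 2 =
      (p - (u * x + v * (x * x))) - (q - (u * 0 + v * (0 * 0))) by ring.
  by rewrite (gE (0 + z)) (gE 0) add0r; exact: alg.
apply: mean_value_bound => t /andP[t0 t1]; rewrite add0r.
have ntz : rnorm (ofR t *: z) <= rnorm z.
  by rewrite rnormZ rnorm_ofR ger0_norm // ler_piMl ?rnorm_ge0.
have [dPw EPw] := dP (ofR t *: z).
have dphi := H _ (le_lt_trans ntz z1).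
have [dg Eg] := diff_lincomb (-1) dPw dphi; split; first exact: dg.
have -> : 'd g (ofR t *: z) z = (cderive phi (ofR t *: z) - a - c * (ofR t *: z)) * z.
  rewrite diffC_mul; congr (_ * _); apply: etrans (Eg 1) _.
  rewrite scaleN1r addrC.
  apply: etrans (congr1 (fun p : C => cderive phi (ofR t *: z) - p) EPw) _.
  by rewrite opprD addrA.
have := Hd _ (le_lt_trans ntz zd); rewrite add0r diffC_mul -/(cderive _ _) => h1.
rewrite rnormM expr2 mulrA ler_wpM2r ?rnorm_ge0 //; apply: le_trans h1 _.
by rewrite ler_wpM2l // ltW.
Qed.

(** As for the first derivative, the terms [phi 0 * z ^- 2] and [a * z ^- 1] split off from the
    quotient have mean 0. *)
Lemma cmean_second r phi : 0 < r -> r < 1 -> disc_holomorphic phi ->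
  cmean r (fun z => phi z * z ^- 2) = cderive (cderive phi) 0 / 2.
Proof.
move=> r0 r1 H; set a := cderive phi 0; set c := _ / 2.
pose q z := (phi z - phi 0 - a * z) * z ^- 2.
have dq z : 0 < rnorm z < 1 -> differentiable q z.
  move=> /andP[z0 z1]; apply: differentiableM.
    apply: differentiableB; last first.
      by apply: differentiableM; [exact: differentiable_cst|exact: (cderive_id z).1].
    by apply: differentiableB; [exact: H|exact: differentiable_cst].
  by apply: differentiable_exprV; rewrite -rnorm_gt0.
have lim : cmean r q = c.
  apply: (cmean_limit r0 r1 dq) => e e0.
  have [d d0 Hd] := cderive_taylor2 H e0; exists d => // z /andP[z0 /Hd h].
  have zn : z != 0 by rewrite -rnorm_gt0.
  have -> : q z - c = (phi z - phi 0 - a * z - c * z ^+ 2) * z ^- 2.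
    by rewrite /q [RHS]mulrBl mulfK // expf_neq0.
  by rewrite rnormM rnormV rnormX ler_pdivrMr // exprn_gt0.
have cexp n : circle_continuous r (fun z => z ^- n).
  apply: differentiable_circle => [|z zr]; first exact: ltW.
  by apply: differentiable_exprV; rewrite -rnorm_gt0 zr.
have cq : circle_continuous r q.
  by apply: differentiable_circle => [|z zr]; [exact: ltW|apply: dq; rewrite zr r0].
transitivity (cmean r (fun z => q z + (phi 0 * z ^- 2 + a * z ^- 1))).
  apply: eq_cmean => [|z zr]; first exact: ltW.
  have zn : z != 0 by rewrite -rnorm_gt0 zr.
  by rewrite /q; field.
have c2 := circle_continuousZ (k := phi 0) (cexp 2).
have c1 := circle_continuousZ (k := a) (cexp 1).
rewrite (cmeanD cq (circle_continuousD c2 c1)) (cmeanD c2 c1) lim.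
rewrite (cmeanZ _ (cexp 2)) (cmeanZ _ (cexp 1)).
by rewrite (@cmean_exprV _ _ 2 r0 isT) (@cmean_exprV _ _ 1 r0 isT) !mulr0 !addr0.
Qed.

(** * Caratheodory's inequality *)

Lemma rnorm_conjc z : rnorm (conjc z : C) = rnorm z.
Proof. by rewrite !rnorm_def; case: z => a b /=; rewrite sqrrN. Qed.

Lemma circle_continuous_conjc r phi : circle_continuous r phi ->
  circle_continuous r (fun z => conjc (phi z) : C).
Proof.
move=> H t; apply: (@continuous_comp _ _ _ (fun t => phi (polar r t)) (fun z : C => conjc z : C)).
  exact: H.
apply/continuous_rnorm => e e0; exists e => // h he.
have -> : conjc (phi (polar r t) + h) - conjc (phi (polar r t)) = conjc h :> C.
  by case: (phi _) h {he} => a b [u v] /=; apply: Cplx_eq => /=; ring.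
by rewrite rnorm_conjc.
Qed.

Lemma cmean_conjc r phi : circle_continuous r phi ->
  cmean r (fun z => conjc (phi z) : C) = conjc (cmean r phi).
Proof.
have E (x : R) (y : C) : conjc (ofR x * y) = ofR x * conjc y :> C.
  by case: y => a b; apply: Cplx_eq => /=; ring.
move=> H; rewrite /cmean E; congr (_ * _).
apply: Cplx_eq; rewrite /cint /=.
  by apply: eq_Rintegral => t _; case: (phi _).
rewrite -mulN1r -RintegralZl //; last exact: integrable_Im.
by apply: eq_Rintegral => t _; rewrite mulN1r; case: (phi _).
Qed.

Lemma cmean_weighted r phi psi (K : R) : 0 <= r -> 0 <= K -> circle_continuous r phi ->
  circle_continuous r psi ->
  (forall z, rnorm z = r -> rnorm (phi z) <= K * complex.Re (psi z)) ->
  rnorm (cmean r phi) <= K * complex.Re (cmean r psi).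
Proof.
move=> r0 K0 c1 c2 H; rewrite /cmean rnormM rnorm_ofR gtr0_norm ?invr_gt0 ?pi2_gt0 //.
rewrite Re_M /= mul0r subr0 mulrCA ler_wpM2l ?invr_ge0 ?(ltW (pi2_gt0 R)) //.
apply: le_trans (cint_norm _ _ c1) _; rewrite /cint /= -RintegralZl //; last exact: integrable_Re.
apply: le_Rintegral => //.
- exact: integrable_comp_continuous (@continuous_modulus R) c1.
- have c3 := circle_continuousZ (k := ofR K) c2.
  rewrite (_ : (fun _ => _) = fun t => complex.Re (ofR K * psi (polar r t))); first exact: integrable_Re.
  by apply/funext => t; rewrite Re_M /= mul0r subr0.
- by move=> t _; apply: H; rewrite rnorm_polar.
Qed.

Lemma Re_2M z : complex.Re (2 * z) = 2 * complex.Re z.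
Proof. by rewrite !mulr_natl !mulr2n Re_D. Qed.

(** On the circle [conj z = r^2 / z], so the mean of [conj(h) z^-m] is a multiple of the conjugate
    of the mean of [h z^m], which vanishes. Adding it, and subtracting [2 alpha z^-m], replaces [h]
    by the nonnegative real function [2 (Re h - alpha)], whose mean is [2 (1 - alpha)]. *)
Lemma caratheodory_mean h (alpha r : R) m : disc_holomorphic h -> h 0 = 1 ->
  (forall z, rnorm z < 1 -> alpha <= complex.Re (h z)) -> 0 < r -> r < 1 -> (0 < m)%N ->
  rnorm (cmean r (fun z => h z * z ^- m)) <= r ^- m * (2 * (1 - alpha)).
Proof.
move=> H h0 Re_h r0 r1 m0.
have r0' := ltW r0.
have zneq0 z : rnorm z = r -> z != 0 by move=> zr; rewrite -rnorm_gt0 zr.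
have ch : circle_continuous r h.
  by apply: (differentiable_circle r0') => z zr; apply: H; rewrite zr.
have cV : circle_continuous r (fun z => z ^- m).
  by apply: (differentiable_circle r0') => z zr; apply: differentiable_exprV; exact: zneq0.
have cX : circle_continuous r (fun z => z ^+ m).
  by apply: (differentiable_circle r0') => z zr; exact: differentiable_expr.
have chV := circle_continuousM ch cV; have chX := circle_continuousM ch cX.
have hX0 : cmean r (fun z => h z * z ^+ m) = 0.
  rewrite (cmean_center r0 r1); first by rewrite expr0n gtn_eqF // mulr0.
  by move=> z z1; apply: differentiableM; [exact: H|exact: differentiable_expr].
pose k : C := (ofR (r ^+ 2)) ^- m.
have conjE z : rnorm z = r -> conjc (h z) * z ^- m = k * conjc (h z * z ^+ m) :> C.
  move=> zr; have zz : z * conjc z = ofR (r ^+ 2).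
    rewrite -zr; case: (z) => a b; apply: Cplx_eq; rewrite /= ?rnorm_def /= ?sqr_sqrtr ?addr_ge0 ?sqr_ge0 //; ring.
  have z0 := zneq0 _ zr.
  have cz0 : conjc z != 0 :> C by rewrite -rnorm_gt0 rnorm_conjc zr.
  rewrite /k -zz rmorphM rmorphXn exprMn invfM.
  by rewrite [RHS]mulrCA; congr (_ * _); rewrite -mulrA mulVf ?mulr1 // expf_neq0.
have conj0 : cmean r (fun z => conjc (h z) * z ^- m : C) = 0.
  rewrite (eq_cmean r0' conjE) cmeanZ; last exact: circle_continuous_conjc.
  by rewrite cmean_conjc // hX0 conjc0 mulr0.
have cc := circle_continuousM (circle_continuous_conjc ch) cV.
have cA := circle_continuousZ (k := - ofR (2 * alpha)) cV.
have E : cmean r (fun z => h z * z ^- m) =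
  cmean r (fun z => h z * z ^- m + (conjc (h z) * z ^- m + - ofR (2 * alpha) * z ^- m)).
  rewrite (cmeanD chV (circle_continuousD cc cA)) (cmeanD cc cA) conj0 cmeanZ //.
  by rewrite cmean_exprV // mulr0 !addr0.
have cpsi : circle_continuous r (fun z => 2 * (h z - ofR alpha)).
  apply: circle_continuousZ; apply: circle_continuousD ch _.
  exact: circle_continuous_cst.
have dpsi z : rnorm z < 1 -> differentiable (fun z => 2 * (h z - ofR alpha)) z.
  move=> z1; apply: differentiableM; first exact: differentiable_cst.
  by apply: differentiableB; [exact: H|exact: differentiable_cst].
have -> : 2 * (1 - alpha) = complex.Re (cmean r (fun z => 2 * (h z - ofR alpha))).
  by rewrite (cmean_center r0 r1 dpsi) h0 Re_2M Re_D Re_N.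
rewrite E; apply: (cmean_weighted r0' _ (circle_continuousD chV (circle_continuousD cc cA)) cpsi).
  by rewrite invr_ge0 exprn_ge0.
move=> z zr.
have -> : h z * z ^- m + (conjc (h z) * z ^- m + - ofR (2 * alpha) * z ^- m) =
    ofR (2 * (complex.Re (h z) - alpha)) * z ^- m.
  rewrite -!mulrDl; congr (_ * _); case: (h z) => a b; apply: Cplx_eq => /=; ring.
rewrite rnormM rnorm_ofR rnormV rnormX zr mulrC.
rewrite ger0_norm; last by rewrite mulr_ge0 // subr_ge0 Re_h // zr.
by rewrite Re_2M Re_D Re_N.
Qed.

Lemma le_of_radius (c X : R) m : 0 <= c -> (m <= 2)%N ->
  (forall r : R, 0 < r -> r < 1 -> c <= r ^- m * X) -> c <= X.
Proof.
move=> c0 m2 H; apply/ler_addgt0Pr => e e0.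
(* Chosen so that [2 * c * t <= e], which suffices because [(1 - t)^2 >= 1 - 2 t]. *)
pose t := e / (2 * c + 2 * e + 1).
have D0 : 0 < 2 * c + 2 * e + 1 by lra.
have t0 : 0 < t by rewrite divr_gt0.
have t1 : t < 1 by rewrite ltr_pdivrMr // mul1r; lra.
have tc : 2 * c * t <= e.
  by rewrite /t mulrA ler_pdivrMr // mulrC ler_wpM2l ?(ltW e0) //; lra.
have r0 : 0 < 1 - t by lra.
have := H (1 - t) r0; have -> : 1 - t < 1 by lra.
move=> /(_ isT); rewrite ler_pdivlMl ?exprn_gt0 // => h.
have : (1 - t) ^+ 2 * c <= (1 - t) ^+ m * c.
  by rewrite ler_wpM2r // ler_wiXn2l //; lra.
have : 0 <= t ^+ 2 * c by rewrite mulr_ge0 // sqr_ge0.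
rewrite expr2; lra.
Qed.

Lemma caratheodory h (alpha : R) : disc_holomorphic h -> h 0 = 1 ->
  (forall z, rnorm z < 1 -> alpha <= complex.Re (h z)) ->
  rnorm (cderive h 0) <= 2 * (1 - alpha) /\
  rnorm (cderive (cderive h) 0 / 2) <= 2 * (1 - alpha).
Proof.
move=> H h0 Re_h; split.
  apply: (@le_of_radius _ _ 1) => [|//|r r0 r1]; first exact: rnorm_ge0.
  by rewrite /cderive -(cmean_derive r0 r1 H); exact: (@caratheodory_mean h alpha r 1).
apply: (@le_of_radius _ _ 2) => [|//|r r0 r1]; first exact: rnorm_ge0.
by rewrite -(cmean_second r0 r1 H); exact: (@caratheodory_mean h alpha r 2).
Qed.

(** * The maximum principle for polynomials *)

Lemma cmean_cauchy_kernel (w : C) : rnorm w < 1 -> cmean 1 (fun z => z / (z - w)) = 1.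
Proof.
move=> w1.
have dk (k : C) z : 1 <= rnorm z -> differentiable (fun z => k / (z - w)) z.
  move=> z1; have zw : z - w != 0.
    by rewrite subr_eq0; apply: contraTneq w1 => <-; rewrite -leNgt.
  apply: differentiableM; first exact: differentiable_cst.
  apply: differentiableV; last exact: zw.
  by apply: differentiableB; [exact: (cderive_id z).1|exact: differentiable_cst].
have ck s : 1 <= s -> circle_continuous s (fun z => w / (z - w)).
  by move=> s1; apply: differentiable_circle => [|z zs]; [lra|apply: dk; rewrite zs].
(* This mean does not depend on the radius, and it tends to 0 as the radius grows. *)
have E0 : cmean 1 (fun z => w / (z - w)) = 0.
  apply/eqP; rewrite -rnorm_eq0 eq_le rnorm_ge0 andbT; apply/ler_addgt0Pr => e e0; rewrite add0r.
  pose s := 2 + e^-1.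
  have ei : 0 < e^-1 by rewrite invr_gt0.
  have s1 : 1 <= s by rewrite /s; lra.
  rewrite (cmean_const ltr01 s1); last by move=> z /andP[z1 _]; exact: dk.
  apply: cmean_bound; [lra|exact: ck|move=> z zs].
  have Nzw : e^-1 <= rnorm (z - w).
    have := rnormD (z - w) w; rewrite subrK zs /s; lra.
  rewrite rnormM rnormV; apply: le_trans (_ : 1 * e <= _); last by rewrite mul1r.
  apply: ler_pM; rewrite ?rnorm_ge0 ?invr_ge0 ?rnorm_ge0 ?(ltW w1) //.
  by rewrite -[leRHS]invrK lef_pV2 ?posrE // (lt_le_trans ei).
transitivity (cmean 1 (fun z => 1 + w / (z - w))).
  apply: eq_cmean => // z z1; have zw : z - w != 0.
    by rewrite subr_eq0; apply: contraTneq w1 => <-; rewrite z1 ltxx.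
  by rewrite -[1](divff zw) -mulrDl subrK.
rewrite cmeanD ?cmean_cst ?E0 ?addr0 //; [exact: circle_continuous_cst|exact: ck].
Qed.

Lemma differentiable_horner (p : {poly C}) z : differentiable (fun w => p.[w]) z.
Proof.
elim/poly_ind: p => [|p c IH].
  rewrite (_ : (fun _ => _) = fun=> 0); first exact: differentiable_cst.
  by apply/funext => w; rewrite horner0.
rewrite (_ : (fun _ => _) = fun w => p.[w] * w + c).
  apply: differentiableD; last exact: differentiable_cst.
  by apply: differentiableM; [exact: IH|exact: (cderive_id z).1].
by apply/funext => w; rewrite hornerMXaddC.
Qed.

(** Cauchy's formula for [p]: division by [z - w] gives [p.[z] = q.[z] * (z - w) + p.[w]], and
    [q.[z] * z] has mean 0 on the circle. *)
Lemma poly_circle_bound (p : {poly C}) (K : R) (w : C) : rnorm w < 1 ->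
  (forall z, rnorm z = 1 -> rnorm p.[z] <= K) -> rnorm p.[w] <= K / (1 - rnorm w).
Proof.
move=> w1 H.
have d0 : 0 < 1 - rnorm w by rewrite subr_gt0.
have /factor_theorem[q pq] : root (p - p.[w]%:P) w by rewrite /root hornerD hornerN hornerC subrr.
have pE z : p.[z] = q.[z] * (z - w) + p.[w].
  by have := congr1 (horner^~ z) pq; rewrite !hornerE => <-; rewrite subrK.
have zw z : rnorm z = 1 -> z - w != 0.
  by move=> z1; rewrite subr_eq0; apply: contraTneq w1 => <-; rewrite z1 ltxx.
have ck : circle_continuous 1 (fun z => z / (z - w)).
  apply: (differentiable_circle ler01) => z z1; apply: differentiableM; first exact: (cderive_id z).1.
  apply: differentiableV; last exact: zw.
  by apply: differentiableB; [exact: (cderive_id z).1|exact: differentiable_cst].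
have cp (q' : {poly C}) : circle_continuous 1 (fun z => q'.[z]).
  by apply: (differentiable_circle ler01) => z _; exact: differentiable_horner.
have cq : circle_continuous 1 (fun z => q.[z] * z).
  apply: circle_continuousM; first exact: cp.
  by apply: (differentiable_circle ler01) => z _; exact: (cderive_id z).1.
have -> : p.[w] = cmean 1 (fun z => p.[z] * (z / (z - w))).
  transitivity (cmean 1 (fun z => q.[z] * z + p.[w] * (z / (z - w)))); last first.
    apply: eq_cmean => // z /zw zw0; by rewrite (pE z); field.
  rewrite (cmeanD cq (circle_continuousZ (k := p.[w]) ck)) (cmeanZ _ ck) (cmean_cauchy_kernel w1).
  have l12 : 1 < 2 :> R by rewrite ltr1n.
  rewrite (cmean_center ltr01 l12); first by rewrite mulr0 add0r mulr1.
  by move=> z _; apply: differentiableM; [exact: differentiable_horner|exact: (cderive_id z).1].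
apply: (cmean_bound ler01 (circle_continuousM (cp p) ck)) => z z1; rewrite rnormM; apply: ler_pM; rewrite ?rnorm_ge0 ?H //.
rewrite rnormM rnormV z1 mul1r lef_pV2 ?posrE // ?rnorm_gt0 ?zw //.
have := rnormD (z - w) w; rewrite subrK z1; lra.
Qed.

Lemma bernoulli (t : R) m : 0 <= t -> 1 + m%:R * t <= (1 + t) ^+ m.
Proof.
move=> t0; elim: m => [|m IH]; first by rewrite mul0r addr0 expr0.
have mt : 0 <= m%:R * t :> R by rewrite mulr_ge0.
rewrite exprS -natr1 mulrDl mul1r.
have : (1 + t) * (1 + m%:R * t) <= (1 + t) * (1 + t) ^+ m by rewrite ler_wpM2l //; lra.
have : 0 <= t * (m%:R * t) by rewrite mulr_ge0.
lra.
Qed.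

(* Applying the Cauchy bound to all powers of p removes the factor 1 / (1 - |w|). *)
Lemma poly_max_modulus (p : {poly C}) (K : R) (w : C) :
  (forall z, rnorm z = 1 -> rnorm p.[z] <= K) -> rnorm w <= 1 -> rnorm p.[w] <= K.
Proof.
move=> H; rewrite le_eqVlt => /predU1P[/H //|w1].
have K0 : 0 <= K by apply: le_trans (H 1 (rnorm1 R)); exact: rnorm_ge0.
have d0 : 0 < 1 - rnorm w by rewrite subr_gt0.
have Hm m : rnorm p.[w] ^+ m <= K ^+ m / (1 - rnorm w).
  rewrite -rnormX -horner_exp; apply: poly_circle_bound => // z z1.
  rewrite horner_exp rnormX; apply: lerXn2r; rewrite ?nnegrE ?rnorm_ge0 //; exact: H.
rewrite leNgt; apply/negP => Kp.
have [K0'|Kn] := eqVneq K 0.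
  by have := Hm 1%N; rewrite K0' !expr1 mul0r => h; have := lt_le_trans Kp h; rewrite K0' ltxx.
have Kp0 : 0 < K by rewrite lt_neqAle eq_sym Kn.
(* If [rnorm p.[w]] exceeded [K], the powers of the ratio [1 + t] would be unbounded by Bernoulli's
   inequality. *)
pose t := rnorm p.[w] / K - 1.
have t0 : 0 < t by rewrite subr_gt0 ltr_pdivlMr // mul1r.
have B m : 1 + m%:R * t <= (1 - rnorm w)^-1.
  apply: le_trans (bernoulli m (ltW t0)) _.
  rewrite /t subrKC expr_div_n ler_pdivrMr ?exprn_gt0 // mulrC; exact: Hm.
pose m := Num.bound ((1 - rnorm w)^-1 / t).
have m_big : (1 - rnorm w)^-1 / t < m%:R by apply: archi_boundP; rewrite divr_ge0 // ?invr_ge0 // ltW.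
rewrite ltr_pdivrMr // in m_big.
have := B m; lra.
Qed.
End DiscFunctions.

(* Otherwise unification of two differentials unfolds their definition by choice. *)
Opaque diff cderive cmean.

(** * The third-order bound *)

Section SupportFunctional.
Variable R : realType.
Local Notation C := (Cplx R).

Lemma mulc_conjc (w : C) : w * conjc w = ofR (rnorm w ^+ 2).
Proof.
case: w => a b; apply: Cplx_eq; rewrite /= ?rnorm_def /= ?sqr_sqrtr ?addr_ge0 ?sqr_ge0 //; ring.
Qed.

Lemma support_functional_coord n (x : 'rV[C]_n) k : x != 0 -> rnorm (x ord0 k) = rnorm x ->
  exists T : {scalar 'rV[C]_n}, support_functional x T /\
    forall y, T y = conjc (x ord0 k) / ofR (rnorm x) * y ord0 k.
Proof.
move=> x0 xk; have xp : 0 < rnorm x by rewrite rnorm_gt0.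
pose c : C := conjc (x ord0 k) / ofR (rnorm x).
have c1 : rnorm c = 1.
  by rewrite /c rnormM rnormV rnorm_conjc xk rnorm_ofR gtr0_norm // divff // gt_eqF.
pose T0 (y : 'rV[C]_n) : C := c * y ord0 k.
have lin : scalar T0 by move=> a u v; rewrite /T0 !mxE mulrDr mulrCA.
pose T : {scalar 'rV[C]_n} := HB.pack T0 (GRing.isLinear.Build _ _ _ _ T0 lin).
exists T; split=> //; split; last first.
  rewrite -[T x]/(c * x ord0 k) /c normE mulrAC [_ * x _ _]mulrC mulc_conjc xk.
  rewrite expr2 /ofR rmorphM /= mulfK // -[_ == 0]/(ofR _ == 0).
  by rewrite -rnorm_eq0 rnorm_ofR normr_eq0 gt_eqF.
have TE y : rnorm (T y) = rnorm (y ord0 k) by rewrite -[T y]/(c * _) rnormM c1 mul1r.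
have ub : ubound [set rnorm (T y) | y in [set y : 'rV[C]_n | rnorm y <= 1]] 1.
  by move=> _ [y /= y1 <-]; rewrite TE (le_trans (rnorm_entry _ _)).
have mem : [set rnorm (T y) | y in [set y : 'rV[C]_n | rnorm y <= 1]] 1.
  exists ((ofR (rnorm x))^-1 *: x).
    by rewrite /= rnormZ rnormV rnorm_ofR gtr0_norm // mulVf // gt_eqF.
  by rewrite TE mxE rnormM rnormV rnorm_ofR gtr0_norm // xk mulVf // gt_eqF.
apply/eqP; rewrite eq_le; apply/andP; split; first by apply: ge_sup => //; exists 1.
by apply: ub_le_sup => //; exists 1.
Qed.

End SupportFunctional.

Section ProductDerivatives.
Variable R : realType.
Local Notation C := (Cplx R).

Lemma cderive_sum_mul (I : Type) (s : seq I) (phi psi : I -> C -> C) (z : C) : rnorm z < 1 ->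
  (forall i, disc_holomorphic (phi i)) -> (forall i, disc_holomorphic (psi i)) ->
  differentiable (fun w => \sum_(i <- s) phi i w * psi i w) z /\
  cderive (fun w => \sum_(i <- s) phi i w * psi i w) z =
  \sum_(i <- s) (cderive (phi i) z * psi i z + phi i z * cderive (psi i) z).
Proof.
move=> z1 H1 H2; have d i := cderiveM (H1 i z z1) (H2 i z z1).
have [d1 E1] := cderive_sum s (fun i => (d i).1); split; first exact: d1.
by apply: (etrans E1); apply: eq_bigr => i _; exact: (d i).2.
Qed.

Lemma cderive2_sum_mul (I : Type) (s : seq I) (phi psi : I -> C -> C) :
  (forall i, disc_holomorphic (phi i)) -> (forall i, disc_holomorphic (psi i)) ->
  cderive (cderive (fun w => \sum_(i <- s) phi i w * psi i w)) 0 =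
  \sum_(i <- s) (cderive (cderive (phi i)) 0 * psi i 0 + 2 * (cderive (phi i) 0 * cderive (psi i) 0)
     + phi i 0 * cderive (cderive (psi i)) 0).
Proof.
move=> H1 H2; have n0 : rnorm (0 : C) < 1 by rewrite rnorm0.
pose G w := \sum_(i <- s) cderive (phi i) w * psi i w + \sum_(i <- s) phi i w * cderive (psi i) w.
have H1' i := disc_holomorphic_cderive (H1 i).
have H2' i := disc_holomorphic_cderive (H2 i).
have dG z : rnorm z < 1 -> differentiable G z /\ cderive G z =
   \sum_(i <- s) (cderive (cderive (phi i)) z * psi i z + cderive (phi i) z * cderive (psi i) z) +
   \sum_(i <- s) (cderive (phi i) z * cderive (psi i) z + phi i z * cderive (cderive (psi i)) z).
  move=> z1; have [d1 E1] := cderive_sum_mul s z1 H1' H2.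
  have [d2 E2] := cderive_sum_mul s z1 H1 H2'.
  have [d3 E3] := cderiveD d1 d2; split; first exact: d3.
  by apply: (etrans E3); exact: (congr2 +%R E1 E2).
have EG w : rnorm w < 1 -> cderive (fun w => \sum_(i <- s) phi i w * psi i w) w = G w.
  by move=> w1; apply: etrans (cderive_sum_mul s w1 H1 H2).2 _; rewrite big_split.
have [_ E] := eq_cderive n0 (fun z z1 => (dG z z1).1) EG.
apply: (etrans E); apply: etrans (dG 0 n0).2 _; rewrite -big_split; apply: eq_bigr => i _.
have alg (p q r : C) : p + q + (q + r) = p + 2 * q + r by ring.
exact: alg.
Qed.

(** Leibniz's rule of orders 0, 1 and 2, to be applied to [numer k], a sum of products of [quot l]
    with entries of the Jacobian matrix. *)
Lemma sum_mul_relations (n : nat) (E : C -> C) (H G : 'I_n -> C -> C) :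
  (forall l, disc_holomorphic (H l)) -> (forall l, disc_holomorphic (G l)) ->
  (forall w, rnorm w < 1 -> E w = \sum_(l < n) H l w * G l w) ->
  [/\ E 0 = \sum_(l < n) H l 0 * G l 0,
    cderive E 0 = \sum_(l < n) cderive (H l) 0 * G l 0 + \sum_(l < n) H l 0 * cderive (G l) 0 &
    cderive (cderive E) 0 = \sum_(l < n) cderive (cderive (H l)) 0 * G l 0 +
      2 * \sum_(l < n) cderive (H l) 0 * cderive (G l) 0 +
      \sum_(l < n) H l 0 * cderive (cderive (G l)) 0].
Proof.
move=> hH hG EE; have n0 : rnorm (0 : C) < 1 by rewrite rnorm0.
pose S w := \sum_(l < n) H l w * G l w.
have hS : disc_holomorphic S by move=> w w1; have [] := cderive_sum_mul (index_enum 'I_n) w1 hH hG.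
have E1 w : rnorm w < 1 -> cderive E w = cderive S w by move=> w1; have [] := eq_cderive w1 hS EE.
split; first exact: EE.
  by rewrite (E1 0 n0) /S (cderive_sum_mul _ n0 hH hG).2 big_split.
have [_ E2] := @eq_cderive _ (cderive E) (cderive S) 0 n0 (disc_holomorphic_cderive hS) E1.
apply: (etrans E2); apply: (etrans (cderive2_sum_mul (index_enum 'I_n) hH hG)).
rewrite big_split; congr (_ + _); rewrite big_split; congr (_ + _).
by rewrite mulr_sumr.
Qed.
End ProductDerivatives.

(** * Taylor coefficients along a direction *)

Section ThirdCoefficient.
Variable R : realType.
Local Notation C := (Cplx R).
Variables (n : nat) (f : 'rV[C]_n -> 'rV[C]_n) (alpha : R).
Hypothesis qc : quasi_convex_B alpha f.

Let hf : holomorphic_on_polydisk f. Proof. by case: qc. Qed.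
Let D0 := polydisk0 R n.

Lemma frechetD_slot vs1 vs2 x : polydisk x -> exists L : {linear 'rV[C]_n -> 'rV[C]_n},
  forall u, frechetD f (vs1 ++ u :: vs2) x = L u.
Proof.
move=> Dx; pose L0 u := frechetD f (vs1 ++ u :: vs2) x.
have lin : linear L0 by move=> a u v; exact: frechetD_linear.
pose L : {linear 'rV[C]_n -> 'rV[C]_n} := HB.pack L0 (GRing.isLinear.Build _ _ _ _ L0 lin).
by exists L.
Qed.

Lemma frechetD_scale vs1 vs2 (a : C) u x : polydisk x ->
  frechetD f (vs1 ++ (a *: u) :: vs2) x = a *: frechetD f (vs1 ++ u :: vs2) x.
Proof. by move=> Dx; have [L EL] := frechetD_slot vs1 vs2 Dx; rewrite !EL linearZ. Qed.

Section Direction.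
Variable z : 'rV[C]_n.
Hypothesis z1 : rnorm z = 1.

Definition slice vs k (w : C) : C := frechetD f vs (w *: z) ord0 k.

Lemma slice_polydisk (w : C) : rnorm w < 1 -> polydisk (w *: z).
Proof. by move=> w1; rewrite /polydisk /= rnormZ z1 mulr1. Qed.

Lemma slice0 vs k : slice vs k 0 = frechetD f vs 0 ord0 k.
Proof. by rewrite /slice scale0r. Qed.

Lemma cderive_slice vs k w : rnorm w < 1 ->
  differentiable (slice vs k) w /\ cderive (slice vs k) w = slice (z :: vs) k w.
Proof.
move=> w1; have [d1 E1] := diff_entry k (differentiable_frechetD hf vs (slice_polydisk w1)).
have d1' : differentiable (fun y => frechetD f vs y ord0 k) (0 + w *: z) by rewrite add0r.
have [d2 E2] := slice_diff d1'.
have EF : slice vs k = fun s : C => frechetD f vs (0 + s *: z) ord0 k.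
  by apply/funext => s; rewrite add0r.
rewrite EF; split; first exact: d2.
by apply: (etrans E2); rewrite add0r; exact: E1.
Qed.

Let n0 : rnorm (0 : C) < 1. Proof. by rewrite rnorm0. Qed.

Lemma holomorphic_slice vs k : disc_holomorphic (slice vs k).
Proof. by move=> w w1; have [] := cderive_slice vs k w1. Qed.

Lemma cderive_slice0 vs k : cderive (slice vs k) 0 = frechetD f (z :: vs) 0 ord0 k.
Proof. by have [_ ->] := cderive_slice vs k n0; rewrite slice0. Qed.

Lemma cderive2_slice0 vs k :
  cderive (cderive (slice vs k)) 0 = frechetD f [:: z, z & vs] 0 ord0 k.
Proof.
have E w : rnorm w < 1 -> cderive (slice vs k) w = slice (z :: vs) k w.
  by move=> w1; have [] := cderive_slice vs k w1.
have [_ E'] := eq_cderive n0 (@holomorphic_slice (z :: vs) k) E.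
exact: etrans E' (cderive_slice0 _ _).
Qed.

(* The components of D^2 f(x)(x, z) + D f(x) z and of its image under D f(x)^-1, at x = w z. *)
Definition numer k w := slice [:: z] k w + w * slice [:: z; z] k w.
Definition quot k w : C := ((\row_l numer l w) *m invmx ('J f (w *: z))) ord0 k.

Lemma cderive_numer k w : rnorm w < 1 -> differentiable (numer k) w /\
  cderive (numer k) w = 2 * slice [:: z; z] k w + w * slice [:: z; z; z] k w.
Proof.
move=> w1; have [d1 E1] := cderive_slice [:: z] k w1; have [d2 E2] := cderive_slice [:: z; z] k w1.
have [di Ei] := cderive_id w; have [d3 E3] := cderiveM di d2.
have [d4 E4] := cderiveD d1 d3; split; first exact: d4.
apply: (etrans E4); apply: etrans (congr2 +%R E1 E3) _.
apply: etrans (congr2 (fun p q : C => slice [:: z; z] k w + (p * slice [:: z; z] k w + w * q)) Ei E2) _.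
by rewrite mul1r mulr_natl mulr2n addrA.
Qed.

Lemma cderive_numer0 k : cderive (numer k) 0 = 2 * frechetD f [:: z; z] 0 ord0 k.
Proof. by have [_ ->] := cderive_numer k n0; rewrite mul0r addr0 slice0. Qed.

Lemma cderive2_numer0 k : cderive (cderive (numer k)) 0 = 3 * frechetD f [:: z; z; z] 0 ord0 k.
Proof.
pose G w := 2 * slice [:: z; z] k w + w * slice [:: z; z; z] k w.
have dG w : rnorm w < 1 -> differentiable G w /\ cderive G w =
  (0 * slice [:: z; z] k w + 2 * slice [:: z; z; z] k w) +
  (1 * slice [:: z; z; z] k w + w * slice [:: z; z; z; z] k w).
  move=> w1; have [d1 E1] := cderive_slice [:: z; z] k w1.
  have [d2 E2] := cderive_slice [:: z; z; z] k w1.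
  have [di Ei] := cderive_id w; have [dc Ec] := cderive_cst (2 : C) w.
  have [d3 E3] := cderiveM dc d1; have [d4 E4] := cderiveM di d2.
  have [d5 E5] := cderiveD d3 d4; split; first exact: d5.
  apply: (etrans E5); apply: congr2.
    apply: (etrans E3).
    exact: (congr2 (fun p q : C => p * slice [:: z; z] k w + 2 * q) Ec E1).
  apply: (etrans E4).
  exact: (congr2 (fun p q : C => p * slice [:: z; z; z] k w + w * q) Ei E2).
have EG w : rnorm w < 1 -> cderive (numer k) w = G w by move=> w1; have [] := cderive_numer k w1.
have hG : disc_holomorphic G by move=> w w1; have [] := dG w w1.
have [_ E'] := eq_cderive n0 hG EG.
apply: (etrans E'); apply: etrans (dG 0 n0).2 _.
have alg (p q r : C) : 0 * p + 2 * q + (1 * q + 0 * r) = 3 * q by ring.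
by rewrite !slice0; exact: alg.
Qed.

Let jacobian_entry w i j : ('J f (w *: z)) i j = slice [:: delta_mx 0 i] j w.
Proof. by rewrite /jacobian /lin1_mx mxE. Qed.

Let jacobian_unit (w : C) : rnorm w < 1 -> 'J f (w *: z) \in unitmx.
Proof. by case: qc => _ _ H _ w1; apply: H; exact: slice_polydisk. Qed.

Lemma holomorphic_quot k : disc_holomorphic (quot k).
Proof.
move=> w w1.
have -> : quot k = fun w => \sum_(l < n) numer l w * invmx ('J f (w *: z)) l k.
  by apply/funext => s; rewrite /quot mxE; apply: eq_bigr => l _; rewrite mxE.
have dt l : differentiable (fun w => numer l w * invmx ('J f (w *: z)) l k) w.
  apply: differentiableM; first by have [] := cderive_numer l w1.
  apply: differentiable_invmx => [i j|].
    have -> : (fun w => ('J f (w *: z)) i j) = slice [:: delta_mx 0 i] j.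
      by apply/funext => s; rewrite jacobian_entry.
    exact: holomorphic_slice.
  by apply: filterS (nbhs_disc w1) => s; exact: jacobian_unit.
exact: (cderive_sum (index_enum 'I_n) dt).1.
Qed.

(** Multiplied back by the Jacobian matrix, the definition of [quot] becomes a relation between
    products; differentiating it avoids the derivatives of the inverse matrix. *)
Lemma numer_quot k w : rnorm w < 1 ->
  numer k w = \sum_(l < n) quot l w * slice [:: delta_mx 0 l] k w.
Proof.
move=> /jacobian_unit Ju.
transitivity (((\row_l numer l w) *m invmx ('J f (w *: z)) *m 'J f (w *: z)) ord0 k).
  by rewrite mulmxKV // mxE.
by rewrite mxE; apply: eq_bigr => l _; rewrite jacobian_entry.
Qed.

Let frechetD1 v : frechetD f [:: v] 0 = v.
Proof. by case: qc => _ [_ Hd] _ _; exact: Hd. Qed.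

Let sum_id (c : 'I_n -> C) k : \sum_(l < n) c l * slice [:: delta_mx 0 l] k 0 = c k.
Proof.
rewrite (bigD1 k) // slice0 frechetD1 mxE !eqxx mulr1 big1 => [|l lk]; first exact: addr0.
by rewrite slice0 frechetD1 mxE eqxx eq_sym (negbTE lk) mulr0.
Qed.

Let sum_last vs (u : 'rV[C]_n) k :
  \sum_(l < n) u ord0 l * frechetD f (vs ++ [:: delta_mx 0 l]) 0 ord0 k = frechetD f (vs ++ [:: u]) 0 ord0 k.
Proof.
have [L EL] := frechetD_slot vs [::] D0.
rewrite EL {2}(row_sum_delta u) linear_sum summxE; apply: eq_bigr => l _.
by rewrite EL linearZ mxE.
Qed.

Let relations k := sum_mul_relations holomorphic_quot
  (fun l => @holomorphic_slice [:: delta_mx 0 l] k) (@numer_quot k).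

Lemma quot0 k : quot k 0 = z ord0 k.
Proof.
have [E0 _ _] := relations k; rewrite (sum_id (fun l => quot l 0)) in E0.
by rewrite -E0 /numer mul0r addr0 slice0 frechetD1.
Qed.

(** Order one of the product relation reads [2 D^2f_k(0)(z^2) = q_k'(0) + D^2f_k(0)(z^2)]. *)
Lemma cderive_quot0 k : cderive (quot k) 0 = frechetD f [:: z; z] 0 ord0 k.
Proof.
have [_ E1 _] := relations k.
rewrite (sum_id (fun l => cderive (quot l) 0)) cderive_numer0 in E1.
have S2 : \sum_(l < n) quot l 0 * cderive (slice [:: delta_mx 0 l] k) 0 = frechetD f [:: z; z] 0 ord0 k.
  by rewrite -[RHS](sum_last [:: z] z k); apply: eq_bigr => l _; rewrite quot0 cderive_slice0.
by rewrite S2 mulr_natl mulr2n in E1; move/addIr: E1 => ->.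
Qed.

(** Order two reads [3 D^3f_k(0)(z^3) = q_k''(0) + 2 D^2f_k(0)(z, q'(0)) + D^3f_k(0)(z^3)], with
    [q'(0) = D^2f(0)(z^2)]. *)
Lemma cderive2_quot0 k : frechetD f [:: z; z; z] 0 ord0 k =
  cderive (cderive (quot k)) 0 / 2 + frechetD f [:: z; frechetD f [:: z; z] 0] 0 ord0 k.
Proof.
have [_ _ E2] := relations k.
have S1 := sum_id (fun l => cderive (cderive (quot l)) 0) k.
have S2 : \sum_(l < n) cderive (quot l) 0 * cderive (slice [:: delta_mx 0 l] k) 0 =
    frechetD f [:: z; frechetD f [:: z; z] 0] 0 ord0 k.
  rewrite -[RHS](sum_last [:: z] _ k).
  by apply: eq_bigr => l _; rewrite cderive_quot0 cderive_slice0.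
have S3 : \sum_(l < n) quot l 0 * cderive (cderive (slice [:: delta_mx 0 l] k)) 0 =
    frechetD f [:: z; z; z] 0 ord0 k.
  by rewrite -[RHS](sum_last [:: z; z] z k); apply: eq_bigr => l _; rewrite quot0 cderive2_slice0.
have alg (t h'' u : C) : 3 * t = h'' + 2 * u + t -> t = h'' / 2 + u.
  move=> T; have -> : h'' = 3 * t - t - 2 * u by rewrite T; ring.
  by field.
apply: alg; apply: (etrans (esym (cderive2_numer0 k))); apply: (etrans E2).
exact: (congr2 +%R (congr2 +%R S1 (congr1 ( *%R 2) S2)) S3).
Qed.

Lemma Re_quot k w : alpha <= 1 -> rnorm (z ord0 k) = 1 -> rnorm w < 1 ->
  alpha <= complex.Re ((z ord0 k)^-1 * quot k w).
Proof.
move=> a1 zk w1; have zk0 : z ord0 k != 0 by rewrite -rnorm_gt0 zk.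
(* At [x = 0] the hypothesis is silent; there the value is 1. *)
have [->|w0] := eqVneq w 0; first by rewrite quot0 mulVf.
have nx : rnorm (w *: z) = rnorm w by rewrite rnormZ z1 mulr1.
have x0 : w *: z != 0 by rewrite -rnorm_gt0 nx rnorm_gt0.
have xk : rnorm ((w *: z) ord0 k) = rnorm (w *: z) by rewrite mxE rnormM zk nx mulr1.
have [T [sT ET]] := support_functional_coord x0 xk.
have [_ _ _ qcT] := qc.
have := qcT _ (slice_polydisk w1) x0 _ sT; rewrite ET.
have -> : Dpow 2 f (w *: z) (w *: z) + 'd f (w *: z) (w *: z) = w *: \row_l numer l w.
  have Dx := slice_polydisk w1.
  have E1 : frechetD f [:: w *: z; w *: z] (w *: z) = w *: frechetD f [:: z; w *: z] (w *: z).
    exact: (frechetD_scale [::] [:: w *: z] w z Dx).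
  have E2 : frechetD f [:: z; w *: z] (w *: z) = w *: frechetD f [:: z; z] (w *: z).
    exact: (frechetD_scale [:: z] [::] w z Dx).
  have E3 : 'd f (w *: z) (w *: z) = w *: frechetD f [:: z] (w *: z).
    exact: (frechetD_scale [::] [::] w z Dx).
  rewrite (E1 : Dpow 2 f (w *: z) (w *: z) = _) E2 E3 -scalerDr; congr (w *: _).
  by apply/rowP => l; rewrite [RHS]mxE /numer /slice [LHS]mxE [X in X + _]mxE addrC.
rewrite /invD -scalemxAl mxE -/(quot k w) nx mxE.
have wp : 0 < rnorm w by rewrite rnorm_gt0.
have wn : ofR (rnorm w) != 0 :> C by rewrite -rnorm_eq0 rnorm_ofR normr_eq0 gt_eqF.
(* Since [z ord0 k] is unimodular and [conjc w * w = rnorm w ^+ 2], the functional leaves a factor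
   [rnorm w], which also multiplies [alpha] in the hypothesis. *)
have -> : conjc (w * z ord0 k) / ofR (rnorm w) * (w * quot k w) =
    ofR (rnorm w) * ((z ord0 k)^-1 * quot k w).
  have cz : conjc (z ord0 k) = (z ord0 k)^-1 :> C.
    by apply: (mulfI zk0); rewrite mulc_conjc zk expr1n divff.
  have cw : conjc w = ofR (rnorm w) * ofR (rnorm w) / w :> C.
    by apply: (mulfI w0); rewrite mulc_conjc [RHS]mulrC divfK // /ofR expr2 rmorphM.
  have -> : conjc (w * z ord0 k) = conjc w * conjc (z ord0 k) :> C by exact: rmorphM.
  rewrite cz cw; move: (ofR (rnorm w)) (quot k w) wn => r q rn; field.
  by rewrite w0 zk0 rn.
by rewrite /ReC Re_M /= mul0r subr0 mulrC ler_pM2l.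
Qed.

Lemma quot_bounds k : alpha <= 1 -> rnorm (z ord0 k) = 1 ->
  rnorm (frechetD f [:: z; z] 0 ord0 k) <= 2 * (1 - alpha) /\
  rnorm (cderive (cderive (quot k)) 0 / 2) <= 2 * (1 - alpha).
Proof.
move=> a1 zk; have zk0 : z ord0 k != 0 by rewrite -rnorm_gt0 zk.
pose c := (z ord0 k)^-1.
have dh q w : differentiable q w -> differentiable (fun w => c * q w) w /\
    cderive (fun w => c * q w) w = c * cderive q w.
  move=> dq; have [dc Ec] := cderive_cst c w.
  have [d1 E1] := cderiveM dc dq; split; first exact: d1.
  apply: (etrans E1); apply: etrans (congr1 (fun p : C => p * q w + c * cderive q w) Ec) _.
  by rewrite mul0r add0r.
have hq := @holomorphic_quot k; have hq' := disc_holomorphic_cderive hq.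
have hh : disc_holomorphic (fun w => c * quot k w) by move=> w w1; have [] := dh _ w (hq w w1).
have h0 : c * quot k 0 = 1 by rewrite quot0 mulVf.
have hG : disc_holomorphic (fun w => c * cderive (quot k) w).
  by move=> w w1; have [] := dh _ w (hq' w w1).
have E1 w : rnorm w < 1 -> cderive (fun w => c * quot k w) w = c * cderive (quot k) w.
  by move=> w1; have [] := dh _ w (hq w w1).
have E2 : cderive (cderive (fun w => c * quot k w)) 0 = c * cderive (cderive (quot k)) 0.
  have [_ E] := eq_cderive n0 hG E1; apply: (etrans E).
  by have [] := dh _ 0 (hq' 0 n0).
have c1 : rnorm c = 1 by rewrite /c rnormV zk invr1.
have [b1 b2] := caratheodory hh h0 (fun w w1 => Re_quot a1 zk w1).
rewrite (E1 0 n0) rnormM c1 mul1r cderive_quot0 in b1.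
by rewrite E2 -mulrA rnormM c1 mul1r in b2.
Qed.
End Direction.
End ThirdCoefficient.

(** * Coefficient estimates *)

Section UpperBound.
Variable R : realType.
Local Notation C := (Cplx R).
Variables (n : nat) (f : 'rV[C]_n -> 'rV[C]_n) (alpha : R) (a : 'M[C]_n).
Hypotheses (qc : quasi_convex_B alpha f) (sof : second_order_form f a) (a1 : alpha <= 1).

Let hf : holomorphic_on_polydisk f. Proof. by case: qc. Qed.
Let D0 := polydisk0 R n.
Let lin_form k (z : 'rV[C]_n) : C := \sum_(l < n) a k l * z ord0 l.

Lemma frechetD_add vs1 vs2 u v : frechetD f (vs1 ++ (u + v) :: vs2) 0 =
  frechetD f (vs1 ++ u :: vs2) 0 + frechetD f (vs1 ++ v :: vs2) 0.
Proof. by have [L EL] := frechetD_slot qc vs1 vs2 D0; rewrite !EL linearD. Qed.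

Lemma second_coefficient z k : frechetD f [:: z; z] 0 ord0 k = 2 * (z ord0 k * lin_form k z).
Proof.
have := sof z k; rewrite /Dpow -[nseq 2 z]/[:: z; z] (component_frechetD hf) // => <-.
by rewrite mulrC divfK // pnatr_eq0.
Qed.

(** Polarization at [x + y], by the symmetry of the second derivative at 0. *)
Lemma second_coefficient_polar x y k :
  frechetD f [:: x; y] 0 ord0 k = x ord0 k * lin_form k y + y ord0 k * lin_form k x.
Proof.
have E := second_coefficient (x + y) k.
have E1 : frechetD f [:: x + y; x + y] 0 = frechetD f [:: x; x + y] 0 + frechetD f [:: y; x + y] 0.
  exact: (frechetD_add [::] [:: x + y]).
have E2 u : frechetD f [:: u; x + y] 0 = frechetD f [:: u; x] 0 + frechetD f [:: u; y] 0.
  exact: (frechetD_add [:: u] [::]).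
have S : frechetD f [:: y; x] 0 ord0 k = frechetD f [:: x; y] 0 ord0 k by exact: frechetD_symmetric hf _ _ _.
have L : lin_form k (x + y) = lin_form k x + lin_form k y.
  by rewrite /lin_form -big_split; apply: eq_bigr => l _; rewrite mxE mulrDr.
have XY : (x + y) ord0 k = x ord0 k + y ord0 k by rewrite mxE.
have K : frechetD f [:: x + y; x + y] 0 ord0 k =
  (frechetD f [:: x; x] 0 ord0 k + frechetD f [:: x; y] 0 ord0 k) +
  (frechetD f [:: y; x] 0 ord0 k + frechetD f [:: y; y] 0 ord0 k).
  by rewrite E1 (E2 x) (E2 y) mxE [X in X + _]mxE [X in _ + X]mxE.
have alg (s xx xy yx yy p q u v pq uv : C) : s = xx + xy + (yx + yy) -> yx = xy ->
    xx = 2 * (p * u) -> yy = 2 * (q * v) -> s = 2 * (pq * uv) -> pq = p + q -> uv = u + v ->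
    xy = p * v + q * u.
  move=> F Fyx Fxx Fyy F' Ep Eu; rewrite F' Ep Eu Fyx Fxx Fyy in F.
  have n2 : (2 : C) != 0 by rewrite pnatr_eq0.
  apply: (mulfI n2).
  have -> : 2 * xy = (2 * (p * u) + xy + (xy + 2 * (q * v))) - 2 * (p * u) - 2 * (q * v) by ring.
  by rewrite -F; ring.
exact: (alg _ _ _ _ _ _ _ _ _ _ _ K S (second_coefficient x k) (second_coefficient y k) E XY L).
Qed.

Lemma rnormC2 : rnorm (2 : C) = 2.
Proof.
have -> : (2 : C) = ofR 2 by rewrite /ofR rmorph_nat.
by rewrite rnorm_ofR normr_nat.
Qed.

Lemma row_sum_bound k : \sum_(l < n) rnorm (a k l) <= 1 - alpha.
Proof.
(* The phases turn every product of [a k l] with the [l]-th entry into the modulus of [a k l]; where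
   the coefficient is 0 the entry 1 keeps all entries unimodular, so [quot_bounds] is available for
   row [k]. *)
pose z : 'rV[C]_n := \row_l (if a k l == 0 then 1 else ofR (rnorm (a k l)) / a k l).
have zl l : rnorm (z ord0 l) = 1.
  rewrite mxE; case: eqVneq => [_|al]; first exact: rnorm1.
  by rewrite rnormM rnormV rnorm_ofR ger0_norm ?rnorm_ge0 // divff // rnorm_eq0.
have z1 : rnorm z = 1.
  apply/eqP; rewrite eq_le -{2}(zl k) rnorm_entry andbT.
  by apply: rnorm_row_le => // l; rewrite zl.
have E : lin_form k z = ofR (\sum_(l < n) rnorm (a k l)).
  rewrite /lin_form /ofR rmorph_sum; apply: eq_bigr => l _; rewrite mxE.
  by case: eqVneq => [->|al]; rewrite ?mul0r ?rnorm0 // mulrC divfK.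
have [+ _] := quot_bounds qc z1 a1 (zl k).
rewrite second_coefficient rnormM rnormM zl mul1r E rnorm_ofR.
rewrite rnormC2 ler_pM2l // => h; exact: le_trans (ler_norm _) h.
Qed.

Lemma lin_form_bound k z : rnorm (lin_form k z) <= (1 - alpha) * rnorm z.
Proof.
apply: le_trans (rnorm_sum _ _ _) _.
apply: le_trans (_ : \sum_(l < n) rnorm (a k l) * rnorm z <= _).
  by apply: ler_sum => l _; rewrite rnormM ler_wpM2l ?rnorm_ge0 // rnorm_entry.
by rewrite -mulr_suml ler_wpM2r ?rnorm_ge0 // row_sum_bound.
Qed.

(** Equals [2 (1 - alpha) (3 - 2 alpha)], six times the constant of the theorem. *)
Let bound := 2 * (1 - alpha) + 4 * (1 - alpha) ^+ 2.

Lemma third_coefficient_unimodular (z : 'rV[C]_n) k : rnorm z = 1 -> rnorm (z ord0 k) = 1 ->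
  rnorm (frechetD f [:: z; z; z] 0 ord0 k) <= bound.
Proof.
move=> z1 zk; have a1' : 0 <= 1 - alpha by rewrite subr_ge0.
have [_ b2] := quot_bounds qc z1 a1 zk.
rewrite (cderive2_quot0 qc z1) second_coefficient_polar.
set u := frechetD f [:: z; z] 0.
(* All coordinates of [u] are needed, also those where [z] is not maximal; the special form and the
   row sums cover them. *)
have ul l : rnorm (u ord0 l) <= 2 * (1 - alpha).
  rewrite second_coefficient rnormM rnormC2 rnormM ler_wpM2l //.
  have := lin_form_bound l z; rewrite z1 mulr1 => h.
  by rewrite -[leRHS]mul1r; apply: ler_pM; rewrite ?rnorm_ge0 // -z1 rnorm_entry.
have u1 : rnorm u <= 2 * (1 - alpha) by apply: rnorm_row_le => //; rewrite mulr_ge0.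
have t1 : rnorm (z ord0 k * lin_form k u) <= 2 * (1 - alpha) ^+ 2.
  rewrite rnormM zk mul1r; apply: le_trans (lin_form_bound k u) _.
  by apply: le_trans (ler_wpM2l a1' u1) _; rewrite mulrCA -expr2.
have t2 : rnorm (u ord0 k * lin_form k z) <= 2 * (1 - alpha) ^+ 2.
  have := lin_form_bound k z; rewrite z1 mulr1 => h.
  by rewrite rnormM expr2 mulrA; apply: ler_pM; rewrite ?rnorm_ge0.
apply: le_trans (rnormD _ _) _; apply: le_trans (lerD b2 (rnormD _ _)) _.
apply: le_trans (lerD (lexx _) (lerD t1 t2)) _; rewrite /bound; lra.
Qed.

(* As a polynomial in the k-th variable alone, D^3 f_k(0)(z^3) satisfies the maximum principle. *)
Lemma third_coefficient_bound (z : 'rV[C]_n) k : rnorm z = 1 ->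
  rnorm (frechetD f [:: z; z; z] 0 ord0 k) <= bound.
Proof.
move=> z1; pose e : 'rV[C]_n := delta_mx 0 k; pose y := z - z ord0 k *: e.
pose T u v w := frechetD f [:: u; v; w] 0 ord0 k.
have T1 w u v : T (w *: e + y) u v = w * T e u v + T y u v.
  by rewrite /T (frechetD_linear hf [::] [:: u; v] w e y D0) !mxE.
have T2 w u v : T u (w *: e + y) v = w * T u e v + T u y v.
  by rewrite /T (frechetD_linear hf [:: u] [:: v] w e y D0) !mxE.
have T3 w u v : T u v (w *: e + y) = w * T u v e + T u v y.
  by rewrite /T (frechetD_linear hf [:: u; v] [::] w e y D0) !mxE.
have TE u : frechetD f [:: u; u; u] 0 ord0 k = T u u u by [].
clearbody T.
pose p : {poly C} :=
  'X * ('X * ('X * (T e e e)%:P + (T e e y)%:P) + ('X * (T e y e)%:P + (T e y y)%:P)) +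
  ('X * ('X * (T y e e)%:P + (T y e y)%:P) + ('X * (T y y e)%:P + (T y y y)%:P)).
have pE w : p.[w] = T (w *: e + y) (w *: e + y) (w *: e + y).
  by rewrite T1 !T2 !T3 /p !(hornerD, hornerM, hornerX, hornerC).
have xE w l : (w *: e + y) ord0 l = if l == k then w else z ord0 l.
  rewrite !mxE eqxx /=; case: eqVneq => [->|_]; first by rewrite mulr1 mulr1 subrr addr0.
  by rewrite !mulr0 add0r subr0.
have -> : frechetD f [:: z; z; z] 0 ord0 k = p.[z ord0 k].
  by rewrite pE TE /y addrC subrK.
have zk1 : rnorm (z ord0 k) <= 1 by rewrite -z1 rnorm_entry.
(* Replacing the [k]-th entry by a unimodular [w] keeps the norm equal to 1 and makes that
   coordinate maximal. *)
apply: poly_max_modulus zk1 => w w1; rewrite pE -TE.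
have xk : rnorm ((w *: e + y) ord0 k) = 1 by rewrite xE eqxx.
apply: third_coefficient_unimodular => //.
apply/eqP; rewrite eq_le -{2}xk rnorm_entry andbT; apply: rnorm_row_le => // l.
by rewrite xE; case: eqP => _; [rewrite w1|rewrite -z1 rnorm_entry].
Qed.

Lemma quasi_convex_third_order_bound :
  third_order_bound ((1 - alpha) * (3 - 2 * alpha) / 3) f.
Proof.
move=> z _; have a1' : 0 <= 1 - alpha by rewrite subr_ge0.
have b0 : 0 <= bound by rewrite /bound addr_ge0 // mulr_ge0 // sqr_ge0.
have -> : (1 - alpha) * (3 - 2 * alpha) / 3 = bound / 6 by rewrite /bound; field.
have -> : (3`!)%:R = 6 :> R by [].
suff H : rnorm (Dpow 3 f 0 z) <= rnorm z ^+ 3 * bound.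
  by rewrite mulrAC [bound * _]mulrC ler_wpM2r.
rewrite /Dpow -[nseq 3 z]/[:: z; z; z].
have [->|z0] := eqVneq z 0.
  have -> : frechetD f [:: 0; 0; 0] 0 = 0 by exact: linear0.
  by rewrite !rnorm0 expr0n mul0r.
have zp : 0 < rnorm z by rewrite rnorm_gt0.
pose r : C := ofR (rnorm z); pose y := r^-1 *: z.
have r0 : r != 0 by rewrite -rnorm_eq0 rnorm_ofR normr_eq0 gt_eqF.
have y1 : rnorm y = 1.
  by rewrite rnormZ rnormV rnorm_ofR gtr0_norm // mulVf // gt_eqF.
have -> : z = r *: y by rewrite scalerA divff // scale1r.
have E1 : frechetD f [:: r *: y; r *: y; r *: y] 0 = r *: frechetD f [:: y; r *: y; r *: y] 0.
  exact: (frechetD_scale qc [::] [:: r *: y; r *: y] r y D0).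
have E2 : frechetD f [:: y; r *: y; r *: y] 0 = r *: frechetD f [:: y; y; r *: y] 0.
  exact: (frechetD_scale qc [:: y] [:: r *: y] r y D0).
have E3 : frechetD f [:: y; y; r *: y] 0 = r *: frechetD f [:: y; y; y] 0.
  exact: (frechetD_scale qc [:: y; y] [::] r y D0).
have rn : rnorm (r *: y) = rnorm z by rewrite rnormZ y1 mulr1 rnorm_ofR gtr0_norm.
have rr : rnorm r = rnorm z by rewrite rnorm_ofR gtr0_norm.
rewrite rn E1 E2 E3 !rnormZ rr !mulrA -expr2 -exprSr.
rewrite ler_wpM2l ?exprn_ge0 ?rnorm_ge0 //.
by apply: rnorm_row_le => // k; exact: third_coefficient_bound.
Qed.
End UpperBound.

(** * Extremal maps *)

(** The letters stand for [q = rho^s], [P = 1 / q], [r = rho], [T = 2^k], [S = s] and [u = 1 - z];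
    the hypotheses are the derivatives of [P q = 1], of the power [q] and of [rho^T = 1 - z]. *)
Lemma logarithmic_derivative_elimination (K : fieldType) (q r T S u q' p' r' P : K) :
  T != 0 -> q != 0 -> r != 0 -> p' * q + P * q' = 0 -> q' * r = S * q * r' ->
  T * (u * r') = - r -> u * p' = S / T * P.
Proof.
move=> T0 q0 r0 E1 E2 E3; have N : q * r * T != 0 by rewrite !mulf_neq0.
apply: (mulIf N); have -> : u * p' * (q * r * T) = (p' * q + P * q') * u * r * T
    - P * u * T * (q' * r - S * q * r') - P * S * q * (T * (u * r') + r) + P * S * q * r by ring.
by rewrite E1 E2 E3 subrr addNr !(mul0r, mulr0) !subr0 add0r; field; exact: T0.
Qed.

(** * Dyadic powers of 1 - z *)

Section PowerFunction.
Variable R : realType.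
Local Notation C := (Cplx R).

(** A purely imaginary number has a nonpositive square, so each root has nonzero real part and one
    of the two opposite roots lies in the right half-plane. *)
Lemma right_half_plane_sqrt (w : C) : 0 < complex.Re w ->
  exists2 s : C, 0 < complex.Re s & s ^+ 2 = w.
Proof.
move=> w0; have sw : (sqrtc w : C) ^+ 2 = w by exact: sqr_sqrtc.
have Rs : complex.Re (sqrtc w : C) != 0.
  apply: contraTneq w0 => E; rewrite -sw expr2 Re_M E mul0r sub0r -leNgt oppr_le0.
  by rewrite -expr2 sqr_ge0.
have [s0|s0] := ltP 0 (complex.Re (sqrtc w : C)); first by exists (sqrtc w).
exists (- (sqrtc w : C)); last by rewrite sqrrN.
by rewrite Re_N oppr_gt0 lt_neqAle Rs.
Qed.

(* h(z + k) - h(z) = (g(z + k) - g(z)) / (h(z + k) + h(z)), and the denominator stays away from 0. *)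
Lemma differentiable_sqrt (g h : C -> C) (z : C) :
  (forall w, h w ^+ 2 = g w) -> (\forall w \near z, 0 < complex.Re (h w)) ->
  differentiable g z -> differentiable h z.
Proof.
move=> hg /nbhs_rnorm[r r0 Hr] dg.
pose m := complex.Re (h z); pose D := 'd g z 1.
have m0 : 0 < m by have := Hr 0; rewrite rnorm0 addr0; exact.
have h0 : h z != 0 by apply: contraTneq m0 => E; rewrite /m E ltxx.
pose c := D / (2 * h z).
have lower k : rnorm k < r -> m <= rnorm (h (z + k) + h z).
  move=> /Hr hk; apply: le_trans (abs_Re_le _); apply: le_trans (ler_norm _).
  by rewrite Re_D lerDr ltW.
have lin : linear (fun k : C => c * k).
  by move=> a x y; rewrite mulrDr -[a *: x]/(a * x) -[a *: (_ : C)]/(a * _) mulrCA.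
pose L : {linear C -> C} := HB.pack (fun k : C => c * k) (GRing.isLinear.Build _ _ _ _ _ lin).
have LB k : rnorm (L k) <= rnorm c * rnorm k by rewrite -[L k]/(c * k) rnormM.
suff H : forall e : R, 0 < e -> exists2 d : R, 0 < d & forall k, rnorm k < d ->
    rnorm (h (z + k) - h z - L k) <= e * rnorm k by have [] := diff_intro LB H.
move=> e e0; pose e1 := e * m / 2.
have e10 : 0 < e1 by rewrite divr_gt0 // mulr_gt0.
have [d d0 Hd] := diff_approx dg e10.
pose K := rnorm c * ((rnorm D + e1) / m) + 1.
have G0 : 0 <= rnorm D by exact: rnorm_ge0.
have K0 : 0 < K.
  by rewrite ltr_wpDl // mulr_ge0 ?rnorm_ge0 // divr_ge0 ?(ltW m0) // addr_ge0 // ltW.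
exists (Num.min (Num.min d r) (e1 / K)) => [|k].
  by rewrite !lt_min d0 r0 divr_gt0.
rewrite !lt_min => /andP[/andP[kd kr] kK].
have lk := lower k kr; have Hk := Hd k kd; rewrite diffC_mul -/D in Hk.
have sum0 : 0 < rnorm (h (z + k) + h z) by apply: lt_le_trans lk.
have E1 : g (z + k) - g z = (h (z + k) + h z) * (h (z + k) - h z) by rewrite -!hg; ring.
have gk : rnorm (g (z + k) - g z) <= (rnorm D + e1) * rnorm k.
  have -> : g (z + k) - g z = (g (z + k) - g z - D * k) + D * k by rewrite subrK.
  by apply: le_trans (rnormD _ _) _; rewrite rnormM mulrDl addrC lerD2l.
have hk : rnorm (h (z + k) - h z) <= (rnorm D + e1) / m * rnorm k.
  rewrite mulrAC ler_pdivlMr // mulrC; apply: le_trans gk.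
  by rewrite E1 rnormM ler_wpM2r ?rnorm_ge0.
(* The increment of [g] is the sum of the two roots times their difference, and [D = 2 * h z * c];
   the last product is of second order in [k] by [hk]. *)
have E2 : (h (z + k) + h z) * (h (z + k) - h z - L k) =
    (g (z + k) - g z - D * k) - c * k * (h (z + k) - h z).
  rewrite -[L k]/(c * k) E1 /c; move: (h (z + k)) => hk'; field; exact: h0.
have E3 : m * rnorm (h (z + k) - h z - L k) <= e * m * rnorm k.
  apply: le_trans (_ : rnorm (h (z + k) + h z) * rnorm (h (z + k) - h z - L k) <= _).
    by rewrite ler_wpM2r ?rnorm_ge0.
  rewrite -rnormM E2; apply: le_trans (rnormB _ _) _.
  have -> : e * m * rnorm k = e1 * rnorm k + e1 * rnorm k by rewrite /e1; field.
  apply: lerD => //; rewrite rnormM rnormM.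
  apply: le_trans (_ : rnorm c * rnorm k * ((rnorm D + e1) / m * rnorm k) <= _).
    by rewrite ler_wpM2l // mulr_ge0 ?rnorm_ge0.
  have -> : rnorm c * rnorm k * ((rnorm D + e1) / m * rnorm k) = (rnorm c * ((rnorm D + e1) / m)) * rnorm k * rnorm k by ring.
  rewrite ler_wpM2r ?rnorm_ge0 //.
  rewrite ltr_pdivlMr // in kK; apply: le_trans (ltW kK); rewrite mulrC ler_wpM2l ?rnorm_ge0 //.
  by rewrite /K lerDl.
by rewrite -(ler_pM2l m0) mulrCA mulrA.
Qed.

(** Taking roots in the right half-plane fixes the branch: it makes [differentiable_sqrt]
    applicable, excludes the value -1 at 0, and permits the next root. *)
Lemma dyadic_root k : exists rho : C -> C, [/\ disc_holomorphic rho, rho 0 = 1,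
  (forall z, rnorm z < 1 -> 0 < complex.Re (rho z)) &
  (forall z, rnorm z < 1 -> rho z ^+ (2 ^ k) = 1 - z)].
Proof.
elim: k => [|k [rho [hrho rho0 Re_rho rhoX]]].
  exists (fun z => 1 - z); split => [z _||z z1|z _].
  - by apply: differentiableB; [exact: differentiable_cst|exact: (cderive_id z).1].
  - by rewrite subr0.
  - rewrite Re_D Re_N /= subr_gt0; apply: le_lt_trans z1.
    by apply: le_trans (abs_Re_le _); exact: ler_norm.
  - by rewrite expn0 expr1.
have ex z : exists s : C, s ^+ 2 = rho z /\ (rnorm z < 1 -> 0 < complex.Re s).
  have [z1|z1] := boolP (rnorm z < 1).
    by have [s s0 sE] := right_half_plane_sqrt (Re_rho z z1); exists s.
  (* Outside the disc any root will do; [differentiable_sqrt] wants the square relation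
     everywhere. *)
  by exists (sqrtc (rho z)); split => //; exact: sqr_sqrtc.
pose sigma z := projT1 (cid (ex z)).
have sE z : sigma z ^+ 2 = rho z by have [] := projT2 (cid (ex z)).
have s0 z : rnorm z < 1 -> 0 < complex.Re (sigma z) by have [] := projT2 (cid (ex z)).
exists sigma; split => [z z1||//|z z1].
- apply: (differentiable_sqrt sE) (hrho z z1).
  by apply: filterS (nbhs_disc z1) => w; exact: s0.
- have n0 : rnorm (0 : C) < 1 by rewrite rnorm0.
  have /eqP : sigma 0 ^+ 2 = 1 by rewrite sE rho0.
  rewrite sqrf_eq1 => /orP[/eqP //|/eqP E].
  by have := s0 0 n0; rewrite E Re_N /= ltr0N1.
- by rewrite expnS exprM sE rhoX.
Qed.

(** The factor [phi z] on both sides avoids the exponent [m - 1]. *)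
Lemma cderiveX (phi : C -> C) m z : differentiable phi z ->
  differentiable (fun w => phi w ^+ m) z /\
  cderive (fun w => phi w ^+ m) z * phi z = m%:R * phi z ^+ m * cderive phi z.
Proof.
move=> dphi; elim: m => [|m [d1 E1]].
  have [d0 E0] := cderive_cst (1 : C) z.
  split; first exact: d0.
  by rewrite (E0 : cderive (fun w => phi w ^+ 0) z = 0) !mul0r.
have EX : (fun w => phi w ^+ m.+1) = fun w => phi w * phi w ^+ m by apply/funext => w; rewrite exprS.
have [d2 E2] := cderiveM dphi d1; rewrite EX; split; first exact: d2.
have alg (p q r d N : C) : r * p = N * q * d -> (d * q + p * r) * p = (N + 1) * (p * q) * d.
  by move=> E; rewrite mulrDl -[p * r * p]mulrA E; ring.
by rewrite E2 exprS -natr1; exact: alg.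
Qed.

Lemma cderive_subl (z : C) :
  differentiable (fun w : C => 1 - w) z /\ cderive (fun w : C => 1 - w) z = -1.
Proof.
have [da Ea] := cderive_cst (1 : C) z; have [di Ei] := cderive_id z.
have [dm Em] := cderive_cst (-1 : C) z.
have [db Eb] := cderiveM dm di; have [dc Ec] := cderiveD da db.
have -> : (fun w : C => 1 - w) = (fun w => 1 + -1 * w) by apply/funext => x; rewrite mulN1r.
by split; [exact: dc|rewrite Ec Ea Eb Em Ei mul0r !add0r mulr1].
Qed.

(* The function (1 - z)^(-b) for the dyadic exponent b = s / 2^k. *)
Lemma dyadic_power s k : exists p : C -> C, [/\ disc_holomorphic p, p 0 = 1,
  (forall z : C, rnorm z < 1 -> p z != 0) &
  (forall z : C, rnorm z < 1 -> (1 - z) * cderive p z = ofR (s%:R / (2 ^ k)%:R) * p z)].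
Proof.
have [rho [hrho rho0 Re_rho rhoX]] := dyadic_root k.
pose t := (2 ^ k)%N; have t0 : (t%:R : C) != 0 by rewrite pnatr_eq0 expn_eq0.
have rhon (z : C) : rnorm z < 1 -> rho z != 0.
  by move=> z1; apply: contraTneq (Re_rho z z1) => ->; rewrite ltxx.
have theta (z : C) : rnorm z < 1 -> t%:R * ((1 - z) * cderive rho z) = - rho z.
  move=> z1; have [d1 E1] := cderiveX t (hrho z z1).
  have [_ E2] := eq_cderive z1 (fun w _ => (cderive_subl w).1) rhoX.
  have alg (x q r d T u : C) : x * r = T * q * d -> x = -1 -> q = u -> T * (u * d) = - r.
    by move=> E xE <-; rewrite mulrA -E xE mulN1r.
  exact: alg E1 (etrans E2 (cderive_subl z).2) (rhoX z z1).
pose p z := (rho z ^+ s)^-1.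
have dq (z : C) : rnorm z < 1 -> differentiable (fun w => rho w ^+ s) z by move=> z1; have [] := cderiveX s (hrho z z1).
have hp : disc_holomorphic p.
  by move=> z z1; apply: differentiableV; [exact: dq|rewrite expf_neq0 // rhon].
exists p; split => // [|z z1|z z1]; first by rewrite /p rho0 expr1n invr1.
  by rewrite invr_eq0 expf_neq0 // rhon.
have qn : rho z ^+ s != 0 by rewrite expf_neq0 // rhon.
have [_ Eq] := cderiveX s (hrho z z1).
have [_ Epq] := cderiveM (hp z z1) (dq z z1).
have d1 (w : C) : rnorm w < 1 -> differentiable (fun=> 1 : C) w by move=> _; exact: differentiable_cst.
have one (w : C) : rnorm w < 1 -> p w * rho w ^+ s = 1.
  by move=> w1; rewrite mulVf // expf_neq0 // rhon.
have [_ E1] := eq_cderive z1 d1 one.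
have P0 : cderive p z * rho z ^+ s + p z * cderive (fun w => rho w ^+ s) z = 0.
  by rewrite -Epq E1; exact: (cderive_cst _ _).2.
have -> : ofR (s%:R / (2 ^ k)%:R) = s%:R / t%:R :> C.
  by rewrite /ofR rmorphM fmorphV !rmorph_nat.
exact: logarithmic_derivative_elimination t0 qn (rhon z z1) P0 Eq (theta z z1).
Qed.

Lemma dyadic_below (beta e : R) : 0 < beta -> 0 < e -> exists s k : nat,
  let b := s%:R / (2 ^ k)%:R : R in [/\ b != 1, b <= beta & beta - e <= b].
Proof.
move=> b0 e0; have [k Hk] := half_pow_lt 2 e0.
have t0 : 0 < (2 ^ k)%:R :> R by rewrite ltr0n expn_gt0.
have tk : 2 ^+ k = (2 ^ k)%:R :> R by rewrite natrX.
rewrite tk in Hk; set t := (2 ^ k)%N in t0 Hk *.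
pose m := Num.truncn (beta * t%:R).
have bt0 : 0 <= beta * t%:R by rewrite mulr_ge0 // ltW.
have /andP[m1 m2] : m%:R <= beta * t%:R < m.+1%:R by exact: truncn_itv.
have t2 : 2 < e * t%:R by rewrite -ltr_pdivrMr.
rewrite -natr1 in m2.
(* Truncation may give [b = 1], where the primitive of [(1 - z)^-b] is a logarithm and
   [extremal_function] does not apply. Stepping down by one costs another [1 / t], which is why
   [2 / t < e] was arranged. *)
have [mt|mt] := eqVneq m t.
  have m0 : (0 < m)%N by rewrite mt expn_gt0.
  have mS : m.-1%:R = m%:R - 1 :> R by rewrite -{2}(prednK m0) -natr1 addrK.
  exists m.-1, k; split; rewrite -/t.
  - by rewrite lt_eqF // ltr_pdivrMr // mS mt; lra.
  - by rewrite ler_pdivrMr // mS; lra.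
  - by rewrite ler_pdivlMr // mS mulrBl; lra.
exists m, k; split; rewrite -/t.
- by apply: contraNneq mt => E; rewrite -(eqr_nat R) -[m%:R](divfK (lt0r_neq0 t0)) E mul1r.
- by rewrite ler_pdivrMr.
- by rewrite ler_pdivlMr // mulrBl; lra.
Qed.
End PowerFunction.

Section ExtremalFunction.
Variable R : realType.
Local Notation C := (Cplx R).

(** The equation at 0 gives [p'(0) = b]; its derivative there reads [p''(0) - p'(0) = b p'(0)]. *)
Lemma binomial_ode_derivatives (p : C -> C) (b : C) : disc_holomorphic p -> p 0 = 1 ->
  (forall z : C, rnorm z < 1 -> (1 - z) * cderive p z = b * p z) ->
  cderive p 0 = b /\ cderive (cderive p) 0 = b * (b + 1).
Proof.
move=> hp p0 H; have n0 : rnorm (0 : C) < 1 by rewrite rnorm0.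
have E1 : cderive p 0 = b by rewrite -[LHS]mul1r -[X in X * _](subr0 1) (H 0 n0) p0 mulr1.
split=> //; have hp' := disc_holomorphic_cderive hp.
have db (w : C) : rnorm w < 1 -> differentiable (fun w => b * p w) w.
  by move=> w1; have [] := cderiveM (cderive_cst b w).1 (hp w w1).
have [_ EL] := cderiveM (cderive_subl 0).1 (hp' 0 n0).
have [_ ER] := cderiveM (cderive_cst b 0).1 (hp 0 n0).
have [_ E] := eq_cderive n0 db H.
have alg (m u p1 p2 k q : C) : m = -1 -> u = 0 -> k = 0 -> p1 = b ->
    m * p1 + (1 - u) * p2 = k * q + b * p1 -> p2 = b * (b + 1).
  by move=> -> -> -> ->; rewrite subr0 mul0r mul1r add0r mulN1r => /eqP; rewrite addrC subr_eq => /eqP ->; rewrite mulrDr mulr1.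
apply: alg (cderive_subl 0).2 erefl (cderive_cst b 0).2 E1 _.
exact: etrans (esym EL) (etrans E ER).
Qed.

(* F(z) = (1 - (1 - z)^(1 - b)) / (1 - b), so that F' = (1 - z)^(-b). *)
Lemma extremal_function s k (b := s%:R / (2 ^ k)%:R : R) : b != 1 ->
  exists F : C -> C, [/\ disc_holomorphic F, F 0 = 0,
    (forall z : C, rnorm z < 1 -> cderive F z != 0),
    (forall z : C, rnorm z < 1 -> (1 - z) * cderive (cderive F) z = ofR b * cderive F z) &
    [/\ cderive F 0 = 1, cderive (cderive F) 0 = ofR b &
      cderive (cderive (cderive F)) 0 = ofR b * (ofR b + 1)]].
Proof.
move=> b1; have [p [hp p0 pn Hp]] := dyadic_power R s k; rewrite -/b in Hp.
have n0 : rnorm (0 : C) < 1 by rewrite rnorm0.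
pose B : C := ofR b.
have B1 : 1 - B != 0.
  by rewrite subr_eq0 eq_sym; apply: contraNneq b1 => /(congr1 (@complex.Re R)) /= ->.
pose a : C := (1 - B)^-1.
pose F (w : C) : C := a + - a * ((1 - w) * p w).
have FE (z : C) : rnorm z < 1 -> differentiable F z /\ cderive F z = p z.
  move=> z1; have [d1 E1] := cderiveM (cderive_subl z).1 (hp z z1).
  have [d2 E2] := cderiveM (cderive_cst (- a) z).1 d1.
  have [d3 E3] := cderiveD (cderive_cst a z).1 d2.
  split; first exact: d3.
  have alg (x y m u q r l : C) : x = 0 -> y = 0 -> m = -1 -> u * r = B * q ->
      x + (y * l + - a * (m * q + u * r)) = q.
    by move=> -> -> -> ->; rewrite mul0r !add0r /a; field; exact: B1.
  apply: (etrans E3); apply: (etrans (congr1 (fun y => _ + y) E2)).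
  apply: (etrans (congr1 (fun y => _ + (_ + _ * y)) E1)).
  exact: alg (cderive_cst a z).2 (cderive_cst (- a) z).2 (cderive_subl z).2 (Hp z z1).
have hp' := disc_holomorphic_cderive hp.
have F2 (z : C) : rnorm z < 1 -> cderive (cderive F) z = cderive p z.
  by move=> z1; have [] := eq_cderive z1 hp (fun w w1 => (FE w w1).2).
have F3 (z : C) : rnorm z < 1 -> cderive (cderive (cderive F)) z = cderive (cderive p) z.
  by move=> z1; have [] := eq_cderive z1 hp' F2.
have [p1 p2] := binomial_ode_derivatives hp p0 Hp.
exists F; split => [z z1||z z1|z z1|].
- exact: (FE z z1).1.
- by rewrite /F subr0 mul1r p0 mulr1 subrr.
- by rewrite (FE z z1).2; exact: pn.
- by rewrite (FE z z1).2 (F2 z z1); exact: Hp.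
- split; first exact: etrans (FE 0 n0).2 p0.
    exact: etrans (F2 0 n0) p1.
  exact: etrans (F3 0 n0) p2.
Qed.

End ExtremalFunction.

(** * Differentials of diagonal maps *)

Section DiagonalMap.
Variables (R : realType) (n : nat).
Local Notation C := (Cplx R).

Lemma diff_coord (phi : C -> C) (c : C) (x : 'rV[C]_n) k :
  differentiable phi (x ord0 k) ->
  differentiable (fun y : 'rV[C]_n => phi (y ord0 k) * c) x /\
  forall h, 'd (fun y : 'rV[C]_n => phi (y ord0 k) * c) x h = cderive phi (x ord0 k) * h ord0 k * c.
Proof.
move=> dphi; pose D := cderive phi (x ord0 k).
pose L0 (h : 'rV[C]_n) : C := D * h ord0 k * c.
have lin : linear L0.
  move=> a u w; rewrite /L0 !mxE mulrDr mulrDl; congr (_ + _).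
  by rewrite -[RHS]/(a * _) [D * (a * _)]mulrCA -!mulrA.
pose L : {linear 'rV[C]_n -> C} := HB.pack L0 (GRing.isLinear.Build _ _ _ _ L0 lin).
have LB h : rnorm (L h) <= rnorm D * rnorm c * rnorm h.
  rewrite -[L h]/(D * h ord0 k * c) rnormM rnormM mulrAC.
  by rewrite ler_wpM2l ?rnorm_entry // mulr_ge0 ?rnorm_ge0.
suff H : forall e : R, 0 < e -> exists2 d : R, 0 < d & forall h : 'rV[C]_n, rnorm h < d ->
    rnorm (phi ((x + h) ord0 k) * c - phi (x ord0 k) * c - L h) <= e * rnorm h.
  have [d1 E1] := @diff_intro R _ _ (fun y : 'rV[C]_n => phi (y ord0 k) * c) x L _ LB H.
  by split; [exact: d1|move=> h; exact: (congr1 (fun G => G h) E1)].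
move=> e e0; pose e1 := e / (rnorm c + 1).
have c1 : 0 < rnorm c + 1 by rewrite ltr_wpDl ?rnorm_ge0.
have e10 : 0 < e1 by rewrite divr_gt0.
have [d d0 Hd] := diff_approx dphi e10.
exists d => // h hd; have hk := rnorm_entry h k.
have := Hd (h ord0 k) (le_lt_trans hk hd); rewrite diffC_mul -/(cderive phi (x ord0 k)) -/D => Hk.
have -> : phi ((x + h) ord0 k) * c - phi (x ord0 k) * c - L h =
    (phi (x ord0 k + h ord0 k) - phi (x ord0 k) - D * h ord0 k) * c.
  by rewrite mxE -[L h]/(D * h ord0 k * c) !mulrBl.
rewrite rnormM; apply: le_trans (_ : e1 * rnorm h * rnorm c <= _).
  rewrite ler_wpM2r ?rnorm_ge0 //; apply: le_trans Hk _.
  by rewrite ler_wpM2l // ltW.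
rewrite mulrAC ler_wpM2r ?rnorm_ge0 // /e1 mulrAC ler_pdivrMr // ler_wpM2l ?(ltW e0) //.
by rewrite lerDl.
Qed.

(** The weights [c] will be the powers [y_k^m] in the induction that computes the iterated
    derivatives of a diagonal map. *)
Lemma diff_diagonal (phi : C -> C) (c x : 'rV[C]_n) : disc_holomorphic phi -> polydisk x ->
  differentiable (fun y : 'rV[C]_n => \row_k (phi (y ord0 k) * c ord0 k)) x /\
  forall h, 'd (fun y : 'rV[C]_n => \row_k (phi (y ord0 k) * c ord0 k)) x h =
    \row_k (cderive phi (x ord0 k) * (h ord0 k * c ord0 k)).
Proof.
move=> hphi Dx.
have D k : rnorm (x ord0 k) < 1 by exact: le_lt_trans (rnorm_entry x k) Dx.
have E k : (fun y : 'rV[C]_n => (\row_j (phi (y ord0 j) * c ord0 j)) ord0 k) =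
    (fun y => phi (y ord0 k) * c ord0 k) by apply/funext => y; rewrite mxE.
have dF : differentiable (fun y : 'rV[C]_n => \row_k (phi (y ord0 k) * c ord0 k)) x.
  by apply: diff_row => k; rewrite E; exact: (diff_coord _ (hphi _ (D k))).1.
split; first exact: dF.
move=> h; apply/rowP => k; rewrite [RHS]mxE mulrA.
have [_ Ek] := diff_entry k dF; apply: (etrans (esym (Ek h))).
rewrite E; exact: (diff_coord _ (hphi _ (D k))).2.
Qed.

End DiagonalMap.

(** * Support functionals of the sup norm *)

Section Support.
Variables (R : realType) (n : nat).
Local Notation C := (Cplx R).

Lemma scalar_coord (T : {scalar 'rV[C]_n}) (y : 'rV[C]_n) :
  T y = \sum_k T (delta_mx 0 k) * y ord0 k.
Proof.
rewrite {1}[y]row_sum_delta linear_sum; apply: eq_bigr => k _.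
by rewrite linearZ mulrC.
Qed.

Lemma dual_norm_sum_le (T : {scalar 'rV[C]_n}) : dual_norm T = 1 ->
  \sum_k rnorm (T (delta_mx 0 k)) <= 1.
Proof.
rewrite /dual_norm; set E := [set _ | _ in _] => T1.
(* A set without supremum has [sup] equal to 0 by default, so the value 1 shows that the set is
   bounded. *)
have [_ ubE] : has_sup E.
  by apply: contrapT => /sup_out E0; move: T1; rewrite E0 => /eqP; rewrite eq_sym oner_eq0.
(* The phases of the conjugates turn [T y] into the sum of the moduli; where [t k = 0] the quotient
   is 0 by convention. *)
pose t k : C := T (delta_mx 0 k); pose y : 'rV[C]_n := \row_k (conjc (t k) / ofR (rnorm (t k))).
have y1 : rnorm y <= 1.
  apply: rnorm_row_le => // k; rewrite mxE rnormM rnormV rnorm_conjc rnorm_ofR.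
  rewrite ger0_norm ?rnorm_ge0 //; have [->|t0] := eqVneq (rnorm (t k)) 0; first by rewrite mul0r.
  by rewrite divff.
have Ty : T y = ofR (\sum_k rnorm (t k)).
  rewrite scalar_coord /ofR rmorph_sum; apply: eq_bigr => k _; rewrite mxE -/(t k) mulrA mulc_conjc.
  have [->|t0] := eqVneq (t k) 0; first by rewrite rnorm0 expr0n /ofR !rmorph0 mul0r.
  rewrite expr2 /ofR rmorphM /= mulfK // -[_ == 0]/(ofR _ == 0).
  by rewrite -rnorm_eq0 rnorm_ofR normr_eq0 rnorm_eq0.
rewrite -T1; apply: le_trans (ub_le_sup ubE (_ : E (rnorm (T y)))); last by exists y.
by rewrite Ty rnorm_ofR ler_norm.
Qed.

(* Equality in Re T(x) <= sum_k |T(e_k)| |x_k| <= |x| forces every summand to be real and nonnegative. *)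
Lemma support_functional_weights (x : 'rV[C]_n) (T : {scalar 'rV[C]_n}) : support_functional x T ->
  exists mu : 'I_n -> R, [/\ forall k, 0 <= mu k, \sum_k mu k = rnorm x &
    forall k, T (delta_mx 0 k) * x ord0 k = ofR (mu k)].
Proof.
move=> [T1 Tx]; pose t k : C := T (delta_mx 0 k).
have S1 := dual_norm_sum_le T1.
have ReT : \sum_k complex.Re (t k * x ord0 k) = rnorm x.
  rewrite scalar_coord normE in Tx; have := congr1 (@complex.Re R) Tx.
  by rewrite raddf_sum.
pose mu k := rnorm (t k * x ord0 k).
have muRe k : complex.Re (t k * x ord0 k) <= mu k by apply: le_trans (abs_Re_le _); exact: ler_norm.
have mux : \sum_k mu k <= rnorm x.
  apply: le_trans (_ : \sum_k rnorm (t k) * rnorm x <= _).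
    by apply: ler_sum => k _; rewrite /mu rnormM ler_wpM2l ?rnorm_ge0 ?rnorm_entry.
  by rewrite -mulr_suml ler_piMl ?rnorm_ge0.
have tight k : complex.Re (t k * x ord0 k) = mu k.
  have d0 j : true -> 0 <= mu j - complex.Re (t j * x ord0 j) by move=> _; rewrite subr_ge0.
  have S0 : \sum_j (mu j - complex.Re (t j * x ord0 j)) = 0.
    by apply/eqP; rewrite eq_le sumr_ge0 // andbT sumrB ReT subr_le0.
  by have /eqP := psumr_eq0P d0 S0 (erefl : is_true true) (i := k); rewrite subr_eq0 => /eqP.
exists mu; split => [k||k]; first exact: rnorm_ge0.
- by rewrite -ReT; apply: eq_bigr => k _; rewrite tight.
apply: Cplx_eq; first exact: tight.
have := tight k; rewrite /mu rnorm_def; move: (t k * x ord0 k) => w E.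
have := congr1 (fun r => r ^+ 2) E; rewrite sqr_sqrtr ?addr_ge0 ?sqr_ge0 // => /eqP.
by rewrite -subr_eq0 opprD addNKr oppr_eq0 sqrf_eq0 => /eqP.
Qed.

(** For [w = z / (1 - z)] one has [w = z * (1 + w)], so [w] is no farther from 0 than from -1. *)
Lemma Re_half_plane (z : C) : rnorm z < 1 -> - 2^-1 <= complex.Re (z / (1 - z)).
Proof.
move=> z1; have n1 : 1 - z != 0.
  by apply: contraTneq z1 => /subr0_eq <-; rewrite rnorm1 ltxx.
set w := z / (1 - z); have E : w = z * (1 + w) by rewrite /w; field; exact: n1.
have : rnorm w <= rnorm (1 + w) by rewrite {1}E rnormM ler_piMl ?rnorm_ge0 // ltW.
rewrite -ler_sqr ?nnegrE ?rnorm_ge0 // !rnorm_def !sqr_sqrtr ?addr_ge0 ?sqr_ge0 //.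
by rewrite Re_D Im_D /= add0r; move: (complex.Re w) (complex.Im w) => a b; rewrite sqrrD expr1n; lra.
Qed.

End Support.

(** * Extremal diagonal maps *)

Section Extremal.
Variables (R : realType) (n : nat).
Local Notation C := (Cplx R).
Variables (F : C -> C).
Hypothesis hF : disc_holomorphic F.

Let f (x : 'rV[C]_n) : 'rV[C]_n := \row_k F (x ord0 k).

Lemma Dpow_diagonal m (x y : 'rV[C]_n) : polydisk x ->
  Dpow m f x y = \row_k (iter m (@cderive R) F (x ord0 k) * y ord0 k ^+ m).
Proof.
have hol j : disc_holomorphic (iter j (@cderive R) F).
  by elim: j => [//|j IH]; exact: disc_holomorphic_cderive.
elim: m x => [|m IH] x Dx; first by apply/rowP => k; rewrite !mxE mulr1.
pose c : 'rV[C]_n := \row_k (y ord0 k ^+ m).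
have [dd Ed] := diff_diagonal c (hol m) Dx.
have [|_ E] := @diff_local_polydisk R n _ (fun x => Dpow m f x y) _ x Dx dd.
  by move=> z Dz; rewrite IH //; apply/rowP => k; rewrite !mxE.
apply: (etrans (E y)); apply: (etrans (Ed y)).
by apply/rowP => k; rewrite !mxE -exprS.
Qed.

Lemma holomorphic_diagonal : holomorphic_on_polydisk f.
Proof.
move=> x Dx; have [dd _] := diff_diagonal (const_mx 1) hF Dx.
have -> : f = fun y => \row_k (F (y ord0 k) * (const_mx 1 : 'rV[C]_n) ord0 k).
  by apply/funext => y; apply/rowP => k; rewrite !mxE mulr1.
exact: dd.
Qed.

Lemma diff_diagonal_map (x y : 'rV[C]_n) : polydisk x ->
  'd f x y = \row_k (cderive F (x ord0 k) * y ord0 k).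
Proof. exact: (@Dpow_diagonal 1). Qed.

Lemma jacobian_diagonal (x : 'rV[C]_n) : polydisk x ->
  'J f x = diag_mx (\row_k cderive F (x ord0 k)).
Proof.
move=> Dx; apply/matrixP => i j; rewrite /jacobian /lin1_mx mxE diff_diagonal_map // !mxE eqxx /=.
rewrite [j == i]eq_sym; have [->|_] := eqVneq i j; first by rewrite mulr1 mulr1n.
by rewrite mulr0 mulr0n.
Qed.

Hypothesis F0 : F 0 = 0.
Hypothesis Fn : forall z : C, rnorm z < 1 -> cderive F z != 0.
Variable b : R.
Hypothesis ode : forall z : C, rnorm z < 1 ->
  (1 - z) * cderive (cderive F) z = ofR b * cderive F z.
Hypothesis F1 : cderive F 0 = 1.
Hypothesis F2 : cderive (cderive F) 0 = ofR b.

Let entry (x : 'rV[C]_n) k : polydisk x -> rnorm (x ord0 k) < 1.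
Proof. exact: le_lt_trans (rnorm_entry x k). Qed.

Lemma locally_biholomorphic_diagonal : locally_biholomorphic f.
Proof.
move=> x Dx; rewrite jacobian_diagonal // unitmxE det_diag unitfE.
by apply/prodf_neq0 => k _; rewrite mxE; apply/Fn/entry.
Qed.

Lemma invD_diagonal (x w : 'rV[C]_n) : polydisk x ->
  invD f x w = \row_k (w ord0 k / cderive F (x ord0 k)).
Proof.
move=> Dx; have U := locally_biholomorphic_diagonal Dx.
apply: (canLR (mulmxK U)); rewrite jacobian_diagonal // mul_mx_diag.
by apply/rowP => k; rewrite !mxE divfK //; apply/Fn/entry.
Qed.

(** The weights of a support functional reduce the condition to one variable, where
    [1 + z F'' / F' = 1 + b z / (1 - z)] has real part at least [1 - b / 2]; this is the origin of
    the limit [2 (1 - alpha)]. *)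
Lemma quasi_convex_diagonal alpha : 0 <= b <= 2 * (1 - alpha) -> quasi_convex_B alpha f.
Proof.
move=> /andP[b0 ba]; split.
- exact: holomorphic_diagonal.
- split; first by apply/rowP => k; rewrite !mxE.
  move=> v; rewrite diff_diagonal_map; last exact: polydisk0.
  by apply/rowP => k; rewrite !mxE F1 mul1r.
- exact: locally_biholomorphic_diagonal.
move=> x Dx x0 T sT; have [mu [mu0 mux muE]] := support_functional_weights sT.
have gE k : invD f x (Dpow 2 f x x + 'd f x x) ord0 k =
    x ord0 k * (1 + ofR b * (x ord0 k / (1 - x ord0 k))).
  rewrite invD_diagonal // Dpow_diagonal // diff_diagonal_map // !mxE /=.
  have xk := entry k Dx; have := ode xk; have := Fn xk.
  have : 1 - x ord0 k != 0.
    by apply: contraTneq xk => /subr0_eq <-; rewrite rnorm1 ltxx.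
  move: (x ord0 k) (ofR b) (cderive F (x ord0 k)) (cderive (cderive F) (x ord0 k)).
  move=> z B p q z1 p0 E.
  have -> : q = B * p / (1 - z) by apply: (mulfI z1); rewrite E [RHS]mulrC divfK.
  by field; rewrite ?p0 ?z1.
rewrite scalar_coord /ReC raddf_sum -mux mulr_sumr; apply: ler_sum => k _ /=.
rewrite gE mulrA muE Re_M /= mul0r subr0 mulrC ler_wpM2l // Re_D Re_M /= mul0r subr0.
have := Re_half_plane (entry k Dx); move: (complex.Re _) => t Ht.
have : b * (- 2^-1) <= b * t by rewrite ler_wpM2l.
lra.
Qed.

Lemma second_order_form_diagonal : second_order_form f (ofR b / 2)%:M.
Proof.
move=> z k; have D0 := polydisk0 R n.
rewrite /Dpow (component_frechetD holomorphic_diagonal) // -/(Dpow 2 f 0 z) Dpow_diagonal // !mxE /= F2.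
rewrite (bigD1 k) //= big1 => [|l lk]; last by rewrite !mxE eq_sym (negPf lk) mul0r.
by rewrite mxE eqxx mulr1n addr0 -[(2`!)%:R]/(2 : C); field.
Qed.

Hypothesis F3 : cderive (cderive (cderive F)) 0 = ofR b * (ofR b + 1).

Lemma third_order_bound_diagonal c : (1 <= n)%N -> 0 <= b -> third_order_bound c f ->
  b * (b + 1) / 6 <= c.
Proof.
(* With equal entries [1 / 2], every coordinate of the third derivative is [b * (b + 1) / 8], so the
   powers of [1 / 2] cancel in the bound. *)
move=> hn b0 H; pose k := Ordinal hn; pose z : 'rV[C]_n := const_mx (ofR 2^-1).
have half : rnorm (ofR 2^-1 : C) = 2^-1 by rewrite rnorm_ofR gtr0_norm.
have zn : rnorm z = 2^-1.
  apply/eqP; rewrite eq_le; apply/andP; split.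
    by apply: rnorm_row_le => // j; rewrite mxE half.
  by have := rnorm_entry z k; rewrite mxE half.
have Dz : polydisk z by rewrite /polydisk /= zn invf_lt1 // ltr1n.
have := H z Dz; rewrite zn -[(3`!)%:R]/(6 : R) => Hz.
have := rnorm_entry (Dpow 3 f 0 z) k.
rewrite (Dpow_diagonal _ _ (polydisk0 R n)) // mxE /= mxE F3 -/(Dpow 3 f 0 z) mxE.
have -> : ofR b * (ofR b + 1) * ofR 2^-1 ^+ 3 = ofR (b * (b + 1) * 2^-1 ^+ 3) :> C.
  by rewrite /ofR !(rmorphM, rmorphD, rmorphXn, rmorph1).
rewrite rnorm_ofR ger0_norm ?mulr_ge0 ?addr_ge0 ?exprn_ge0 ?invr_ge0 //.
rewrite -(Dpow_diagonal _ _ (polydisk0 R n)).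
move: (rnorm _) Hz => N; rewrite ler_pdivrMr // => H1 H2.
have := le_trans H2 H1; rewrite ler_pdivrMr //; lra.
Qed.

End Extremal.

Lemma sharp_third_order_constant (R : realType) (n : nat) (alpha c : R) : (1 <= n)%N -> alpha < 1 ->
  (forall (f : 'rV[Cplx R]_n -> 'rV[Cplx R]_n) (a : 'M[Cplx R]_n),
     quasi_convex_B alpha f -> second_order_form f a -> third_order_bound c f) ->
  (1 - alpha) * (3 - 2 * alpha) / 3 <= c.
Proof.
move=> hn a1 H; pose beta := 2 * (1 - alpha).
have beta0 : 0 < beta by rewrite mulr_gt0 // subr_gt0.
have -> : (1 - alpha) * (3 - 2 * alpha) / 3 = beta * (beta + 1) / 6 by rewrite /beta; field.
(* On [[0, beta]] the function [b (b + 1)] has Lipschitz constant [2 beta + 1], so an exponent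
   within [d] of [beta] loses at most [6 e]. *)
apply/ler_addgt0Pr => e e0; pose d := 6 * e / (2 * beta + 1).
have d0 : 0 < d by rewrite divr_gt0 ?mulr_gt0 // addr_gt0 // mulr_gt0.
have [s [k [b1 bb be]]] := dyadic_below beta0 d0.
have [F [hF F0 Fn ode [F1 F2 F3]]] := extremal_function b1.
move: F2 F3 ode b1 bb be; set b := s%:R / (2 ^ k)%:R => F2 F3 ode b1 bb be.
have b0 : 0 <= b by rewrite divr_ge0.
have ba : 0 <= b <= 2 * (1 - alpha) by rewrite b0.
have qc := quasi_convex_diagonal n hF F0 Fn ode F1 (alpha := alpha) ba.
have so := second_order_form_diagonal (n := n) hF F2.
have Hb := third_order_bound_diagonal hF F3 hn b0 (H _ _ qc so).
have Ed : d * (2 * beta + 1) = 6 * e by rewrite /d divfK // gt_eqF // addr_gt0 // mulr_gt0.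
have : beta * (beta + 1) - b * (b + 1) <= d * (2 * beta + 1).
  have -> : beta * (beta + 1) - b * (b + 1) = (beta - b) * (beta + b + 1) by ring.
  apply: ler_pM; rewrite ?subr_ge0 //; lra.
lra.
Qed.

Theorem theorem3p2 (R : realType) (n : nat) (hn : (1 <= n)%N)
    (alpha : R) (halpha : 0 <= alpha < 1) :
  (forall (f : 'rV[Cplx R]_n -> 'rV[Cplx R]_n) (a : 'M[Cplx R]_n),
     quasi_convex_B alpha f -> second_order_form f a ->
     third_order_bound ((1 - alpha) * (3 - 2 * alpha) / 3) f) /\
  (forall c : R,
     (forall (f : 'rV[Cplx R]_n -> 'rV[Cplx R]_n) (a : 'M[Cplx R]_n),
        quasi_convex_B alpha f -> second_order_form f a ->
        third_order_bound c f) ->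
     (1 - alpha) * (3 - 2 * alpha) / 3 <= c).
Proof.
have /andP[_ a1] := halpha; split => [f a qc so|c H].
  exact: quasi_convex_third_order_bound qc so (ltW a1).
exact: sharp_third_order_constant hn a1 H.
Qed.
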